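(* Let $\Bbbk$ be a field of characteristic zero. For every integer $n\geqslant 3$, the homology groups (with $\Bbbk$-coefficients) of the Vietoris-Rips complex $X^{n,2}$ are zero except in degrees $0$ and $3$, and \[ H_0 (X^{n,2}) \cong \{n;0\}, \] \[ H_3 (X^{n,2}) \cong \left( \bigoplus_{j=1}^{n-3} \{n-3-j; (j,1^3)\} \right) \oplus \operatorname{Ind}^{\mathfrak{H}_n}_{\mathfrak{S}_{n-3} \times \mathfrak{H}_3} \left( \{n-3\} \otimes \{1^3;0\} \right) \] \[ \cong \left( \bigoplus_{j=1}^{n-3} \{n-3-j; (j,1^3)\} \right) \oplus \left( \bigoplus_{j=0}^{1}\;\bigoplus_{i=0}^{n-3-j} \{(n-2-i-j,1^{2+j});i\} \right) \] as representations of $\mathfrak{H}_n$ (empty direct sums are zero).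
   Context: Vertices of the hypercube graph $Q_n$ are binary sequences $u=(u_1,\dots,u_n)\in\mathbb{Z}_2^n$; the Hamming distance $d(u,v)$ is the number of coordinates in which $u,v$ differ. $X^{n,r}$ is the simplicial complex whose simplices are the (nonempty) subsets $Y\subseteq \mathbb{Z}_2^n$ with $d(x,y)\leqslant r$ for all $x,y\in Y$. Homology is unreduced simplicial homology over $\Bbbk$. The hyperoctahedral group is $\mathfrak{H}_n=\mathbb{Z}_2^n\rtimes\mathfrak{S}_n$ with product $(s,\sigma)(u,\tau)=(s+\sigma u,\sigma\tau)$, where $\sigma(u_1,\dots,u_n)=(u_{\sigma^{-1}(1)},\dots,u_{\sigma^{-1}(n)})$. It acts on vertices by $(s,\sigma)u=s+\sigma u$, hence on $X^{n,r}$, its oriented chains and its homology. For $0\leqslant p\leqslant n$, $\mathfrak{S}_{n-p}\times\mathfrak{H}_p$ is identified with the subgroup of $\mathfrak{H}_n$ of elements $(s,\sigma)$ with $s\in\{0\}^{n-p}\times\mathbb{Z}_2^p$ and $\sigma(\{1,\dots,n-p\})=\{1,\dots,n-p\}$. Representations are over $\Bbbk$. For a partition $\lambda$ of $m$, $\{\lambda\}$ is the Specht module of $\mathfrak{S}_m$, with $\{m\}$ trivial and $\{1^m\}$ the sign representation. For a bipartition $(\lambda;\mu)$ of $n$ ($\lambda$ a partition of $n-k$, $\mu$ a partition of $k$), $\{\lambda;\mu\}$ is the irreducible representation of $\mathfrak{H}_n$ \[\operatorname{Ind}^{\mathfrak{H}_n}_{\mathbb{Z}_2^n\rtimes(\mathfrak{S}_{n-k}\times\mathfrak{S}_k)}\left(U_{w_k}\otimes\{\lambda\}\otimes\{\mu\}\right),\]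 where $\mathfrak{S}_{n-k}\times\mathfrak{S}_k$ permutes the first $n-k$ and last $k$ coordinates, $U_{w_k}$ is the one-dimensional space on which $s\in\mathbb{Z}_2^n$ acts by $(-1)^{s_{n-k+1}+\dots+s_n}$ and the symmetric groups act trivially, $\mathbb{Z}_2^n$ acts trivially on $\{\lambda\}$ and $\{\mu\}$, and the two symmetric groups act on $\{\lambda\}$ and $\{\mu\}$ respectively. The partition of $0$ is written $0$; an integer $m$ stands for the partition $(m)$; $a^b$ means the part $a$ repeated $b$ times. *)

(* Defs.v *)
From HB Require Import structures.
From mathcomp Require Import all_boot all_order all_algebra all_fingroup.
From mathcomp Require Import mxrepresentation character.

Set Implicit Arguments.
Unset Strict Implicit.
Unset Printing Implicit Defensive.

Import GroupScope GRing.Theory.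
Local Open Scope ring_scope.

(******************************************************************************)
(* Convention.  mathcomp composes permutations from left to right and lets    *)
(* the matrices of an mx_representation act on row vectors, on the right.     *)
(* This is followed throughout: for all groups below x * y means "x, then y", *)
(* so a left module in the usual notation is a row module v *m rG g = g.v,    *)
(* with no inverse or transpose involved.                                     *)
(******************************************************************************)

Section PermutationModule.
Variables (k : fieldType) (gT : finGroupType) (X : finType).

Definition pt (x : X) : 'rV[k]_#|X| := delta_mx 0 (enum_rank x).

Lemma pt_matrix m (f : X -> 'rV[k]_m) x :
  pt x *m (\matrix_(i < #|X|) f (enum_val i)) = f x.
Proof. by rewrite -rowE rowK enum_rankK. Qed.

Lemma matrix_pt_eq m (A B : 'M[k]_(#|X|, m)) :
  (forall x, pt x *m A = pt x *m B) -> A = B.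
Proof.
by move=> eqAB; apply/row_matrixP=> i; rewrite !rowE -(enum_valK i) eqAB.
Qed.

Variable to : {action gT &-> X}.

Definition perm_mx_rep (g : gT) : 'M[k]_#|X| :=
  \matrix_(i < #|X|) pt (to (enum_val i) g).

Lemma pt_act x g : pt x *m perm_mx_rep g = pt (to x g).
Proof. exact: (pt_matrix (fun x => pt (to x g))). Qed.

Lemma perm_mx_repr : mx_repr [set: gT] perm_mx_rep.
Proof.
split=> [|g h _ _]; apply: matrix_pt_eq => x.
  by rewrite pt_act act1 mulmx1.
by rewrite mulmxA !pt_act actM.
Qed.

Definition permutation_repr := MxRepresentation perm_mx_repr.

End PermutationModule.
Arguments pt k {X} x.

(* An oriented i-chain of K is viewed, as usual, as an alternating function   *)
(* on the orderings x_0, ..., x_i of the i-simplices of K; thus it is a       *)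
(* vector of the permutation module on (i+1)-tuples of vertices.              *)
Section SimplicialHomology.
Variables (k : fieldType) (V : finType) (K : {set {set V}}).

Notation tup i := {ffun 'I_i.+1 -> V}.

Definition is_osimplex i (x : tup i) := injectiveb x && (x @: 'I_i.+1 \in K).

(* The oriented simplex [x_0, ..., x_i]. *)
Definition osimplex i (x : tup i) : 'rV[k]_#|{: tup i}| :=
  \sum_(s : 'S_i.+1) (-1) ^+ s *: pt k ([ffun j => x (s j)] : tup i).

Definition chains i : 'M[k]_#|{: tup i}| :=
  (\sum_(x : tup i | is_osimplex x) <<osimplex x>>)%MS.

Definition face i (h : 'I_i.+2) (x : tup i.+1) : tup i :=
  [ffun j => x (lift h j)].

(* On alternating functions the boundary is                                   *)
(*   (d c)(y_0, ..., y_i) = \sum_v c(v, y_0, ..., y_i);                       *)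
(* osimplex_boundary shows that this is the usual alternating sum of faces.   *)
Definition boundary i : 'M[k]_(#|{: tup i.+1}|, #|{: tup i}|) :=
  \matrix_(a < #|{: tup i.+1}|) pt k (face ord0 (enum_val a)).

Lemma osimplex_perm i (x : tup i) (s : 'S_i.+1) :
  osimplex ([ffun j => x (s j)] : tup i) = (-1) ^+ s *: osimplex x.
Proof.
rewrite /osimplex scaler_sumr [RHS](reindex_inj (mulIg s)) /=.
apply: eq_bigr => t _.
rewrite scalerA odd_permM signr_addb mulrCA -signr_addb addbb mulr1.
by congr (_ *: pt _ _); apply/ffunP=> j; rewrite !ffunE permM.
Qed.

Lemma osimplex_boundary i (x : tup i.+1) :
  osimplex x *m boundary i = \sum_(h < i.+2) (-1) ^+ h *: osimplex (face h x).
Proof.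
rewrite /osimplex mulmx_suml.
rewrite (partition_big (fun s : 'S_i.+2 => s ord0) xpredT) //=.
apply: eq_bigr => h _; rewrite scaler_sumr.
pose ulsf (s : 'S_i.+2) j := odflt j (unlift (s ord0) (s (lift ord0 j))).
have ulsfK (s : 'S_i.+2) j : lift (s ord0) (ulsf s j) = s (lift ord0 j).
  rewrite /ulsf; have := neq_lift ord0 j.
  by rewrite -(can_eq (permK s)) => /unlift_some[] ? ? ->.
have ulsf_inj s : injective (ulsf s).
  move=> j1 j2 eq_j; apply: (@lift_inj _ ord0); apply: (@perm_inj _ s).
  by rewrite -!ulsfK eq_j.
rewrite (reindex (lift_perm ord0 h)) /=; last first.
  exists (fun s => perm (ulsf_inj s)) => [s _ | s].
    by apply/permP=> j; rewrite permE /ulsf lift_perm_lift lift_perm_id liftK.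
  move/(s _ =P _) => sh; apply/permP=> j.
  case: (unliftP ord0 j) => [j'|] ->; rewrite ?lift_perm_id //.
  by rewrite lift_perm_lift -sh permE ulsfK.
apply: eq_big => [s|s _]; first by rewrite lift_perm_id eqxx.
rewrite -scalemxAl (pt_matrix (fun z : tup i.+1 => pt k (face ord0 z))).
rewrite scalerA odd_lift_perm /= signr_addb signr_odd.
congr (_ *: pt _ _); apply/ffunP=> j; rewrite !ffunE.
by rewrite lift_perm_lift.
Qed.

Definition cycles i : 'M[k]_#|{: tup i}| :=
  match i return 'M[k]_#|{: tup i}| with
  | 0 => chains 0
  | j.+1 => (chains j.+1 :&: kermx (boundary j))%MS
  end.

Definition boundaries i : 'M[k]_#|{: tup i}| :=
  (<<chains i.+1 *m boundary i>>)%MS.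

Lemma boundaryK i (x : tup i.+2) :
  osimplex x *m boundary i.+1 *m boundary i = 0.
Proof.
pose r : 'S_i.+3 := tperm ord0 (lift ord0 ord0).
have odd_r : r = true :> bool by rewrite odd_tperm.
rewrite /osimplex !mulmx_suml (bigID (fun s : 'S_i.+3 => s : bool)) /=.
rewrite [X in _ + X](reindex_inj (mulgI r)) /=.
rewrite [X in _ + X](eq_bigl (fun s : 'S_i.+3 => s : bool)) => [|s]; last first.
  by rewrite odd_permM odd_r negbK.
rewrite -big_split big1 //= => s _.
rewrite -!scalemxAl !(pt_matrix (fun z : tup i.+2 => pt k (face ord0 z))).
rewrite !(pt_matrix (fun z : tup i.+1 => pt k (face ord0 z))).
rewrite odd_permM odd_r signr_addb mulN1r.
rewrite scaleNr; apply/eqP; rewrite subr_eq0; apply/eqP.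
congr (_ *: pt _ _); apply/ffunP=> j; rewrite !ffunE permM.
by rewrite tpermD // (inj_eq lift_inj) neq_lift.
Qed.

(* For a simplicial complex K the boundaries are cycles. *)
Lemma boundaries_sub_cycles i :
    (forall A B : {set V}, A \in K -> B \subset A -> B != set0 -> B \in K) ->
  (boundaries i <= cycles i)%MS.
Proof.
move=> downK; rewrite /boundaries genmxE /chains sumsmxMr_gen.
apply/sumsmx_subP=> x /andP[injx Kx]; rewrite genmxE (eqmxMr _ (genmxE _)).
have sub_chains : (osimplex x *m boundary i <= chains i)%MS.
  rewrite osimplex_boundary summx_sub // => h _; rewrite scalemx_sub //.
  rewrite (sumsmx_sup (face h x)) ?genmxE // /is_osimplex; apply/andP; split.
    apply/injectiveP=> j1 j2; rewrite !ffunE => /(injectiveP _ injx).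
    exact: lift_inj.
  apply: downK Kx _ _.
    by apply/subsetP=> _ /imsetP[j _ ->]; rewrite ffunE imset_f.
  by apply/set0Pn; exists (face h x ord0); rewrite imset_f.
case: i x {injx Kx} sub_chains => [|i] x sub_chains //=.
by rewrite sub_capmx sub_chains; apply/sub_kermxP; rewrite boundaryK.
Qed.

Variables (gT : finGroupType) (to : {action gT &-> V}).

Definition tuple_act i (x : tup i) (g : gT) : tup i := [ffun j => to (x j) g].

Lemma tuple_act1 i : (@tuple_act i)^~ 1%g =1 id.
Proof. by move=> x; apply/ffunP=> j; rewrite ffunE act1. Qed.

Lemma tuple_actM i (x : tup i) : act_morph (@tuple_act i) x.
Proof. by move=> g h; apply/ffunP=> j; rewrite !ffunE actM. Qed.

Definition tuple_action i := TotalAction (@tuple_act1 i) (@tuple_actM i).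

Definition tuple_repr i := permutation_repr k (tuple_action i).

Lemma osimplex_act i (x : tup i) g :
  osimplex x *m tuple_repr i g = osimplex (tuple_act x g).
Proof.
rewrite /osimplex mulmx_suml; apply: eq_bigr => s _.
rewrite -scalemxAl pt_act; congr (_ *: pt _ _).
by apply/ffunP=> j; rewrite !ffunE.
Qed.

Lemma boundary_act i g :
  boundary i *m tuple_repr i g = tuple_repr i.+1 g *m boundary i.
Proof.
apply: matrix_pt_eq => x.
rewrite !mulmxA pt_act !(pt_matrix (fun z : tup i.+1 => pt k (face ord0 z))).
by rewrite pt_act; congr (pt _ _); apply/ffunP=> j; rewrite !ffunE.
Qed.

Hypothesis actsK : [acts [set: gT], on K | to^*].

Lemma is_osimplex_act i (x : tup i) g :
  is_osimplex (tuple_act x g) = is_osimplex x.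
Proof.
rewrite /is_osimplex; congr (_ && _).
  apply/injectiveP/injectiveP => injx j1 j2 eq_j; apply: injx.
    by rewrite !ffunE eq_j.
  by apply: (act_inj to g); move: eq_j; rewrite !ffunE.
have <- := acts_act actsK (in_setT g) (x @: 'I_i.+1); congr (_ \in K).
by rewrite /= /setact -imset_comp; apply: eq_imset => j; rewrite ffunE.
Qed.

Lemma chains_module i : mxmodule (tuple_repr i) (chains i).
Proof.
apply/mxmoduleP=> g _; rewrite /chains sumsmxMr; apply/sumsmx_subP=> x Kx.
rewrite (eqmxMr _ (genmxE _)) osimplex_act (sumsmx_sup (tuple_act x g)) //.
  by rewrite is_osimplex_act.
by rewrite genmxE.
Qed.

Lemma cycles_module i : mxmodule (tuple_repr i) (cycles i).
Proof.
case: i => [|i]; first exact: chains_module.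
apply: capmx_module; first exact: chains_module.
apply/mxmoduleP=> g _; apply/sub_kermxP.
by rewrite -mulmxA -boundary_act mulmxA mulmx_ker mul0mx.
Qed.

Lemma boundaries_module i : mxmodule (tuple_repr i) (boundaries i).
Proof.
rewrite /boundaries (eqmx_module _ (genmxE _)); apply/mxmoduleP=> g _.
rewrite -mulmxA boundary_act mulmxA submxMr //.
exact: (mxmoduleP (chains_module i.+1)).
Qed.

(* section_repr modB modZ is the representation on the quotient Z / B. *)
Definition homology_repr i : representation k [set: gT] :=
  Representation (section_repr (boundaries_module i) (cycles_module i)).

End SimplicialHomology.

Section Induction.
Variables (k : fieldType) (gT : finGroupType) (H : {group gT}).
Variables (d : nat) (rH : mx_representation k H d).

Notation index := #|rcosets H [set: gT]|.

Definition transversal_elt (i : 'I_index) : gT := repr (enum_val i : {set gT}).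

(* The matrix of g on the direct sum of the V (x) t_i, for a right transversal*)
(* t_i of H, where V is the module of rH.                                     *)
Definition ind_mx (g : gT) : 'M[k]_(\sum_(i < index) d) :=
  \mxblock_(i < index, j < index)
    (let h := (transversal_elt i * g * (transversal_elt j)^-1)%g in
     if h \in H then rH h else 0).

Lemma transversal_coset i : H :* transversal_elt i = enum_val i.
Proof.
have /rcosetsP[x _ def_i] := enum_valP i.
rewrite /transversal_elt def_i; apply: rcoset_eqP.
exact: mem_repr_rcoset.
Qed.

Lemma transversal_eltP x i :
  ((x * (transversal_elt i)^-1)%g \in H) = (enum_val i == H :* x).
Proof.
rewrite -mem_rcoset -transversal_coset eq_sym.
by apply/idP/eqP => [/rcoset_eqP | <-] //; exact: rcoset_refl.
Qed.

Lemma transversal_index x : {i : 'I_index | enum_val i = H :* x}.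
Proof.
have Hx : H :* x \in rcosets H [set: gT] by rewrite mem_rcosets mulSGid ?subsetT ?inE.
by exists (enum_rank_in Hx (H :* x)); rewrite enum_rankK_in.
Qed.

Lemma ind_mx_repr : mx_repr [set: gT] ind_mx.
Proof.
split=> [|g h _ _].
  rewrite /ind_mx -mxdiagZ; apply/eq_mxblock => i j /=.
  rewrite mulg1 transversal_eltP transversal_coset.
  rewrite (inj_eq enum_val_inj) eq_sym; case: eqVneq => [->|//].
  by rewrite mulgV repr_mx1 conform_mx_id.
rewrite /ind_mx mul_mxblock; apply/eq_mxblock => i j /=.
set ti := transversal_elt i; set tj := transversal_elt j.
have [l def_l] := transversal_index (ti * g)%g.
have Hl : ((ti * g * (transversal_elt l)^-1)%g \in H).
  by rewrite transversal_eltP def_l.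
rewrite (bigD1 l) //= Hl big1 ?addr0 => [|m neq_ml]; last first.
  rewrite transversal_eltP -def_l (inj_eq enum_val_inj) (negPf neq_ml).
  by rewrite mul0mx.
have -> : (ti * (g * h) * tj^-1 = (ti * g * (transversal_elt l)^-1)
           * (transversal_elt l * h * tj^-1))%g by rewrite !mulgA mulgKV.
by rewrite groupMl //; case: ifP => Hr; [rewrite (repr_mxM rH Hl Hr) | rewrite mulmx0].
Qed.

Definition induced_repr := MxRepresentation ind_mx_repr.

End Induction.

(* The Specht module of the partition lam of m.  The boxes of lam are         *)
(* numbered 0, ..., m-1 along the rows; box p lies in row reshape_index lam p *)
(* and column reshape_offset lam p.  A tableau is a permutation t, with entry *)
(* t p in box p, and a tabloid maps each entry to the index of its row.       *)
Section Specht.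
Variables (k : fieldType) (m : nat) (lam : seq nat).

Notation tabloid := {ffun 'I_m -> 'I_(size lam).+1}.

Definition tabloid_act (T : tabloid) (s : 'S_m) : tabloid :=
  [ffun x => T (s^-1 x)%g].

Lemma tabloid_act1 : tabloid_act^~ 1%g =1 id.
Proof. by move=> T; apply/ffunP=> x; rewrite ffunE invg1 perm1. Qed.

Lemma tabloid_actM T : act_morph tabloid_act T.
Proof. by move=> s t; apply/ffunP=> x; rewrite !ffunE invMg permM. Qed.

Definition tabloid_action := TotalAction tabloid_act1 tabloid_actM.

Definition tabloid_repr := permutation_repr k tabloid_action.

Definition tabloid_of (t : 'S_m) : tabloid :=
  [ffun x => inord (reshape_index lam (t^-1 x)%g)].

Definition tableau_col (t : 'S_m) (x : 'I_m) := reshape_offset lam (t^-1 x)%g.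

Definition col_stab (t : 'S_m) : {set 'S_m} :=
  [set s : 'S_m | [forall x, tableau_col t (s x) == tableau_col t x]].

Definition polytabloid (t : 'S_m) : 'rV[k]_#|{: tabloid}| :=
  \sum_(s in col_stab t) (-1) ^+ s *: pt k (tabloid_act (tabloid_of t) s).

Definition specht_mx : 'M[k]_#|{: tabloid}| :=
  (\sum_(t : 'S_m) <<polytabloid t>>)%MS.

Lemma polytabloid_act t u :
  polytabloid t *m tabloid_repr u = polytabloid (t * u)%g.
Proof.
have colE s x : tableau_col (t * u)%g ((s ^ u)%g (u x)) = tableau_col t (s x).
  by rewrite permJ /tableau_col invMg permM permK.
have colE1 x : tableau_col (t * u)%g (u x) = tableau_col t x.
  by rewrite /tableau_col invMg permM permK.
rewrite /polytabloid mulmx_suml [RHS](reindex_inj (conjg_inj u)) /=.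
apply: eq_big => [s|s _].
  rewrite !inE; apply/forallP/forallP => eq_col x.
    by rewrite -[x](permKV u) colE colE1 eq_col.
  by have := eq_col (u x); rewrite colE colE1.
rewrite -scalemxAl pt_act odd_permJ; congr (_ *: pt _ _).
rewrite /= -tabloid_actM conjgC tabloid_actM; congr (tabloid_act _ _).
by apply/ffunP=> x; rewrite !ffunE invMg permM.
Qed.

Lemma specht_module : mxmodule tabloid_repr specht_mx.
Proof.
apply/mxmoduleP=> u _; rewrite /specht_mx sumsmxMr; apply/sumsmx_subP=> t _.
rewrite (eqmxMr _ (genmxE _)) polytabloid_act (sumsmx_sup (t * u)%g) //.
by rewrite genmxE.
Qed.

Definition specht_repr := submod_repr specht_module.

End Specht.

Record hyperoct (n : nat) :=
  Hyperoct { hshift : 'rV['Z_2]_n; hperm : 'S_n }.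

Section Hyperoctahedral.
Variable n : nat.
Implicit Types (u : 'rV['Z_2]_n) (g : hyperoct n).

Definition hyperoct_pair g := (hshift g, hperm g).
Definition pair_hyperoct p : hyperoct n := Hyperoct p.1 p.2.
Lemma hyperoct_pairK : cancel hyperoct_pair pair_hyperoct.
Proof. by case. Qed.

HB.instance Definition _ := Finite.copy (hyperoct n) (can_type hyperoct_pairK).

(* (s . u)_i = u_(s^-1 i). *)
Definition perm_coord (s : 'S_n) u : 'rV['Z_2]_n := \row_i u 0 (s^-1 i)%g.

(* The textbook product (s,sigma)(u,tau) = (s + sigma u, sigma o tau); the    *)
(* composite sigma o tau is tau * sigma in mathcomp.  The group law on        *)
(* hyperoct n is this product with the factors exchanged, as for permutations.*)
Definition hyperoct_comp g h : hyperoct n :=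
  Hyperoct (hshift g + perm_coord (hperm g) (hshift h)) (hperm h * hperm g)%g.

Definition hyperoct_mul g h := hyperoct_comp h g.
Definition hyperoct_one : hyperoct n := Hyperoct 0 1%g.
Definition hyperoct_inv g : hyperoct n :=
  Hyperoct (- perm_coord (hperm g)^-1 (hshift g)) (hperm g)^-1.

Lemma perm_coord1 u : perm_coord 1 u = u.
Proof. by apply/rowP=> i; rewrite mxE invg1 perm1. Qed.

Lemma perm_coordM s t u : perm_coord (s * t)%g u = perm_coord t (perm_coord s u).
Proof. by apply/rowP=> i; rewrite !mxE invMg permM. Qed.

Lemma perm_coordD s u v : perm_coord s (u + v) = perm_coord s u + perm_coord s v.
Proof. by apply/rowP=> i; rewrite !mxE. Qed.

Lemma perm_coord0 s : perm_coord s 0 = 0.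
Proof. by apply/rowP=> i; rewrite !mxE. Qed.

Lemma hyperoct_mulA : associative hyperoct_mul.
Proof.
move=> x y z; rewrite /hyperoct_mul /hyperoct_comp /=.
by rewrite perm_coordD perm_coordM addrA mulgA.
Qed.

Lemma hyperoct_mul1 : left_id hyperoct_one hyperoct_mul.
Proof.
case=> u s; rewrite /hyperoct_mul /hyperoct_comp /=.
by rewrite perm_coord0 addr0 mul1g.
Qed.

Lemma hyperoct_mulV : left_inverse hyperoct_one hyperoct_inv hyperoct_mul.
Proof.
case=> u s; rewrite /hyperoct_mul /hyperoct_comp /= mulVg.
congr Hyperoct; apply/rowP=> i.
by rewrite !mxE invgK permKV subrr.
Qed.

HB.instance Definition _ := Finite_isGroup.Build (hyperoct n)
  hyperoct_mulA hyperoct_mul1 hyperoct_mulV.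

Lemma hpermM g h : hperm (g * h)%g = (hperm g * hperm h)%g.
Proof. by []. Qed.

Lemma hshiftM g h :
  hshift (g * h)%g = hshift h + perm_coord (hperm h) (hshift g).
Proof. by []. Qed.

Definition vertex_act u g := hshift g + perm_coord (hperm g) u.

Lemma vertex_act1 : vertex_act^~ 1%g =1 id.
Proof. by move=> u; rewrite /vertex_act perm_coord1 add0r. Qed.

Lemma vertex_actM u : act_morph vertex_act u.
Proof.
by move=> g h; rewrite /vertex_act hshiftM perm_coordD perm_coordM addrA.
Qed.

Definition vertex_action := TotalAction vertex_act1 vertex_actM.

Definition hamming (u v : 'rV['Z_2]_n) : nat := #|[set i | u 0 i != v 0 i]|.

Definition rips (r : nat) : {set {set 'rV['Z_2]_n}} :=
  [set Y : {set 'rV['Z_2]_n} |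
    (Y != set0) && [forall x in Y, forall y in Y, (hamming x y <= r)%N]].

Lemma hamming_act u v g : hamming (vertex_act u g) (vertex_act v g) = hamming u v.
Proof.
rewrite /hamming -[RHS](card_imset _ (@perm_inj _ (hperm g))).
congr #|pred_of_set _|; apply/setP=> i.
rewrite -[i](permKV (hperm g)) mem_imset ?inE; last exact: perm_inj.
by rewrite !mxE permK (inj_eq (addrI _)).
Qed.

Lemma rips_acts r : [acts [set: hyperoct n], on rips r | vertex_action^*].
Proof.
apply/subsetP=> g _; rewrite !inE /=; apply/subsetP=> Y; rewrite !inE /=.
case/andP=> nzY /forall_inP diamY; rewrite /setact imset_eq0 nzY /=.
apply/forall_inP=> _ /imsetP[x Yx ->]; apply/forall_inP=> _ /imsetP[y Yy ->].
by rewrite hamming_act; apply: (forall_inP (diamY x Yx)).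
Qed.

End Hyperoctahedral.

Lemma rips_down n r (A B : {set 'rV['Z_2]_n}) :
  A \in rips n r -> B \subset A -> B != set0 -> B \in rips n r.
Proof.
rewrite !inE => /andP[_ /forall_inP diamA] /subsetP sBA -> /=.
apply/forall_inP=> x Bx; apply/forall_inP=> y By.
by apply: (forall_inP (diamA x _)); exact: sBA.
Qed.

Definition rips_homology (k : fieldType) (n r i : nat) :
    representation k [set: hyperoct n] :=
  homology_repr k (@rips_acts n r) i.

Section Blocks.
Variables n p : nat.

Definition first_coords : {set 'I_n} := [set i : 'I_n | (i < n - p)%N].

(* Z_2^n >< (S_(n-p) x S_p) *)
Definition young_set : {set hyperoct n} :=
  [set g : hyperoct n | hperm g @: first_coords == first_coords].

(* S_(n-p) x H_p *)
Definition sym_hyp_set : {set hyperoct n} :=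
  [set g in young_set | [forall i in first_coords, hshift g 0 i == 0]].

Lemma young_setP g :
  reflect (forall i, (hperm g i < n - p)%N = (i < n - p)%N) (g \in young_set).
Proof.
rewrite inE; apply: (iffP eqP) => [fixg i | fixg].
  have -> : (i < n - p)%N = (i \in first_coords) by rewrite inE.
  by rewrite -(mem_imset _ _ (@perm_inj _ (hperm g))) fixg inE.
apply/setP=> i; rewrite -[i](permKV (hperm g)) mem_imset; last exact: perm_inj.
by rewrite !inE fixg.
Qed.

Lemma young_group_set : group_set young_set.
Proof.
apply/group_setP; split=> [|g h /young_setP fixg /young_setP fixh].
  by apply/young_setP=> i; rewrite perm1.
by apply/young_setP=> i; rewrite hpermM permM fixh fixg.
Qed.
Definition young_group := Group young_group_set.

Lemma sym_hyp_group_set : group_set sym_hyp_set.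
Proof.
apply/group_setP; split=> [|g h].
  apply/setIdP; split; first exact: (group1 young_group).
  by apply/forall_inP=> i _; rewrite mxE.
case/setIdP=> Yg /forall_inP s0g /setIdP[Yh /forall_inP s0h].
apply/setIdP; split; first exact: (groupM (G := young_group)).
apply/forall_inP=> i; rewrite inE => lt_i.
rewrite hshiftM !mxE (eqP (s0h i _)) ?inE // add0r s0g // inE.
by have /young_setP fixh := Yh; rewrite -fixh permKV.
Qed.
Definition sym_hyp_group := Group sym_hyp_group_set.

Lemma sym_hyp_sub : sym_hyp_group \subset young_group.
Proof. by apply/subsetP=> g /setIdP[]. Qed.

End Blocks.

(* The block of the coordinates off, ..., off + m - 1, renumbered from 0.     *)
Section BlockMap.
Variables n off m : nat.

Definition block_vec (u : 'rV['Z_2]_n) : 'rV['Z_2]_m :=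
  \row_(j < m) oapp (u 0) 0 (insub (off + j)%N : option 'I_n).

Definition block_fun (s : 'S_n) : {ffun 'I_m -> 'I_m} :=
  [ffun j : 'I_m => odflt j (obind (fun i : 'I_n => insub (s i - off)%N)
                                   (insub (off + j)%N))].

(* The default value 1 is never used when s preserves the block. *)
Definition block_perm (s : 'S_n) : 'S_m := insubd (1%g : 'S_m) (block_fun s).

Definition block_map (g : hyperoct n) : hyperoct m :=
  Hyperoct (block_vec (hshift g)) (block_perm (hperm g)).

Definition block_fix (s : 'S_n) :=
  forall i, (off <= s i < off + m)%N = (off <= i < off + m)%N.

Lemma block_vecE u (i : 'I_n) (j : 'I_m) :
  i = (off + j)%N :> nat -> block_vec u 0 j = u 0 i.
Proof.
move=> def_i; rewrite mxE; case: insubP => [i' _ def_i'|].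
  by congr (u 0 _); apply: val_inj; rewrite /= def_i.
by rewrite -def_i ltn_ord.
Qed.

Lemma block_vec_out u (j : 'I_m) : (n <= off + j)%N -> block_vec u 0 j = 0.
Proof. by move=> le_n; rewrite mxE insubF // ltnNge le_n. Qed.

Lemma block_funE s (i : 'I_n) (j : 'I_m) : block_fix s ->
  i = (off + j)%N :> nat -> s i = (off + block_fun s j)%N :> nat.
Proof.
move=> fixs def_i.
have /andP[le_s lt_s] : (off <= s i < off + m)%N.
  by rewrite fixs def_i leq_addr ltn_add2l /=.
rewrite ffunE; case: insubP => [i' _ def_i'|]; last by rewrite -def_i ltn_ord.
have -> : i' = i by apply: val_inj; rewrite /= def_i.
rewrite /= insubT /= ?subnKC // ltn_subLR //.
Qed.

Lemma block_fun_out s (j : 'I_m) : (n <= off + j)%N -> block_fun s j = j.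
Proof. by move=> le_n; rewrite ffunE insubF // ltnNge le_n. Qed.

Lemma block_fun_inj s : block_fix s -> injectiveb (block_fun s).
Proof.
move=> fixs; apply/injectiveP=> j1 j2 eq_j.
have case_j (j : 'I_m) : (n <= off + j)%N \/ exists i : 'I_n, i = (off + j)%N :> nat.
  case: (leqP n (off + j)%N) => lt_j; first by left.
  by right; exists (Ordinal lt_j).
case: (case_j j1) (case_j j2) => [out1 | [i1 def1]] [out2 | [i2 def2]].
- by move: eq_j; rewrite !block_fun_out.
- have := block_funE fixs def2; rewrite -eq_j block_fun_out // => eq_s.
  by move: out1; rewrite -eq_s leqNgt ltn_ord.
- have := block_funE fixs def1; rewrite eq_j block_fun_out // => eq_s.
  by move: out2; rewrite -eq_s leqNgt ltn_ord.
apply: val_inj; apply: (@addnI off); rewrite -def1 -def2; congr val.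
apply: (@perm_inj _ s); apply: val_inj.
by rewrite /= (block_funE fixs def1) eq_j (block_funE fixs def2).
Qed.

Lemma block_permE s (i : 'I_n) (j : 'I_m) : block_fix s ->
  i = (off + j)%N :> nat -> s i = (off + block_perm s j)%N :> nat.
Proof.
move=> fixs def_i; rewrite (block_funE fixs def_i) /block_perm -pvalE.
by rewrite val_insubd block_fun_inj.
Qed.

Lemma block_perm_out s (j : 'I_m) :
  block_fix s -> (n <= off + j)%N -> block_perm s j = j.
Proof.
move=> fixs le_n; rewrite /block_perm -pvalE val_insubd block_fun_inj //.
exact: block_fun_out.
Qed.


End BlockMap.

Lemma block_fix_first n p g : g \in young_group n p -> block_fix 0 (n - p) (hperm g).
Proof. by move/young_setP=> fixg i; rewrite !add0n fixg. Qed.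

Lemma block_fix_last n p g : g \in young_group n p -> block_fix (n - p) p (hperm g).
Proof.
move/young_setP=> fixg i; rewrite !(leqNgt (n - p)) fixg.
have le_n: (n <= n - p + p)%N by rewrite addnC -leq_subLR.
by rewrite !(leq_trans (ltn_ord _) le_n).
Qed.

Section BlockMorphisms.
Variables n off m : nat.

Lemma block_permM (s t : 'S_n) : block_fix off m s -> block_fix off m t ->
  block_perm off m (s * t) = (block_perm off m s * block_perm off m t)%g.
Proof.
move=> fixs fixt.
have fixst : block_fix off m (s * t) by move=> i; rewrite permM fixt fixs.
apply/permP=> j; rewrite permM.
case: (leqP n (off + j)%N) => [le_n | lt_n].
  by rewrite !block_perm_out.
have def_i : Ordinal lt_n = (off + j)%N :> nat by [].
apply: val_inj; apply: (@addnI off) => /=.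
rewrite -(block_permE fixst def_i) permM.
by rewrite (block_permE fixt (block_permE fixs def_i)).
Qed.

Lemma block_mapM (D : {group hyperoct n}) :
    {in D, forall g, block_fix off m (hperm g)} ->
  {in D &, {morph @block_map n off m : g h / (g * h)%g}}.
Proof.
move=> fixD g h Dg Dh; have [fixg fixh] := (fixD g Dg, fixD h Dh).
have eq_perm : block_perm off m (hperm (g * h)%g)
  = (block_perm off m (hperm g) * block_perm off m (hperm h))%g.
  by rewrite hpermM block_permM.
rewrite /block_map eq_perm; congr Hyperoct; apply/rowP=> j.
rewrite [RHS]mxE [X in _ = _ + X]mxE /=.
rewrite -[j](permKV (block_perm off m (hperm h))) permK.
set j' := ((block_perm off m (hperm h))^-1)%g j; case: (leqP n (off + j')%N) => [le_n | lt_n].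
  by rewrite block_perm_out // !block_vec_out // addr0.
have def_i : Ordinal lt_n = (off + j')%N :> nat by [].
have def_hi := block_permE fixh def_i.
rewrite (block_vecE _ def_hi) (block_vecE _ def_hi) (block_vecE _ def_i).
by rewrite !mxE permK.
Qed.

End BlockMorphisms.

Section Bipartitions.
Variables (k : fieldType) (n p : nat).

Definition first_block (g : hyperoct n) : 'S_(n - p) :=
  hperm (block_map 0 (n - p) g).
Definition last_block (g : hyperoct n) : hyperoct p := block_map (n - p) p g.
Definition last_block_perm (g : hyperoct n) : 'S_p := hperm (last_block g).

Lemma first_blockM : {in young_group n p &, {morph first_block : g h / (g * h)%g}}.
Proof.
move=> g h Yg Yh; rewrite /first_block.
by rewrite (block_mapM (@block_fix_first n p)).
Qed.
Canonical first_block_morphism := Morphism first_blockM.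

Lemma last_blockM : {in young_group n p &, {morph last_block : g h / (g * h)%g}}.
Proof. exact: (block_mapM (@block_fix_last n p)). Qed.
Canonical last_block_morphism := Morphism last_blockM.

Lemma last_block_permM :
  {in young_group n p &, {morph last_block_perm : g h / (g * h)%g}}.
Proof. by move=> g h Yg Yh; rewrite /last_block_perm last_blockM. Qed.
Canonical last_block_perm_morphism := Morphism last_block_permM.

Definition sign_mx (g : hyperoct n) : 'M[k]_1 :=
  (\prod_(i < n | (n - p <= i)%N) (-1) ^+ hshift g 0 i)%:M.

Lemma sign_mx_repr : mx_repr (young_group n p) sign_mx.
Proof.
have signZ2 (a b : 'Z_2) : (-1) ^+ (a + b)%R = (-1) ^+ a * (-1) ^+ b :> k.
  by rewrite -exprD -signr_odd -[RHS]signr_odd /= modn2 oddb.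
split=> [|g h _ /young_setP fixh].
  by rewrite /sign_mx big1 // => i _; rewrite mxE.
rewrite /sign_mx -scalar_mxM; congr _%:M; rewrite mulrC hshiftM.
rewrite [X in _ = _ * X](reindex_inj (@perm_inj _ (hperm h)^-1%g)) /=.
have fixVh i : (n - p <= (hperm h)^-1%g i)%N = (n - p <= i)%N.
  by rewrite !(leqNgt (n - p)) -fixh permKV.
rewrite (eq_bigl _ _ fixVh) -big_split /=; apply: eq_bigr => i _.
by rewrite !mxE signZ2.
Qed.

(* The character U_(w_p). *)
Definition sign_repr := MxRepresentation sign_mx_repr.

End Bipartitions.

(* Pullback along a morphism, as a representation of its full domain. *)
Definition pullback_repr (k : fieldType) (aT rT : finGroupType)
    (D : {group aT}) (f : {morphism D >-> rT}) d
    (rG : mx_representation k [set: rT] d) : mx_representation k D d :=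
  eqg_repr (morphpre_repr f rG) (introT eqP (morphpreT f)).

(* {lam; mu} for a partition lam of n - k and a partition mu of k. *)
Definition bipartition_repr (k : fieldType) (n : nat) (lam mu : seq nat) :
    representation k [set: hyperoct n] :=
  let p := sumn mu in
  Representation (induced_repr
    (prod_repr (prod_repr (sign_repr k n p)
       (pullback_repr (first_block_morphism n p) (specht_repr k (n - p) lam)))
       (pullback_repr (last_block_perm_morphism n p) (specht_repr k p mu)))).

(* Ind from S_(n-p) x H_p to H_n of {lam} (x) {mu; nu}. *)
Definition ind_sym_hyp_repr (k : fieldType) (n p : nat) (lam mu nu : seq nat) :
    representation k [set: hyperoct n] :=
  Representation (induced_repr (subg_repr
    (prod_repr
       (pullback_repr (first_block_morphism n p) (specht_repr k (n - p) lam))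
       (pullback_repr (last_block_morphism n p) (bipartition_repr k p mu nu)))
    (sym_hyp_sub n p))).

(* The integer m as a partition: one part, or none if m = 0. *)
Definition int_part (m : nat) : seq nat := nseq (0 < m)%N m.

(* Main.v *)
Require Import Defs.
From mathcomp Require Import all_boot all_order all_algebra all_fingroup.
From mathcomp Require Import mxrepresentation character.
From mathcomp Require Import zify ring.

(* Every simplex of X^{n,2} with three vertices, or with at least five, lies in *)
(* one star {v, v + e_1, ..., v + e_n}, and these stars are full simplices; the *)
(* only other simplices are the maximal "special" tetrahedra                    *)
(*   {v + e_a, v + e_b, v + e_c, v + e_a + e_b + e_c}.                          *)
(* A cycle of degree >= 3 carried by the stars splits into cycles of the stars, *)
(* hence bounds; in degrees 1 and 2 the obstruction to filling star by star is  *)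
(* removed by special tetrahedra and by edges shared by stars, which are found  *)
(* one character of Z_2^n at a time.  A class of degree 3 is thus determined by *)
(* its values f(v; a, b, c) on the special tetrahedra, and the functions that   *)
(* occur are the alternating ones invariant under v -> v + e_a + e_b for which  *)
(* sum_c f(v; a, b, c) is invariant under v -> v + e_a.                         *)
(*   Split f by the sign s with which v -> v + e_a acts.  For s = -1, the       *)
(* component of f at the character w of Z_2^n is a cycle of the full simplex on *)
(* w, and these cycles form the hook (j, 1^3).  For s = 1, f is an alternating  *)
(* function on the 3-dimensional faces of the cube, which is the induced        *)
(* module; its component at w is any 2-chain of the full simplex on the         *)
(* complement of w, i.e., the sum of a cycle, giving the hook (m, 1^3), and a   *)
(* coboundary of a cycle, giving (m, 1^2).                                      *)
(*   All the isomorphisms are obtained by showing that two representations      *)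
(* embed onto the same subspace of one permutation module.                      *)

Set Implicit Arguments.
Unset Strict Implicit.
Unset Printing Implicit Defensive.

Import GroupScope GRing.Theory.
Local Open Scope ring_scope.

(** The complex is glued from two kinds of maximal pieces: the stars, which are full simplices on
    the vertices [phi v a], and the special tetrahedra. A triangle lies in exactly one star
    ([triangle_star], [star_uniq]) and in exactly one special tetrahedron, while an edge lies in two
    stars. Stars are acyclic ([full_exact]), so homology only records how the pieces are glued.

    In degrees at least 4 every simplex lies in a star, and a cycle splits into cycles of the stars
    ([homology_high]). In degrees 1 and 2 the pieces of a cycle in the stars need not be cycles; a
    family of chains with the same boundaries is built over each character of Z_2^n
    ([fill_vertices], [fill_edges]). Its sum over the stars is zero in degree 1 ([starsum_edge0])
    and bounds a chain of special tetrahedra in degree 2 ([special_chain_boundary]), so subtracting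
    it leaves cycles of the stars. Degree 0 is connectedness of the cube ([homology0]).

    In degree 3 a cycle is sent to its values on the special tetrahedra by [cube_map]. Since
    4-simplices lie in stars, this kills boundaries; conversely a cycle that it kills is carried by
    the stars and bounds ([cube_map_kernel]). The image is [cube_image] ([cube_map_onto]), so H_3
    becomes an explicit space of functions f(v; a, b, c), which is split by the sign of the shift v
    -> v + e_a ([cube_image_split]).

    For sign -1 the component at the character w is a 2-cycle of the full simplex on w. Such cycles
    form a hook Specht module, because a hook polytabloid is the boundary of the simplex on its
    first column ([embeds_hook]); this gives [embeds_hooks]. For sign 1 there are two descriptions.
    The functions are those on oriented 3-dimensional faces of the cube, which the group permutes
    transitively; this gives the induced module ([embeds_cubes]). They also have as component at w
    an arbitrary 2-chain on the complement of w, a sum of a cycle and a coboundary of a cycle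
    ([alt_suppP]); this gives the two families of hooks ([embeds_second]).

    For H_3 the modules compared are realized on one subspace of [cube_module], and [embeds_rsim]
    turns this into isomorphisms. *)

(** * Row vectors over a finite type as functions *)

Section Coordinates.
Variables (k : fieldType).

Definition ev (X : finType) (u : 'rV[k]_#|X|) (x : X) : k := u 0 (enum_rank x).

Definition fv (X : finType) (f : X -> k) : 'rV[k]_#|X| := \row_i f (enum_val i).

Lemma ev_fv (X : finType) (f : X -> k) x : ev (fv f) x = f x.
Proof. by rewrite /ev mxE enum_rankK. Qed.

Lemma ev_inj (X : finType) (u v : 'rV[k]_#|X|) : ev u =1 ev v -> u = v.
Proof.
by move=> eq_uv; apply/rowP=> i; rewrite -[i]enum_valK; exact: eq_uv.
Qed.

Lemma ev0 (X : finType) (x : X) : ev 0 x = 0.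
Proof. by rewrite /ev mxE. Qed.

Lemma evD (X : finType) (u v : 'rV[k]_#|X|) x : ev (u + v) x = ev u x + ev v x.
Proof. by rewrite /ev mxE. Qed.

Lemma evN (X : finType) (u : 'rV[k]_#|X|) x : ev (- u) x = - ev u x.
Proof. by rewrite /ev mxE. Qed.

Lemma evZ (X : finType) a (u : 'rV[k]_#|X|) x : ev (a *: u) x = a * ev u x.
Proof. by rewrite /ev mxE. Qed.

Lemma ev_sum (X : finType) (I : Type) (r : seq I) (P : pred I)
    (F : I -> 'rV[k]_#|X|) x :
  ev (\sum_(i <- r | P i) F i) x = \sum_(i <- r | P i) ev (F i) x.
Proof. by rewrite /ev summxE. Qed.

Lemma ev_pt (X : finType) (x y : X) : ev (pt k x) y = (x == y)%:R.
Proof. by rewrite /ev mxE eqxx (inj_eq enum_rank_inj) eq_sym. Qed.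

Definition lmx (X Y : finType) (f : X -> Y -> k) : 'M[k]_(#|X|, #|Y|) :=
  \matrix_(i, j) f (enum_val i) (enum_val j).

Lemma ev_lmx (X Y : finType) (f : X -> Y -> k) u y :
  ev (u *m lmx f) y = \sum_x ev u x * f x y.
Proof.
rewrite /ev mxE (reindex_onto (@enum_rank X) enum_val) /= => [|i _]; last exact: enum_valK.
by apply: eq_big => x; rewrite ?enum_rankK ?eqxx // mxE !enum_rankK.
Qed.

Lemma fv_sum_pt (X : finType) (u : 'rV[k]_#|X|) : u = \sum_x ev u x *: pt k x.
Proof.
apply: ev_inj => y; rewrite ev_sum (bigD1 y) //= evZ ev_pt eqxx mulr1 big1 ?addr0 // => x neq_xy.
by rewrite evZ ev_pt (negPf neq_xy) mulr0.
Qed.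

Definition pullmx (X Y : finType) (f : Y -> X) : 'M[k]_(#|X|, #|Y|) :=
  lmx (fun x y => (x == f y)%:R).

Lemma ev_pull (X Y : finType) (f : Y -> X) u y : ev (u *m pullmx f) y = ev u (f y).
Proof.
rewrite ev_lmx (bigD1 (f y)) //= eqxx mulr1 big1 ?addr0 // => x /negPf->.
by rewrite mulr0.
Qed.

Lemma ev_permutation (gT : finGroupType) (X : finType) (to : {action gT &-> X}) u g x :
  ev (u *m permutation_repr k to g) x = ev u (to x g^-1%g).
Proof.
rewrite [u]fv_sum_pt mulmx_suml !ev_sum; apply: eq_bigr => y _.
rewrite -scalemxAl /= pt_act !evZ !ev_pt; congr (_ * _%:R).
by rewrite -[in RHS](inj_eq (act_inj to g)) actKV.
Qed.

End Coordinates.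

(** * Representations embedded in a common module *)

Section Embeddings.
Variables (k : fieldType) (gT : finGroupType) (G : {group gT}).
Local Notation reprG := (mx_representation k G).

(* [rho] is isomorphic to the submodule of [sigma] whose vectors are those    *)
(* that satisfy [P].                                                          *)
Definition embeds d N (rho : reprG d) (sigma : reprG N) (P : 'rV[k]_N -> Prop) :=
  exists B : 'M[k]_(d, N),
    [/\ row_free B, {in G, forall g, rho g *m B = B *m sigma g}
      & forall u : 'rV_N, (u <= B)%MS <-> P u].

Lemma embeds_ext d N (rho : reprG d) (sigma : reprG N) (P Q : 'rV[k]_N -> Prop) :
  (forall u, P u <-> Q u) -> embeds rho sigma P -> embeds rho sigma Q.
Proof.
move=> eqPQ [B [freeB homB imB]]; exists B; split=> // u; split=> [Bu | Qu].
  by apply/eqPQ/imB.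
by apply/imB/eqPQ.
Qed.

(** Two row-free matrices with the same row space differ by an invertible factor, and this factor
    intertwines the two representations because both matrices do. *)
Lemma embeds_rsim d1 d2 N (rho1 : reprG d1) (rho2 : reprG d2) (sigma : reprG N)
    (P : 'rV[k]_N -> Prop) :
  embeds rho1 sigma P -> embeds rho2 sigma P -> mx_rsim rho1 rho2.
Proof.
case=> B1 [free1 hom1 im1] [B2 [free2 hom2 im2]].
have sB12 : (B1 <= B2)%MS by apply/row_subP=> i; apply/im2/im1/row_sub.
have sB21 : (B2 <= B1)%MS by apply/row_subP=> i; apply/im1/im2/row_sub.
have eq_d : d1 = d2.
  by rewrite -(eqP free1) -(eqP free2); apply/eqP; rewrite eqn_leq !mxrankS.
have CB2 : B1 *m pinvmx B2 *m B2 = B1 by rewrite mulmxKpV.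
exists (B1 *m pinvmx B2) => // [|g Gg].
  rewrite /row_free eqn_leq rank_leq_row /=.
  by have := mxrankM_maxl (B1 *m pinvmx B2) B2; rewrite CB2 (eqP free1).
apply: (row_free_inj free2).
by rewrite /= -(mulmxA (rho1 g)) CB2 hom1 // -[RHS]mulmxA hom2 // [RHS]mulmxA CB2.
Qed.

Lemma embeds_submod N (sigma : reprG N) (U : 'M[k]_N) (modU : mxmodule sigma U) :
  embeds (submod_repr modU) sigma (fun u => (u <= U)%MS).
Proof.
exists (val_submod 1%:M); split=> [|g Gg|u]; last by rewrite val_submod1.
  by rewrite /row_free val_submod1.
by rewrite -val_submodE -(val_submodJ modU) // mul1mx.
Qed.

Lemma embeds_hom d N N' (rho : reprG d) (sigma : reprG N) (P : 'rV[k]_N -> Prop)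
    (sigma' : reprG N') (A : 'M[k]_(N, N')) :
    {in G, forall g u, P u -> u *m sigma g *m A = u *m A *m sigma' g} ->
    (forall u, P u -> u *m A = 0 -> u = 0) ->
    embeds rho sigma P ->
  embeds rho sigma' (fun u' => exists2 u, P u & u' = u *m A).
Proof.
move=> homA injA [B [freeB homB imB]]; have PB i : P (row i B) by apply/imB/row_sub.
exists (B *m A); split=> [|g Gg|u'].
- apply/inj_row_free=> x /eqP; rewrite mulmxA => /eqP xBA0; apply: (row_free_inj freeB).
  by rewrite mul0mx; apply: injA xBA0; apply/imB/submxMl.
- rewrite mulmxA homB // -!mulmxA; apply/row_matrixP=> i.
  by rewrite !row_mul !mulmxA homA.
split=> [/submxP[x ->] | [u /imB/submxP[x ->] ->]].
  by exists (x *m B); rewrite ?mulmxA //; apply/imB/submxMl.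
by rewrite -mulmxA submxMl.
Qed.

Lemma embeds_dadd N (rho1 rho2 : representation k G) (sigma : reprG N)
    (P1 P2 : 'rV[k]_N -> Prop) :
    (forall u, P1 u -> P2 u -> u = 0) ->
    embeds rho1 sigma P1 -> embeds rho2 sigma P2 ->
  embeds (dadd_grepr rho1 rho2) sigma
    (fun u => exists u1 u2, [/\ P1 u1, P2 u2 & u = u1 + u2]).
Proof.
move=> dxP [B1 [free1 hom1 im1]] [B2 [free2 hom2 im2]].
exists (col_mx B1 B2); split=> [|g Gg|u].
- apply/inj_row_free=> x; rewrite -[x]hsubmxK mul_row_col => /eqP.
  rewrite addr_eq0 => /eqP eq_x.
  have P1x : P1 (lsubmx x *m B1) by apply/im1/submxMl.
  have x0 : lsubmx x *m B1 = 0.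
    by apply: dxP => //; rewrite eq_x -mulNmx; apply/im2/submxMl.
  have x0' : rsubmx x *m B2 = 0 by apply/eqP; rewrite -oppr_eq0 -eq_x x0.
  have -> : lsubmx x = 0 by apply: (row_free_inj free1); rewrite x0 mul0mx.
  have -> : rsubmx x = 0 by apply: (row_free_inj free2); rewrite x0' mul0mx.
  exact: row_mx0.
- rewrite /= mul_block_col !mul0mx addr0 add0r mul_col_mx.
  by congr col_mx; [exact: hom1 | exact: hom2].
split=> [/submxP[x ->] | [u1 [u2 [/im1 Pu1 /im2 Pu2 ->]]]].
  rewrite -[x]hsubmxK mul_row_col; exists (lsubmx x *m B1), (rsubmx x *m B2).
  by split=> //; [apply/im1/submxMl | apply/im2/submxMl].
by rewrite -addsmxE addmx_sub_adds.
Qed.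

Lemma embeds_grepr0 N (sigma : reprG N) :
  embeds (@grepr0 k gT G) sigma (fun u => u = 0).
Proof.
exists 0; split=> [|g Gg|u]; first by rewrite /row_free mxrank0.
  by rewrite mulmx0 mul0mx.
by split=> [/submxP[x ->] | ->]; rewrite ?mulmx0 ?sub0mx.
Qed.

(** Directness of the sum is supplied by the matrices [pi]: the one of index i fixes the summand i
    and kills the others, so a vector of two complementary sums is zero. *)
Lemma embeds_bigsum (I : eqType) (r : seq I) (rho : I -> representation k G)
    N (sigma : reprG N) (P : I -> 'rV[k]_N -> Prop) (pi : I -> 'M[k]_N) :
    uniq r ->
    {in r, forall i, embeds (rho i) sigma (P i)} ->
    {in r &, forall i j u, P i u -> u *m pi j = if i == j then u else 0} ->
  embeds (\big[dadd_grepr/grepr0]_(i <- r) rho i) sigma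
    (fun u => exists2 F : I -> 'rV_N, {in r, forall i, P i (F i)}
       & u = \sum_(i <- r) F i).
Proof.
elim: r => [|i r IHr] /=.
  move=> _ _ _; rewrite big_nil; apply: embeds_ext (embeds_grepr0 sigma) => u.
  by split=> [-> | [F _ ->]]; [exists (fun=> 0); rewrite ?big_nil // | rewrite big_nil].
case/andP=> ri uniq_r embP dxP.
have sr j : j \in r -> j \in i :: r by rewrite inE orbC => ->.
have {}IHr := IHr uniq_r (fun j rj => embP j (sr j rj))
  (fun j l rj rl => dxP j l (sr j rj) (sr l rl)).
have i_in : i \in i :: r by rewrite mem_head.
rewrite big_cons; apply: embeds_ext (embeds_dadd _ (embP i i_in) IHr) => u; last first.
  move=> Piu [F PF def_u].
  have := dxP i i i_in i_in u Piu; rewrite eqxx => <-.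
  rewrite def_u mulmx_suml big_seq big1 // => j rj.
  by rewrite (dxP j i (sr j rj) i_in _ (PF j rj)) (negPf (memPn ri j rj)).
split=> [[u1 [u2 [Pu1 [F PF ->] ->]]] | [F PF ->]]; last first.
  rewrite big_cons; exists (F i), (\sum_(j <- r) F j); split=> //; first exact: PF.
  by exists F => // j rj; apply/PF/sr.
exists (fun j => if j == i then u1 else F j) => [j|].
  by rewrite inE; have [-> | _ /=] := eqVneq; last exact: PF.
rewrite big_cons eqxx; congr (_ + _); rewrite !big_seq.
by apply: eq_bigr => j rj; rewrite (negPf (memPn ri j rj)).
Qed.

Lemma dadd_rsim (rho1 rho2 rho1' rho2' : representation k G) :
  mx_rsim rho1 rho1' -> mx_rsim rho2 rho2' ->
  mx_rsim (dadd_grepr rho1 rho2) (dadd_grepr rho1' rho2').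
Proof.
case: rho1 rho2 rho1' rho2' => [d1 r1] [d2 r2] [d1' r1'] [d2' r2'] /=.
case=> B1 eq1 free1 hom1 [B2 eq2 free2 hom2].
exists (block_mx B1 0 0 B2) => [||g Gg] /=; first by rewrite eq1 eq2.
  by rewrite /row_free rank_diag_block_mx (eqP free1) (eqP free2).
by rewrite !mulmx_block !mulmx0 !mul0mx !addr0 !add0r hom1 ?hom2.
Qed.

End Embeddings.

Section SectionEmbedding.
Variables (k : fieldType) (gT : finGroupType) (G : {group gT}) (N N' : nat).
Variables (sigma : mx_representation k G N) (sigma' : mx_representation k G N').
Variables (U V : 'M[k]_N) (modU : mxmodule sigma U) (modV : mxmodule sigma V).
Variable Phi : 'M[k]_(N, N').
Local Notation valf := (@val_factmod k N U _).

(** An equivariant map on V with kernel U identifies V / U with its image. With V the cycles and U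
    the boundaries, this turns a homology group into a concrete space of vectors. *)
Lemma embeds_section :
    (U <= V)%MS ->
    {in G, forall g, sigma g *m Phi = Phi *m sigma' g} ->
    (forall u : 'rV_N, (u <= V)%MS -> u *m Phi = 0 <-> (u <= U)%MS) ->
  embeds (section_repr modU modV) sigma'
    (fun u' => exists2 u : 'rV_N, (u <= V)%MS & u' = u *m Phi).
Proof.
move=> sUV homPhi kerPhi; pose A := valf 1%:M *m Phi.
have U_Phi0 m (W : 'M_(m, N)) : (W <= U)%MS -> W *m Phi = 0.
  move=> sWU; apply/row_matrixP=> i; rewrite row_mul row0.
  have sWi : (row i W <= U)%MS := submx_trans (row_sub i W) sWU.
  exact/(kerPhi _ (submx_trans sWi sUV)).
(* The chosen representative of the class of [u] differs from [u] by a vector of [U], which [Phi]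
   kills. *)
have val_inA (u : 'rV_N) : in_factmod U u *m A = u *m Phi.
  rewrite /A mulmxA -val_factmodE -[in RHS](add_sub_fact_mod U u) mulmxDl.
  by rewrite [X in _ = X + _]U_Phi0 ?add0r // val_submodP.
have inV (w : 'rV_(\rank (cokermx U))) :
    (w <= <<in_factmod U V>>)%MS -> exists2 u : 'rV_N, (u <= V)%MS & w = in_factmod U u.
  rewrite genmxE => /submxP[x ->]; exists (x *m V); first exact: submxMl.
  by rewrite /in_factmod /= mulmxA.
apply: embeds_ext (embeds_hom (sigma' := sigma') (A := A) _ _
  (embeds_submod (section_module modU modV))) => [u' | g Gg w _ | w].
- split=> [[w /inV[u Vu ->] ->] | [u Vu ->]]; first by exists u; rewrite ?val_inA.
  by exists (in_factmod U u); rewrite ?val_inA // genmxE /in_factmod /= submxMr.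
- have -> : w *m factmod_repr modU g *m A
    = valf (w *m factmod_mx modU g) *m Phi by rewrite /A mulmxA -val_factmodE.
  rewrite val_factmodJ // -mulmxA.
  have -> : forall u : 'rV_N, valf (in_factmod U u) *m Phi = u *m Phi.
    by move=> u; rewrite val_factmodE -mulmxA val_inA.
  rewrite -mulmxA homPhi // /A val_factmodE; move: (valf 1%:M) => Z.
  by rewrite !mulmxA.
by case/inV=> u Vu ->; rewrite val_inA => /(kerPhi _ Vu); rewrite -in_factmod_eq0 => /eqP.
Qed.

End SectionEmbedding.

Section InducedEmbedding.
Variables (k : fieldType) (gT : finGroupType) (H : {group gT}) (d N : nat).
Variables (rho : mx_representation k H d) (sigma : mx_representation k [set: gT] N).
Variables (Omega : finType) (kappa : gT -> Omega) (O : pred Omega).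
Variables (P : 'rV[k]_N -> Prop) (Q : Omega -> 'rV[k]_N -> Prop).
Variable pi : Omega -> 'M[k]_N.

Hypothesis kappaP : forall g h, (kappa g == kappa h) = ((g * h^-1)%g \in H).
Hypothesis OP : forall w, reflect (exists g, kappa g = w) (O w).
Hypothesis QP : forall g u, P u <-> Q (kappa g) (u *m sigma g).
Hypothesis piP : forall w w' u, O w -> Q w u -> u *m pi w' = if w == w' then u else 0.

(* [kappa] identifies the cosets [H g] with the set [O]; the vectors in [Q w] *)
(* are those of the summand V (x) g of Ind V, for [w = kappa g].              *)
Lemma embeds_induced :
    embeds rho (subg_repr sigma (subsetT H)) P ->
  embeds (induced_repr rho) sigma
    (fun u => exists2 F : Omega -> 'rV_N, forall w, O w -> Q w (F w)
       & u = \sum_(w | O w) F w).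
Proof.
case=> B [freeB homB imB].
pose t := @transversal_elt gT H; pose w_ i := kappa (t i).
have w_inj : injective w_.
  move=> i j /eqP; rewrite kappaP transversal_eltP transversal_coset.
  by rewrite (inj_eq enum_val_inj) => /eqP.
have Ow i : O (w_ i) by apply/OP; exists (t i).
have w_surj w : O w -> exists i, w_ i = w.
  case/OP=> g <-; have [i def_i] := transversal_index H g; exists i.
  by apply/eqP; rewrite eq_sym kappaP transversal_eltP def_i.
have Qx i (x : 'rV_d) : Q (w_ i) (x *m (B *m sigma (t i))).
  by rewrite mulmxA; apply/QP/imB/submxMl.
have piB i j (x : 'rV_d) : x *m (B *m sigma (t i)) *m pi (w_ j)
                 = if i == j then x *m (B *m sigma (t i)) else 0.
  by rewrite (piP _ (Ow i) (Qx i x)) (inj_eq w_inj).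
exists (\mxcol_(i < #|rcosets H [set: gT]|) (B *m sigma (t i))); split=> [|g _|u].
- apply/inj_row_free=> x; rewrite -[x]submxrowK mul_mxrow_mxcol => sum0.
  rewrite -(mxrow0 _); apply: eq_mxrow => i.
  have: (\sum_j submxrow x j *m (B *m sigma (t j))) *m pi (w_ i) = 0.
    by rewrite sum0 mul0mx.
  rewrite mulmx_suml (bigD1 i) //= piB eqxx big1 ?addr0 => [|j /negPf neq_ji]; last first.
    by rewrite piB neq_ji.
  rewrite mulmxA => xB0; apply: (row_free_inj freeB); rewrite mul0mx.
  by rewrite -[LHS](repr_mxK sigma (in_setT (t i))) xB0 mul0mx.
- rewrite mul_mxblock_mxrow mxcol_mul; apply: eq_mxcol => i /=.
  have [l def_l] := transversal_index H (t i * g)%g.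
  have Hl : ((t i * g * (t l)^-1)%g \in H) by rewrite transversal_eltP def_l.
  rewrite (bigD1 l) //= Hl big1 ?addr0 => [|m neq_ml]; last first.
    rewrite transversal_eltP -def_l (inj_eq enum_val_inj) (negPf neq_ml).
    by rewrite mul0mx.
  rewrite mulmxA homB // -!mulmxA /= -!repr_mxM ?inE //.
  by rewrite mulgKV.
have sumO F : \sum_(w | O w) F w = \sum_i F (w_ i) :> 'rV_N.
  transitivity (\sum_(i in [set: 'I_#|rcosets H [set: gT]|]) F (w_ i)); last first.
    by apply: eq_bigl => i; rewrite inE.
  rewrite -(big_imset _ (h := w_)) /= => [|i j _ _]; last exact: w_inj.
  apply: eq_bigl => w; apply/idP/imsetP => [/w_surj[i <-] | [i _ ->]] //.
  by exists i; rewrite ?inE.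
split=> [/submxP[x ->] | [F QF ->]].
  rewrite -[x]submxrowK mul_mxrow_mxcol.
  pose F w := oapp (fun i => submxrow x i *m (B *m sigma (t i))) 0
                   [pick i | w_ i == w].
  have Fw i : F (w_ i) = submxrow x i *m (B *m sigma (t i)).
    by rewrite /F; case: pickP => [j /eqP/w_inj-> | /(_ i)/eqP].
  exists F => [w /w_surj[i <-] |]; first by rewrite Fw.
  by rewrite sumO; apply: eq_bigr => i _; rewrite Fw.
rewrite sumO; apply: summx_sub => i _.
(* A vector of the summand at [w_ i] is brought back to the base summand by the inverse of the coset
   representative, where [B] describes it. *)
have PFi : P (F (w_ i) *m sigma (t i)^-1%g).
  apply/(QP (t i)); rewrite repr_mxKV ?inE //; exact: QF (Ow i).
have /submxP[x def_x] : (F (w_ i) *m sigma (t i)^-1%g <= B)%MS by apply/imB.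
have -> : F (w_ i) = x *m (B *m sigma (t i)).
  by rewrite mulmxA -def_x repr_mxKV ?inE.
apply/submxP; exists (\mxrow_j (if j == i then x else 0)).
rewrite mul_mxrow_mxcol (bigD1 i) //= eqxx big1 ?addr0 // => j /negPf->.
by rewrite mul0mx.
Qed.

End InducedEmbedding.

(** * Tensor products with one-dimensional representations *)

Section TensorLinear.
Variable k : fieldType.

(** The index types ['I_(n * 1)] and ['I_n] are not convertible, so indices are matched by value. *)
Lemma trow_mx11 n (A : 'rV[k]_n) (b : 'M[k]_1) (j : 'I_(n * 1)) (j' : 'I_n) :
  j = j' :> nat -> trow A b 0 j = A 0 j' * b 0 0.
Proof.
elim: n A j j' => [|n IHn] A j j' eq_j; first by case: j' {eq_j}.
rewrite /= mxE; case: splitP => [j0 def_j | j0 def_j].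
  rewrite !mxE ord1; congr (A _ _ * _); apply: val_inj => /=.
  by rewrite -eq_j def_j ord1.
have lt_j' : (j'.-1 < n)%N by rewrite -eq_j def_j /=; case: (j0) => /= m; rewrite muln1.
rewrite (IHn _ _ (Ordinal lt_j')) /= -?eq_j ?def_j // !mxE; congr (A _ _ * _).
by apply: val_inj; rewrite /= -eq_j def_j.
Qed.

Lemma tprod_mx11 m n (A : 'M[k]_(m, n)) (b : 'M[k]_1)
    (i : 'I_(m * 1)) (j : 'I_(n * 1)) (i' : 'I_m) (j' : 'I_n) :
  i = i' :> nat -> j = j' :> nat -> tprod A b i j = A i' j' * b 0 0.
Proof.
elim: m A i i' => [|m IHm] A i i' eq_i eq_j; first by case: i' {eq_i}.
rewrite /= mxE; case: splitP => [i0 def_i | i0 def_i].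
  rewrite [i0]ord1 (trow_mx11 _ _ eq_j) !mxE; congr (A _ _ * _); apply: val_inj => /=.
  by rewrite -eq_i def_i ord1.
have lt_i' : (i'.-1 < m)%N by rewrite -eq_i def_i /=; case: (i0) => /= l; rewrite muln1.
rewrite (IHm _ _ (Ordinal lt_i')) /= -?eq_i ?def_i // !mxE; congr (A _ _ * _).
by apply: val_inj; rewrite /= -eq_i def_i.
Qed.

Variables (gT : finGroupType) (G : {group gT}).
Local Notation reprG := (mx_representation k G).

Definition is_linear d (rho : reprG d) (chi : gT -> k) :=
  d = 1%N /\ {in G, forall g, rho g = (chi g)%:M}.

Lemma is_linear_prod d1 d2 (rho1 : reprG d1) (rho2 : reprG d2) chi1 chi2 :
    is_linear rho1 chi1 -> is_linear rho2 chi2 ->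
  is_linear (prod_repr rho1 rho2) (fun g => chi1 g * chi2 g).
Proof.
case=> d1_1 lin1 [d2_1 lin2]; move: rho1 lin1 rho2 lin2; rewrite d1_1 d2_1.
move=> rho1 lin1 rho2 lin2; split=> // g Gg /=; rewrite lin1 // lin2 //.
apply/matrixP=> i j; rewrite (@tprod_mx11 _ _ _ _ i j i j) // !mxE !eqxx !mulr1n.
by rewrite !ord1 !eqxx !mulr1n.
Qed.

(** The cast along [e] absorbs the degrees [1 * d2] and [d1 * 1] of products with a one-dimensional
    factor on the left and on the right, so that both cases follow from one argument. *)
Lemma embeds_twist d d2 (rho : reprG d) (rho2 : reprG d2) (chi : gT -> k) (e : d2 = d)
    N N' (sigma2 : reprG N) (P : 'rV[k]_N -> Prop) (sigma' : reprG N') (A : 'M[k]_(N, N')) :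
    {in G, forall g, rho g = castmx (e, e) (chi g *: rho2 g)} ->
    embeds rho2 sigma2 P ->
    {in G, forall g u, P u -> chi g *: (u *m sigma2 g *m A) = u *m A *m sigma' g} ->
    (forall u, P u -> u *m A = 0 -> u = 0) ->
  embeds rho sigma' (fun u' => exists2 u, P u & u' = u *m A).
Proof.
case: d / e rho => rho def_rho [B [freeB homB imB]] homA injA.
have PB i : P (row i B) by apply/imB/row_sub.
exists (B *m A); split=> [|g Gg|u'].
- apply/inj_row_free=> x /eqP; rewrite mulmxA => /eqP xBA0; apply: (row_free_inj freeB).
  by rewrite mul0mx; apply: injA xBA0; apply/imB/submxMl.
- rewrite def_rho // castmx_id -scalemxAl mulmxA homB //; apply/row_matrixP=> i.
  rewrite linearZ /= !row_mul.
  by rewrite -homA // -row_mul.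
split=> [/submxP[x ->] | [u /imB/submxP[x ->] ->]].
  by exists (x *m B); rewrite ?mulmxA //; apply/imB/submxMl.
by rewrite -mulmxA submxMl.
Qed.

Lemma embeds_prodl d1 d2 (rho1 : reprG d1) (rho2 : reprG d2) (chi : gT -> k)
    N N' (sigma2 : reprG N) (P : 'rV[k]_N -> Prop) (sigma' : reprG N') (A : 'M[k]_(N, N')) :
    is_linear rho1 chi -> embeds rho2 sigma2 P ->
    {in G, forall g u, P u -> chi g *: (u *m sigma2 g *m A) = u *m A *m sigma' g} ->
    (forall u, P u -> u *m A = 0 -> u = 0) ->
  embeds (prod_repr rho1 rho2) sigma' (fun u' => exists2 u, P u & u' = u *m A).
Proof.
case=> d1_1; move: rho1; rewrite d1_1 => rho1 lin1.
apply: (embeds_twist (e := esym (mul1n d2))) => g Gg.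
by rewrite prod_repr_lin // lin1 // mxE eqxx.
Qed.

Lemma embeds_prodr d1 d2 (rho1 : reprG d1) (rho2 : reprG d2)
    N' (sigma' : reprG N') (P : 'rV[k]_N' -> Prop) :
    is_linear rho2 (fun=> 1) -> embeds rho1 sigma' P ->
  embeds (prod_repr rho1 rho2) sigma' P.
Proof.
case=> d2_1; move: rho2; rewrite d2_1 => rho2 lin2 embP.
apply: embeds_ext (embeds_twist (e := esym (muln1 d1)) (chi := fun=> 1)
  (A := 1%:M) _ embP _ _) => [u | g Gg | g Gg u _ | u _].
- by split=> [[v Pv ->] | Pu]; [rewrite mulmx1 | exists u; rewrite ?mulmx1].
- rewrite scale1r /= lin2 //; apply/matrixP=> i j; rewrite castmxE.
  rewrite (@tprod_mx11 _ _ _ _ i j (cast_ord (muln1 _) i) (cast_ord (muln1 _) j)) //.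
  by rewrite mxE mulr1 !esymK.
- by rewrite scale1r !mulmx1.
by rewrite mulmx1.
Qed.

Lemma is_linear_embeds d (rho : reprG d) N (sigma : reprG N) chi (P : 'rV[k]_N -> Prop) :
  N = 1%N -> (forall u, P u) -> {in G, forall g, sigma g = (chi g)%:M} ->
  embeds rho sigma P -> is_linear rho chi.
Proof.
move=> N1 allP lin_sigma [B [freeB homB imB]].
have d1 : d = 1%N.
  rewrite -N1 -(eqP freeB) -[RHS](@mxrank1 k); apply/eqP.
  rewrite eqn_leq mxrankS ?submx1 //= mxrankS //.
  by apply/row_subP=> i; apply/imB.
split=> // g Gg; apply: (row_free_inj freeB) => /=.
by rewrite homB // lin_sigma // -scalar_mxC.
Qed.

Lemma is_linear_submod N (sigma : reprG N) (U : 'M[k]_N) (modU : mxmodule sigma U) chi :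
  \rank U = 1%N -> {in G, forall g, U *m sigma g = chi g *: U} ->
  is_linear (submod_repr modU) chi.
Proof.
move=> rU1 linU; split=> // g Gg; apply: (@val_submod_inj _ _ U).
rewrite -[submod_repr modU g]mul1mx val_submodJ //.
rewrite [RHS]val_submodE mul_scalar_mx.
have /submxP[D ->] : (val_submod (1%:M : 'M_(\rank U)) <= U)%MS by rewrite val_submod1.
by rewrite -mulmxA linU // -scalemxAr.
Qed.

End TensorLinear.

(** * Alternating functions and chains *)

Section Tuples.
Variable V : finType.

Definition tcons i (v : V) (y : {ffun 'I_i -> V}) : {ffun 'I_i.+1 -> V} :=
  [ffun j => oapp y v (unlift ord0 j)].

Lemma tcons0 i v (y : {ffun 'I_i -> V}) : tcons v y ord0 = v.
Proof. by rewrite ffunE unlift_none. Qed.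

Lemma tconsS i v (y : {ffun 'I_i -> V}) j : tcons v y (lift ord0 j) = y j.
Proof. by rewrite ffunE liftK. Qed.

Lemma face_tcons i v (y : {ffun 'I_i.+1 -> V}) : face ord0 (tcons v y) = y.
Proof. by apply/ffunP=> j; rewrite ffunE tconsS. Qed.

Lemma tcons_face i (x : {ffun 'I_i.+2 -> V}) : tcons (x ord0) (face ord0 x) = x.
Proof.
apply/ffunP=> j; have [l ->|->] := unliftP ord0 j; last by rewrite tcons0.
by rewrite tconsS ffunE.
Qed.

Lemma tcons_perm i v (y : {ffun 'I_i -> V}) (s : 'S_i) :
  tcons v [ffun j => y (s j)] = [ffun j => tcons v y (lift_perm ord0 ord0 s j)].
Proof.
apply/ffunP=> j; rewrite [RHS]ffunE; have [l ->|->] := unliftP ord0 j.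
  by rewrite lift_perm_lift !tconsS ffunE.
by rewrite lift_perm_id !tcons0.
Qed.

Lemma injective_tcons i v (y : {ffun 'I_i -> V}) :
  injectiveb (tcons v y) = (v \notin codom y) && injectiveb y.
Proof.
apply/injectiveP/andP => [injx | [vy /injectiveP injy] j1 j2].
  split; last first.
    apply/injectiveP=> j1 j2 eq_y; apply: (@lift_inj _ ord0); apply: injx.
    by rewrite !tconsS.
  apply/negP=> /codomP[j def_v]; have := neq_lift ord0 j.
  by rewrite -(inj_eq injx) tcons0 tconsS -def_v eqxx.
have [l1 ->|->] := unliftP ord0 j1; have [l2 ->|->] := unliftP ord0 j2 => //.
- by rewrite !tconsS => /injy->.
- by rewrite tcons0 tconsS => def_v; rewrite -def_v codom_f in vy.
by rewrite tcons0 tconsS => def_v; rewrite def_v codom_f in vy.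
Qed.

Definition T0 : {ffun 'I_0 -> V} := ffun0 (card_ord 0).
Definition T1 a := tcons a T0.
Definition T2 a b := tcons a (T1 b).
Definition T3 a b c := tcons a (T2 b c).
Definition T4 a b c d := tcons a (T3 b c d).

Lemma T1P (x : {ffun 'I_1 -> V}) : x = T1 (x ord0).
Proof. by apply/ffunP=> j; rewrite !ord1 tcons0. Qed.

Lemma T2P (x : {ffun 'I_2 -> V}) : exists a b, x = T2 a b.
Proof.
by exists (x ord0), (face ord0 x ord0); rewrite /T2 -T1P tcons_face.
Qed.

Lemma T3P (x : {ffun 'I_3 -> V}) : exists a b c, x = T3 a b c.
Proof.
have [b [c def_f]] := T2P (face ord0 x).
by exists (x ord0), b, c; rewrite /T3 -def_f tcons_face.
Qed.

Lemma T4P (x : {ffun 'I_4 -> V}) : exists a b c d, x = T4 a b c d.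
Proof.
have [b [c [d def_f]]] := T3P (face ord0 x).
by exists (x ord0), b, c, d; rewrite /T4 -def_f tcons_face.
Qed.

Lemma codom_tcons i v (y : {ffun 'I_i -> V}) u :
  (u \in codom (tcons v y)) = (u == v) || (u \in codom y).
Proof.
apply/codomP/orP => [[j ->] | [/eqP-> | /codomP[j ->]]].
- have [l ->|->] := unliftP ord0 j; first by rewrite tconsS codom_f; right.
  by rewrite tcons0; left.
- by exists ord0; rewrite tcons0.
by exists (lift ord0 j); rewrite tconsS.
Qed.

Lemma codom_T1 a u : (u \in codom (T1 a)) = (u == a).
Proof.
by apply/codomP/eqP => [[j ->] | ->]; [rewrite ord1 tcons0 | exists ord0; rewrite tcons0].
Qed.

Lemma injective_T1 a : injectiveb (T1 a).
Proof. by apply/injectiveP=> j1 j2 _; rewrite !ord1. Qed.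

Lemma injective_T2 a b : injectiveb (T2 a b) = (a != b).
Proof. by rewrite injective_tcons codom_T1 injective_T1 andbT. Qed.

Lemma injective_T3 a b c : injectiveb (T3 a b c) = [&& a != b, a != c & b != c].
Proof.
by rewrite injective_tcons injective_T2 codom_tcons codom_T1 negb_or andbA.
Qed.

Lemma injective_T4 a b c d : injectiveb (T4 a b c d) =
  [&& a != b, a != c, a != d, b != c, b != d & c != d].
Proof.
rewrite injective_tcons injective_T3 2!codom_tcons codom_T1 !negb_or.
by rewrite -!andbA.
Qed.

End Tuples.

Definition tcomp (V' V : finType) (phi : V' -> V) i (x : {ffun 'I_i -> V'}) :
  {ffun 'I_i -> V} := [ffun j => phi (x j)].

Lemma tcomp_tcons (V' V : finType) (phi : V' -> V) i v (y : {ffun 'I_i -> V'}) :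
  tcomp phi (tcons v y) = tcons (phi v) (tcomp phi y).
Proof.
apply/ffunP=> j; rewrite ffunE; have [l ->|->] := unliftP ord0 j.
  by rewrite !tconsS ffunE.
by rewrite !tcons0.
Qed.

Lemma tcomp_T1 (V' V : finType) (phi : V' -> V) a : tcomp phi (T1 a) = T1 (phi a).
Proof. by apply/ffunP=> j; rewrite ffunE ord1 !tcons0. Qed.

Lemma tcomp_T2 (V' V : finType) (phi : V' -> V) a b :
  tcomp phi (T2 a b) = T2 (phi a) (phi b).
Proof. by rewrite /T2 tcomp_tcons tcomp_T1. Qed.

Lemma tcomp_T3 (V' V : finType) (phi : V' -> V) a b c :
  tcomp phi (T3 a b c) = T3 (phi a) (phi b) (phi c).
Proof. by rewrite /T3 tcomp_tcons tcomp_T2. Qed.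

Lemma tcomp_T4 (V' V : finType) (phi : V' -> V) a b c d :
  tcomp phi (T4 a b c d) = T4 (phi a) (phi b) (phi c) (phi d).
Proof. by rewrite /T4 tcomp_tcons tcomp_T3. Qed.

Section Alternating.
Variables (k : fieldType) (V : finType).

Definition altf i (F : {ffun 'I_i -> V} -> k) :=
  forall (x : {ffun 'I_i -> V}) (s : 'S_i), F [ffun j => x (s j)] = (-1) ^+ s * F x.

Lemma altf_slice i (F : {ffun 'I_i.+1 -> V} -> k) v :
  altf F -> altf (fun y => F (tcons v y)).
Proof.
move=> altF y s; rewrite tcons_perm altF; congr (_ ^+ _ * _).
by rewrite odd_lift_perm addbb.
Qed.

Lemma altf_tperm i (F : {ffun 'I_i -> V} -> k) :
    (forall j1 j2, j1 != j2 -> forall x : {ffun 'I_i -> V}, F [ffun j => x (tperm j1 j2 j)] = - F x) ->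
  altf F.
Proof.
move=> swapF x s; have [ts -> dts] := prod_tpermP s.
elim: ts dts => [_ | [j1 j2] ts IHts /andP[/= neq_j /IHts{}IHts]] in x *.
  rewrite big_nil odd_perm1 mul1r; congr F.
  by apply/ffunP=> j; rewrite ffunE perm1.
rewrite big_cons odd_mul_tperm neq_j signr_addb mulN1r mulNr -IHts /=.
rewrite -(swapF _ _ neq_j); congr F; apply/ffunP=> j.
by rewrite !ffunE permM.
Qed.

Lemma altf_swap i (F : {ffun 'I_i.+2 -> V} -> k) a b y :
  altf F -> F (tcons a (tcons b y)) = - F (tcons b (tcons a y)).
Proof.
move=> altF; pose t : 'S_i.+2 := tperm ord0 (lift ord0 ord0).
have := altF (tcons b (tcons a y)) t; rewrite odd_tperm /= mulN1r => <-.
congr F; apply/ffunP=> j; rewrite [RHS]ffunE /t.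
have [l ->|->] := unliftP ord0 j; last by rewrite tpermL tcons0 tconsS tcons0.
have [l' ->|->] := unliftP ord0 l; last by rewrite tpermR tcons0 tconsS tcons0.
by rewrite tpermD ?neq_lift ?(inj_eq lift_inj) ?neq_lift // !tconsS.
Qed.

(** Transpositions generate the symmetric group. Those fixing 0 are handled by the slices, (0 1) by
    the second hypothesis, and (0 l) is the conjugate of (0 1) by (1 l). *)
Lemma altf_cons i (F : {ffun 'I_i.+2 -> V} -> k) :
    (forall v, altf (fun y => F (tcons v y))) ->
    (forall a b y, F (tcons a (tcons b y)) = - F (tcons b (tcons a y))) ->
  altf F.
Proof.
move=> altF swapF.
pose o1 : 'I_i.+2 := lift ord0 ord0.
have swap01 (x : {ffun 'I_i.+2 -> V}) : F [ffun j => x (tperm ord0 o1 j)] = - F x.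
  rewrite -[x]tcons_face; set b := x ord0; set y1 := face ord0 x.
  have -> : y1 = tcons (y1 ord0) [ffun j => y1 (lift ord0 j)].
    apply/ffunP=> j; have [l ->|->] := unliftP ord0 j; last by rewrite tcons0.
    by rewrite tconsS [RHS]ffunE.
  rewrite -swapF; congr F; apply/ffunP=> j; rewrite [LHS]ffunE /o1.
  have [l ->|->] := unliftP ord0 j; last by rewrite tpermL tcons0 tconsS tcons0.
  have [l' ->|->] := unliftP ord0 l; last by rewrite tpermR tcons0 tconsS tcons0.
  by rewrite tpermD ?neq_lift ?(inj_eq lift_inj) ?neq_lift // !tconsS.
have swapS j1 j2 : j1 != j2 -> forall x : {ffun 'I_i.+2 -> V},
    F [ffun j => x (tperm (lift ord0 j1) (lift ord0 j2) j)] = - F x.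
  move=> neq_j x; rewrite -[x]tcons_face.
  have := altF (x ord0) (face ord0 x) (tperm j1 j2); rewrite odd_tperm neq_j mulN1r => <-.
  rewrite tcons_perm; congr F; apply/ffunP=> j; rewrite !ffunE; congr (oapp _ _ (unlift _ _)).
  have [l ->|->] := unliftP ord0 j.
    rewrite lift_perm_lift; case: tpermP => [/lift_inj-> | /lift_inj-> | /eqP n1 /eqP n2].
    - by rewrite tpermL.
    - by rewrite tpermR.
    by rewrite tpermD // eq_sym ?(inj_eq lift_inj) // -(inj_eq (@lift_inj _ ord0)).
  by rewrite lift_perm_id tpermD // eq_sym neq_lift.
have swap0 l : forall x : {ffun 'I_i.+2 -> V}, F [ffun j => x (tperm ord0 (lift ord0 l) j)] = - F x.
  move=> x; have [-> | neq_l] := eqVneq l ord0; first exact: swap01.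
  have := swapS ord0 l; rewrite eq_sym neq_l => /(_ isT) swl.
  (* Each minus sign is one of the three transpositions in (0 l) = (1 l)(0 1)(1 l). *)
  have -> : - F x = - - - F x by rewrite opprK.
  rewrite -(swl x) -swap01 -(swl [ffun j => _]); congr F; apply/ffunP=> j.
  rewrite !ffunE; congr (x _).
  rewrite -/o1; have neq01 : ord0 != o1 := neq_lift _ _.
  have neq0l : ord0 != lift ord0 l := neq_lift _ _.
  have neq1l : o1 != lift ord0 l by rewrite (inj_eq lift_inj) eq_sym.
  rewrite -!permM; congr (fun_of_perm _ j); apply/permP=> m; rewrite !permM.
  have t1l0 : tperm o1 (lift ord0 l) ord0 = ord0 by rewrite tpermD // eq_sym.
  have t01l : tperm ord0 o1 (lift ord0 l) = lift ord0 l by rewrite tpermD.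
  have t0l1 : tperm ord0 (lift ord0 l) o1 = o1 by rewrite tpermD // eq_sym.
  have [-> | n0] := eqVneq m ord0; first by rewrite t1l0 !tpermL.
  have [-> | n1] := eqVneq m o1; first by rewrite t0l1 tpermL t01l tpermR.
  have [-> | nl] := eqVneq m (lift ord0 l); first by rewrite !tpermR t1l0.
  by rewrite !tpermD // eq_sym.
apply: altf_tperm => j1 j2.
have [l1 ->|->] := unliftP ord0 j1; have [l2 ->|->] := unliftP ord0 j2 => //.
  by rewrite (inj_eq lift_inj) => /swapS.
by move=> _ x; rewrite tpermC swap0.
Qed.

Lemma altf1 (F : {ffun 'I_1 -> V} -> k) : altf F.
Proof.
move=> x s; have -> : s = 1%g by apply/permP=> j; rewrite !ord1.
by rewrite odd_perm1 mul1r; congr F; apply/ffunP=> j; rewrite ffunE perm1.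
Qed.

Lemma altf2 (F : {ffun 'I_2 -> V} -> k) :
  (forall a b, F (T2 a b) = - F (T2 b a)) -> altf F.
Proof.
move=> swapF; apply: altf_cons => [a | a b y]; first exact: altf1.
have -> : y = T0 V by apply/ffunP=> -[].
exact: swapF.
Qed.

Lemma altf3 (F : {ffun 'I_3 -> V} -> k) :
    (forall a b c, F (T3 a b c) = - F (T3 b a c)) ->
    (forall a b c, F (T3 a b c) = - F (T3 a c b)) ->
  altf F.
Proof.
move=> swap0 swap1; apply: altf_cons => [a | a b y].
  by apply: altf2 => b c; exact: swap1.
by rewrite [y]T1P; exact: swap0.
Qed.

Lemma altf4 (F : {ffun 'I_4 -> V} -> k) :
    (forall a b c d, F (T4 a b c d) = - F (T4 b a c d)) ->
    (forall a b c d, F (T4 a b c d) = - F (T4 a c b d)) ->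
    (forall a b c d, F (T4 a b c d) = - F (T4 a b d c)) ->
  altf F.
Proof.
move=> swap0 swap1 swap2; apply: altf_cons => [a | a b y].
  by apply: altf3 => b c d; [exact: swap1 | exact: swap2].
by have [c [d ->]] := T2P y; exact: swap0.
Qed.

Lemma altf_T2 (F : {ffun 'I_2 -> V} -> k) a b : altf F -> F (T2 a b) = - F (T2 b a).
Proof. exact: altf_swap. Qed.

Lemma altf_T3l (F : {ffun 'I_3 -> V} -> k) a b c :
  altf F -> F (T3 a b c) = - F (T3 b a c).
Proof. exact: altf_swap. Qed.

Lemma altf_T3r (F : {ffun 'I_3 -> V} -> k) a b c :
  altf F -> F (T3 a b c) = - F (T3 a c b).
Proof. by move=> altF; apply: (altf_T2 _ _ (altf_slice a altF)). Qed.

Lemma altf_T4l (F : {ffun 'I_4 -> V} -> k) a b c d :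
  altf F -> F (T4 a b c d) = - F (T4 b a c d).
Proof. exact: altf_swap. Qed.

Lemma altf_T4m (F : {ffun 'I_4 -> V} -> k) a b c d :
  altf F -> F (T4 a b c d) = - F (T4 a c b d).
Proof. by move=> altF; apply: (altf_T3l _ _ _ (altf_slice a altF)). Qed.

Lemma altf_T4r (F : {ffun 'I_4 -> V} -> k) a b c d :
  altf F -> F (T4 a b c d) = - F (T4 a b d c).
Proof. by move=> altF; apply: (altf_T3r _ _ _ (altf_slice a altF)). Qed.

End Alternating.

Section Chains.
Variables (k : fieldType) (char0 : [pchar k] =i pred0).

Lemma char0_natf_neq0 m : (0 < m)%N -> m%:R != 0 :> k.
Proof. by rewrite lt0n; move/pcharf0P: char0 => ->. Qed.

Lemma eq_oppr0 (a : k) : a = - a -> a = 0.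
Proof.
move=> /eqP; rewrite -subr_eq0 opprK -mulr2n -mulr_natl mulf_eq0.
by rewrite (negPf (char0_natf_neq0 _)) // => /eqP.
Qed.

Section OneSpace.
Variable V : finType.
Notation tup i := {ffun 'I_i.+1 -> V}.
Implicit Types i : nat.

Definition alt i (c : 'rV[k]_#|{: tup i}|) := altf (ev c).

Lemma alt0 i : alt (0 : 'rV_#|{: tup i}|).
Proof. by move=> x s; rewrite !ev0 mulr0. Qed.

Lemma altD i (b c : 'rV_#|{: tup i}|) : alt b -> alt c -> alt (b + c).
Proof. by move=> altb altc x s; rewrite !evD altb altc mulrDr. Qed.

Lemma altZ i a (c : 'rV_#|{: tup i}|) : alt c -> alt (a *: c).
Proof. by move=> altc x s; rewrite !evZ altc mulrCA. Qed.

Lemma alt_sum i (I : Type) (r : seq I) (P : pred I) (F : I -> 'rV_#|{: tup i}|) :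
  (forall j, P j -> alt (F j)) -> alt (\sum_(j <- r | P j) F j).
Proof.
by move=> altF; elim/big_ind: _ => //; [exact: alt0 | exact: altD].
Qed.

Lemma ev_osimplex i (x y : tup i) :
  ev (osimplex k x) y = \sum_(s : 'S_i.+1) (-1) ^+ s * ([ffun j => x (s j)] == y)%:R.
Proof. by rewrite ev_sum; apply: eq_bigr => s _; rewrite evZ ev_pt. Qed.

Lemma alt_osimplex i (x : tup i) : alt (osimplex k x).
Proof.
move=> y t; rewrite !ev_osimplex (reindex_inj (mulgI t)) mulr_sumr /=.
apply: eq_bigr => s _; rewrite odd_permM signr_addb -mulrA; congr (_ * (_ * _%:R)).
congr (nat_of_bool _); apply/eqP/eqP => [eq_x | <-]; apply/ffunP=> j; last first.
  by rewrite !ffunE permM.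
by have /ffunP/(_ ((t^-1)%g j)) := eq_x; rewrite !ffunE permM permKV.
Qed.

(** Antisymmetrization: a simplex with i + 1 vertices occurs in the sum once for each of its (i +
    1)! orderings, always with the same contribution, and this number is divided out in
    characteristic zero. *)
Lemma alt_expand i (c : 'rV_#|{: tup i}|) :
  alt c -> c = (i.+1)`!%:R^-1 *: \sum_x ev c x *: osimplex k x.
Proof.
move=> altc; apply: ev_inj => y; rewrite evZ ev_sum.
suff -> : \sum_x ev (ev c x *: osimplex k x) y = (i.+1)`!%:R * ev c y.
  by rewrite mulKf // char0_natf_neq0 // fact_gt0.
transitivity (\sum_(s : 'S_i.+1) ev c y).
  under eq_bigr => x _ do rewrite evZ ev_osimplex mulr_sumr.
  rewrite exchange_big; apply: eq_bigr => s _ /=.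
  rewrite (bigD1 [ffun j => y ((s^-1)%g j)]) //= big1 => [|x neq_x].
    rewrite altc addr0 odd_permV.
    have -> : [ffun j => [ffun l => y ((s^-1)%g l)] (s j)] = y.
      by apply/ffunP=> j; rewrite !ffunE permK.
    by rewrite eqxx mulr1 mulrAC -signr_addb addbb mul1r.
  case: eqP => [def_y|]; last by rewrite !mulr0.
  by case/eqP: neq_x; apply/ffunP=> j; rewrite -def_y !ffunE permKV.
rewrite sumr_const mulr_natl; congr (_ *+ _).
exact: card_Sn.
Qed.

Lemma altf_noninj i (F : {ffun 'I_i -> V} -> k) (x : {ffun 'I_i -> V}) :
  altf F -> ~~ injectiveb x -> F x = 0.
Proof.
move=> altF /injectiveP ninj; apply: eq_oppr0.
have [j1 [j2 neq_j eq_x]] : exists j1, exists2 j2, j1 != j2 & x j1 = x j2.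
  have: ~~ [forall j1, forall j2, (x j1 == x j2) ==> (j1 == j2)].
    apply/negP=> /forallP inj; apply: ninj => j1 j2 /eqP eqx.
    by have /forallP/(_ j2)/implyP/(_ eqx)/eqP := inj j1.
  rewrite negb_forall => /existsP[j1]; rewrite negb_forall => /existsP[j2].
  by rewrite negb_imply => /andP[/eqP eqx neq_j]; exists j1, j2.
have := altF x (tperm j1 j2); rewrite odd_tperm neq_j mulN1r => <-; congr F.
by apply/ffunP=> j; rewrite ffunE; case: tpermP => [->|->|].
Qed.

Variable K : {set {set V}}.

(** By [alt_expand] an alternating function is a combination of the oriented simplices in its
    support. Tuples with a repeated vertex do not occur there, since an alternating function
    vanishes on them. *)
Lemma chainsP i (c : 'rV_#|{: tup i}|) :
  (c <= chains k K i)%MS <-> alt c /\ forall x, ev c x != 0 -> x @: 'I_i.+1 \in K.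
Proof.
split=> [/sub_sumsmxP[u ->] | [altc suppc]].
  split=> [|y].
    apply: alt_sum => x _; have /submxP[a ->] : (u x *m <<osimplex k x>> <= osimplex k x)%MS.
      by rewrite (submx_trans (submxMl _ _)) ?genmxE.
    by rewrite [a]mx11_scalar mul_scalar_mx; apply/altZ/alt_osimplex.
  apply: contraNT => Ky; rewrite ev_sum big1 // => x /andP[_ Kx].
  have /submxP[a ->] : (u x *m <<osimplex k x>> <= osimplex k x)%MS.
    by rewrite (submx_trans (submxMl _ _)) ?genmxE.
  rewrite [a]mx11_scalar mul_scalar_mx evZ ev_osimplex big1 ?mulr0 // => s _.
  case: eqP => [def_y|]; last by rewrite mulr0.
  case/negP: Ky; rewrite -def_y (_ : _ @: _ = x @: 'I_i.+1) //.
  apply/setP=> v; apply/imsetP/imsetP => -[j _ ->].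
    by exists (s j); rewrite ?ffunE.
  by exists ((s^-1)%g j); rewrite ?ffunE ?permKV.
rewrite (alt_expand altc) scalemx_sub // summx_sub // => x _.
have [cx0 | nz_cx] := eqVneq (ev c x) 0; first by rewrite cx0 scale0r sub0mx.
rewrite scalemx_sub // (sumsmx_sup x) ?genmxE // /is_osimplex suppc // andbT.
by apply: contraNT nz_cx => ninj; rewrite (altf_noninj altc ninj).
Qed.

Lemma ev_boundary i (c : 'rV_#|{: tup i.+1}|) y :
  ev (c *m boundary k V i) y = \sum_v ev c (tcons v y).
Proof.
have -> : boundary k V i = lmx (fun (x : tup i.+1) (z : tup i) => (face ord0 x == z)%:R).
  apply/matrixP=> a b; rewrite !mxE eqxx /= -(inj_eq enum_val_inj) enum_rankK.
  by rewrite eq_sym.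
rewrite ev_lmx (bigID (fun x : tup i.+1 => face ord0 x == y)) /=.
rewrite [X in _ + X]big1 ?addr0 => [|x /negPf->]; last by rewrite mulr0.
rewrite (reindex_onto (fun v => tcons v y) (fun x => x ord0)) /= => [|x /eqP <-]; last first.
  exact: tcons_face.
by apply: eq_big => v; rewrite face_tcons tcons0 ?eqxx // mulr1.
Qed.

Lemma alt_boundary i (c : 'rV_#|{: tup i.+1}|) : alt c -> alt (c *m boundary k V i).
Proof.
move=> altc y s; rewrite !ev_boundary mulr_sumr; apply: eq_bigr => v _.
exact: altf_slice.
Qed.

Lemma boundary_boundary i (c : 'rV_#|{: tup i.+2}|) :
  alt c -> c *m boundary k V i.+1 *m boundary k V i = 0.
Proof.
move=> /alt_expand->; rewrite -!scalemxAl !mulmx_suml big1 ?scaler0 // => x _.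
by rewrite -!scalemxAl boundaryK scaler0.
Qed.

(** The cone over [v0] contracts the full simplex: its boundary is the chain itself minus the cone
    over the boundary, and the latter vanishes for a cycle. *)
Lemma full_exact (v0 : V) i (c : 'rV_#|{: tup i.+1}|) :
    alt c -> c *m boundary k V i = 0 ->
  exists2 b, alt b & b *m boundary k V i.+1 = c.
Proof.
(* [con] is the cone with apex [v0]. *)
move=> altc dc0; pose con m : 'M[k]_(#|{: tup m}|, #|{: tup m.+1}|) :=
  \matrix_a osimplex k (tcons v0 (enum_val a)).
(* The cone is defined on tuples and is already antisymmetric there, so each of the (m + 1)!
   orderings of a simplex contributes the same oriented cone. *)
have con_osimplex m (y : tup m) :
    osimplex k y *m con m = (m.+1)`!%:R *: osimplex k (tcons v0 y).
  rewrite /osimplex mulmx_suml -/(osimplex k (tcons v0 y)).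
  rewrite (eq_bigr (fun=> osimplex k (tcons v0 y))) => [|s _].
    rewrite sumr_const -scaler_nat; congr (_%:R *: _).
    exact: card_Sn.
  rewrite -scalemxAl (pt_matrix (fun z : tup m => osimplex k (tcons v0 z))).
  rewrite tcons_perm osimplex_perm scalerA odd_lift_perm addbb /=.
  by rewrite -signr_addb addbb scale1r.
pose a : k := (i.+2)`!%:R^-1; pose C := \sum_x ev c x *: osimplex k x.
have def_c : c = a *: C by apply: alt_expand.
have nz_a : a != 0 by rewrite invr_eq0 char0_natf_neq0 ?fact_gt0.
have dC0 : C *m boundary k V i = 0.
  by apply/eqP; move/eqP: dc0; rewrite def_c -scalemxAl scaler_eq0 (negPf nz_a).
exists (a *: \sum_x ev c x *: osimplex k (tcons v0 x)).
  by apply/altZ/alt_sum => x _; apply/altZ/alt_osimplex.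
rewrite [RHS]def_c -scalemxAl; congr (_ *: _); rewrite mulmx_suml.
have dcon x : osimplex k (tcons v0 x) *m boundary k V i.+1
    = osimplex k x - (i.+1)`!%:R^-1 *: (osimplex k x *m boundary k V i *m con i).
  rewrite !osimplex_boundary big_ord_recl expr0 scale1r face_tcons; congr (_ + _).
  rewrite mulmx_suml scaler_sumr -sumrN; apply: eq_bigr => h _.
  rewrite -scalemxAl con_osimplex !scalerA mulrCA mulVf ?char0_natf_neq0 ?fact_gt0 //.
  rewrite mulr1 lift0 exprS mulN1r scaleNr.
  congr (- (_ *: osimplex k _)); apply/ffunP=> j; rewrite ffunE.
  have [l ->|->] := unliftP ord0 j; last first.
    have -> : lift (lift ord0 h) ord0 = ord0 :> 'I_i.+3 by apply: val_inj.
    by rewrite !tcons0.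
  have -> : lift (lift ord0 h) (lift ord0 l) = lift ord0 (lift h l) :> 'I_i.+3.
    by apply: val_inj; rewrite /= /bump !add1n ltnS addnS.
  by rewrite !tconsS ffunE.
under eq_bigr => x _ do rewrite -scalemxAl dcon scalerBr.
rewrite sumrB -[RHS]subr0; congr (_ - _).
transitivity ((i.+1)`!%:R^-1 *: (C *m boundary k V i *m con i)).
  rewrite !mulmx_suml scaler_sumr; apply: eq_bigr => x _.
  by rewrite -!scalemxAl scalerA mulrC -scalerA.
by rewrite dC0 mul0mx scaler0.
Qed.

End OneSpace.

Section Push.
Variables (V' V : finType) (phi : V' -> V).

Definition push i : 'M[k]_(#|{: {ffun 'I_i.+1 -> V'}}|, #|{: {ffun 'I_i.+1 -> V}}|) :=
  lmx (fun a y => (tcomp phi a == y)%:R).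

Definition pull i : 'M[k]_(#|{: {ffun 'I_i.+1 -> V}}|, #|{: {ffun 'I_i.+1 -> V'}}|) :=
  pullmx k (@tcomp V' V phi i.+1).

Lemma ev_push_out i (u : 'rV_#|{: {ffun 'I_i.+1 -> V'}}|) y :
  (forall a, tcomp phi a <> y) -> ev (u *m push i) y = 0.
Proof.
by move=> out_y; rewrite ev_lmx big1 // => a _; case: eqP => [/out_y|]; rewrite ?mulr0.
Qed.

Section Injective.
Hypothesis inj_phi : injective phi.

Lemma tcomp_inj i : injective (@tcomp V' V phi i).
Proof.
by move=> a b /ffunP eq_ab; apply/ffunP=> j; apply: inj_phi; have := eq_ab j; rewrite !ffunE.
Qed.

Lemma injective_tcomp i (a : {ffun 'I_i -> V'}) : injectiveb (tcomp phi a) = injectiveb a.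
Proof.
apply/injectiveP/injectiveP => inj_a j l; last by rewrite !ffunE => /inj_phi/inj_a.
by move=> eq_a; apply: inj_a; rewrite !ffunE eq_a.
Qed.

Lemma ev_push_in i (u : 'rV_#|{: {ffun 'I_i.+1 -> V'}}|) a :
  ev (u *m push i) (tcomp phi a) = ev u a.
Proof.
rewrite ev_lmx (bigD1 a) //= eqxx mulr1 big1 ?addr0 // => b neq_ba.
by case: eqP => [/tcomp_inj/eqP | _]; rewrite ?(negPf neq_ba) ?mulr0.
Qed.

Lemma push_inj i (u v : 'rV_#|{: {ffun 'I_i.+1 -> V'}}|) :
  u *m push i = v *m push i -> u = v.
Proof. by move=> eq_uv; apply: ev_inj => a; rewrite -!ev_push_in eq_uv. Qed.

Lemma pullK i (u : 'rV_#|{: {ffun 'I_i.+1 -> V}}|) :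
  (forall y, ev u y != 0 -> exists a, y = tcomp phi a) -> u *m pull i *m push i = u.
Proof.
move=> supp_u; apply: ev_inj => y.
case: (pickP (fun a => y == tcomp phi a)) => [a /eqP-> | out_y].
  by rewrite ev_push_in ev_pull.
rewrite ev_push_out => [|a def_y]; last by have /eqP[] := out_y a.
by apply/esym/eqP/negPn/negP=> /supp_u[a def_y]; have /eqP[] := out_y a.
Qed.

End Injective.

Lemma alt_push i (u : 'rV_#|{: {ffun 'I_i.+1 -> V'}}|) : alt u -> alt (u *m push i).
Proof.
move=> altu y s; rewrite !ev_lmx mulr_sumr.
rewrite (reindex_onto (fun a : {ffun 'I_i.+1 -> V'} => [ffun j => a (s j)])
  (fun a : {ffun 'I_i.+1 -> V'} => [ffun j => a ((s^-1)%g j)])) /= => [|a _]; last first.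
  by apply/ffunP=> j; rewrite !ffunE permK.
apply: eq_big => [a|a _].
  by apply/eqP/ffunP=> j; rewrite !ffunE permKV.
rewrite altu -mulrA; congr (_ * (_ * _%:R)).
congr (nat_of_bool _); apply/eqP/eqP => [/ffunP eq_a | <-]; apply/ffunP=> j; last first.
  by rewrite !ffunE.
by have := eq_a ((s^-1)%g j); rewrite !ffunE permKV.
Qed.

Lemma alt_pull i (u : 'rV_#|{: {ffun 'I_i.+1 -> V}}|) : alt u -> alt (u *m pull i).
Proof.
move=> altu y s; rewrite !ev_pull -altu; congr (ev u _).
by apply/ffunP=> j; rewrite !ffunE.
Qed.

Lemma push_boundary i (u : 'rV_#|{: {ffun 'I_i.+2 -> V'}}|) :
  u *m push i.+1 *m boundary k V i = u *m boundary k V' i *m push i.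
Proof.
apply: ev_inj => y; rewrite ev_boundary ev_lmx.
under eq_bigr => v _ do rewrite ev_lmx.
under [RHS]eq_bigr => a _ do rewrite ev_boundary mulr_suml.
rewrite exchange_big [RHS]exchange_big /=.
rewrite (eq_bigr (fun a => ev u a * (tcomp phi (face ord0 a) == y)%:R)) => [|a _]; last first.
  rewrite -mulr_sumr; congr (_ * _).
  rewrite (bigD1 (phi (a ord0))) //= big1 => [|v neq_v]; last first.
    case: eqP => // /ffunP/(_ ord0); rewrite tcons0 ffunE => def_v.
    by rewrite def_v eqxx in neq_v.
  rewrite addr0; congr (nat_of_bool _)%:R; rewrite -{1}[a]tcons_face tcomp_tcons.
  apply/eqP/eqP => [/(congr1 (face ord0))| <-//]; by rewrite !face_tcons.
rewrite pair_big /= (reindex_onto (fun p => tcons p.1 p.2) (fun a => (a ord0, face ord0 a))) /=.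
  apply: eq_big => [[v a]|[v a] _] /=; first by rewrite tcons0 face_tcons eqxx.
  by rewrite face_tcons.
by move=> a _; rewrite tcons_face.
Qed.

End Push.

End Chains.

Lemma perm_extend (T : finType) (s1 s2 : seq T) :
  uniq s1 -> uniq s2 -> size s1 = size s2 -> exists t : {perm T}, map t s1 = s2.
Proof.
elim: s1 s2 => [|a s1 IHs] [|b s2] //=; first by exists 1%g.
case/andP=> s1a uniq1 /andP[s2b uniq2] [/(IHs _ uniq1 uniq2)[t def_t]].
exists (t * tperm (t a) b)%g; rewrite permM tpermL -def_t; congr (_ :: _).
apply/eq_in_map=> z s1z; rewrite permM tpermD //.
  by rewrite (inj_eq perm_inj); apply: contraNneq s1a => ->.
by apply: contraNneq s2b => ->; rewrite -def_t map_f.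
Qed.

(** * Specht modules of hooks *)

Section ExtendPerm.
Variables (a m : nat) (x : {ffun 'I_a -> 'I_m}).
Hypothesis injx : injective x.

Definition ext_fun (s : 'S_a) (z : 'I_m) : 'I_m :=
  if [pick l | x l == z] is Some l then x (s l) else z.

Lemma ext_funE s l : ext_fun s (x l) = x (s l).
Proof.
by rewrite /ext_fun; case: pickP => [l' /eqP/injx-> | /(_ l)/eqP].
Qed.

Lemma ext_fun_out s z : z \notin codom x -> ext_fun s z = z.
Proof.
by rewrite /ext_fun; case: pickP => // l /eqP <- /negP[]; exact: codom_f.
Qed.

Lemma ext_funK s : cancel (ext_fun s) (ext_fun s^-1%g).
Proof.
move=> z; have [/codomP[l ->] | out_z] := boolP (z \in codom x).
  by rewrite !ext_funE permK.
by rewrite !ext_fun_out.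
Qed.

Definition ext_perm s : 'S_m := perm (can_inj (ext_funK s)).

Lemma ext_permE s l : ext_perm s (x l) = x (s l).
Proof. by rewrite permE ext_funE. Qed.

Lemma ext_perm_out s z : z \notin codom x -> ext_perm s z = z.
Proof. by move=> out_z; rewrite permE ext_fun_out. Qed.

Lemma ext_permM s t : ext_perm (s * t) = (ext_perm s * ext_perm t)%g.
Proof.
apply/permP=> z; rewrite permM; have [/codomP[l ->] | out_z] := boolP (z \in codom x).
  by rewrite !ext_permE permM.
by rewrite !ext_perm_out.
Qed.

Lemma ext_perm_inj : injective ext_perm.
Proof.
by move=> s t eq_st; apply/permP=> l; apply: injx; rewrite -!ext_permE eq_st.
Qed.

Lemma odd_ext_perm s : ext_perm s = s :> bool.
Proof.
have [ts -> dts] := prod_tpermP s.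
elim: ts dts => [_ | [l1 l2] ts IHts /andP[/= neq_l /IHts IH]].
  rewrite big_nil odd_perm1 (_ : ext_perm 1 = 1%g) ?odd_perm1 //.
  by apply: (mulgI (ext_perm 1)); rewrite -ext_permM !mulg1.
rewrite big_cons ext_permM !odd_permM IH; congr (_ (+) _).
rewrite (_ : ext_perm _ = tperm (x l1) (x l2)) ?odd_tperm ?(inj_eq injx) //.
apply/permP=> z; have [/codomP[l ->] | out_z] := boolP (z \in codom x).
  by rewrite ext_permE; case: tpermP => [->|->|n1 n2];
    rewrite ?tpermL ?tpermR // tpermD // (inj_eq injx) eq_sym; apply/eqP.
by rewrite ext_perm_out // tpermD //; apply: contraNneq out_z => <-; apply: codom_f.
Qed.

End ExtendPerm.

Section LinearSpecht.
Variables (k : fieldType) (m : nat).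

Lemma tabloid_of_act lam t s :
  tabloid_act (@tabloid_of m lam t) s = tabloid_of lam (t * s)%g.
Proof. by apply/ffunP=> x; rewrite !ffunE invMg permM. Qed.

Lemma ev_polytabloid lam (t : 'S_m) T :
  ev (polytabloid k lam t) T =
  \sum_(s in col_stab lam t) (-1) ^+ s * (tabloid_of lam (t * s)%g == T)%:R.
Proof.
by rewrite ev_sum; apply: eq_bigr => s _; rewrite evZ ev_pt tabloid_of_act.
Qed.

Lemma specht_linear lam (chi : 'S_m -> k) :
    polytabloid k lam (1%g : 'S_m) != 0 ->
    (forall t : 'S_m, polytabloid k lam t = chi t *: polytabloid k lam (1%g : 'S_m)) ->
  is_linear (specht_repr k m lam) chi.
Proof.
move=> nz_e eq_e.
have def_U : (specht_mx k m lam :=: polytabloid k lam (1%g : 'S_m))%MS.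
  apply/eqmxP/andP; split.
    by apply/sumsmx_subP=> t _; rewrite genmxE eq_e scalemx_sub.
  by rewrite (sumsmx_sup 1%g) // genmxE.
apply: is_linear_submod => [|g _]; first by rewrite def_U rank_rV nz_e.
have /submxP[D def_D] : (specht_mx k m lam <= polytabloid k lam (1%g : 'S_m))%MS by rewrite def_U.
by rewrite def_D -mulmxA polytabloid_act mul1g eq_e -scalemxAr.
Qed.

Lemma specht_trivial lam : lam = int_part m -> is_linear (specht_repr k m lam) (fun=> 1).
Proof.
move=> ->.
have row0 (x : 'I_m) : reshape_index (int_part m) x = 0%N.
  by case: x => x; case: (m) => // i lt_x; rewrite /reshape_index /= subn_eq0 lt_x.
have tabE t : @tabloid_of m (int_part m) t = tabloid_of (int_part m) (1%g : 'S_m).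
  by apply/ffunP=> x; rewrite !ffunE !row0.
have eq_e t : polytabloid k (int_part m) t = pt k (tabloid_of (int_part m) (1%g : 'S_m)).
  apply: ev_inj => T; rewrite ev_polytabloid (big_pred1 1%g) => [|s].
    by rewrite odd_perm1 mul1r tabE ev_pt.
  rewrite inE; apply/forallP/eqP => [fix_s | -> x]; last by rewrite perm1.
  apply/permP=> x; rewrite perm1; have := fix_s x.
  rewrite /tableau_col /reshape_offset !row0 take0 !subn0 => /eqP/val_inj.
  exact: perm_inj.
apply: specht_linear => [|t]; last by rewrite !eq_e scale1r.
apply/eqP=> /(congr1 (fun u => ev u (tabloid_of (int_part m) (1%g : 'S_m)))) /eqP.
by rewrite eq_e ev_pt eqxx ev0 oner_eq0.
Qed.

Lemma specht_sign lam : lam = nseq m 1%N -> is_linear (specht_repr k m lam) (fun s => (-1) ^+ s).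
Proof.
move=> ->.
have rowcol (x : 'I_m) :
    reshape_index (nseq m 1%N) x = x /\ reshape_offset (nseq m 1%N) x = 0%N.
  have def_x : flatten_index (nseq m 1%N) x 0 = x.
    rewrite /flatten_index addn0 take_nseq ?sumn_nseq ?mul1n //.
    by apply: ltnW.
  by rewrite -{1 3}def_x flatten_indexKl ?flatten_indexKr // nth_nseq ltn_ord.
have col_all t : col_stab (nseq m 1%N) t = [set: 'S_m].
  apply/setP=> s; rewrite !inE; apply/forallP=> x.
  by rewrite /tableau_col !(proj2 (rowcol _)).
have tab_inj t : @tabloid_of m (nseq m 1%N) t = tabloid_of (nseq m 1%N) (1%g : 'S_m) -> t = 1%g.
  move/ffunP=> eq_t; apply: invg_inj; rewrite invg1; apply/permP=> x; rewrite perm1; have := eq_t x.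
  rewrite !ffunE !(proj1 (rowcol _)) invg1 perm1 => /(congr1 val) /=.
  have lt y : ((y : 'I_m) < (size (nseq m 1%N)).+1)%N by rewrite size_nseq ltnS ltnW.
  by rewrite !inordK // => /val_inj.
apply: specht_linear => [|t].
  apply/eqP=> /(congr1 (fun u => ev u (tabloid_of (nseq m 1%N) (1%g : 'S_m)))) /eqP.
  rewrite ev_polytabloid ev0 (bigD1 1%g) ?col_all ?inE //= big1 => [|s /andP[_ s1]].
    by rewrite mulg1 eqxx odd_perm1 addr0 mulr1 oner_eq0.
  by rewrite mul1g; case: eqP => [/tab_inj/eqP | _]; rewrite ?(negPf s1) ?mulr0.
apply: ev_inj => T; rewrite evZ !ev_polytabloid !col_all mulr_sumr.
rewrite (reindex_inj (mulgI t^-1%g)) /=; apply: eq_big => [s|s _]; rewrite ?inE //.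
by rewrite mulKVg mul1g odd_permM odd_permV signr_addb mulrA.
Qed.

End LinearSpecht.

Section Hook.
Variables (k : fieldType) (char0 : [pchar k] =i pred0).
Variables (m j r : nat) (lam : seq nat).
Hypotheses (j_gt0 : (0 < j)%N) (def_lam : lam = j :: nseq r.+2 1%N).
Hypothesis def_m : m = (j + r.+2)%N.

Notation tup i := {ffun 'I_i.+1 -> 'I_m}.

Lemma hook_box (p : nat) : (p < m)%N ->
  reshape_index lam p = (if (p < j)%N then 0%N else (p - j).+1) /\
  reshape_offset lam p = (if (p < j)%N then p else 0%N).
Proof.
rewrite def_m => lt_p; case: ltnP => [lt_pj | le_jp].
  have def_p : flatten_index lam 0 p = p by rewrite /flatten_index take0.
  by split; rewrite -{1}def_p ?flatten_indexKl ?flatten_indexKr // def_lam.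
have lt_pr : (p - j < r.+2)%N by rewrite ltn_subLR.
have def_p : flatten_index lam (p - j).+1 0 = p.
  rewrite /flatten_index addn0 def_lam; set s := nseq _ _.
  by rewrite /= /s take_nseq ?(ltnW lt_pr) // sumn_nseq mul1n subnKC.
split; rewrite -{1}def_p ?flatten_indexKl ?flatten_indexKr // def_lam.
  by rewrite -[nth _ _ _.+1]/(nth 0%N (nseq r.+2 1%N) _) nth_nseq lt_pr.
by rewrite -[nth _ _ _.+1]/(nth 0%N (nseq r.+2 1%N) _) nth_nseq lt_pr.
Qed.

Lemma leg_lt (l : 'I_r.+2) : (j + l < m)%N. Proof. by rewrite def_m ltn_add2l. Qed.
Definition leg l : 'I_m := Ordinal (leg_lt l).
Lemma corner_lt : (0 < m)%N. Proof. by rewrite def_m addn_gt0 j_gt0. Qed.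
Definition corner : 'I_m := Ordinal corner_lt.

Definition leg_entries (t : 'S_m) : tup r.+1 := [ffun l => t (leg l)].
Definition col_entries (t : 'S_m) : tup r.+2 := tcons (t corner) (leg_entries t).

Lemma leg_entriesM t s : leg_entries (t * s)%g = [ffun l => s (leg_entries t l)].
Proof. by apply/ffunP=> l; rewrite !ffunE permM. Qed.

Lemma col_entries_inj t : injective (col_entries t).
Proof.
apply/injectiveP; rewrite injective_tcons; apply/andP; split; last first.
  by apply/injectiveP=> l1 l2; rewrite !ffunE => /perm_inj[] /addnI/val_inj.
apply/codomP=> -[l]; rewrite ffunE => /perm_inj[] /eqP.
by rewrite eq_sym addn_eq0 eqn0Ngt j_gt0.
Qed.

Lemma col0P t z : (tableau_col lam t z == 0%N) = (z \in codom (col_entries t)).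
Proof.
rewrite /tableau_col (proj2 (hook_box (ltn_ord _))) codom_tcons.
have -> : (z == t corner) = ((t^-1)%g z == corner).
  by rewrite -{1}[z](permKV t) (inj_eq perm_inj).
rewrite -val_eqE /=; case: ltnP => [lt_j | le_j].
  rewrite orb_idr // => /codomP[l]; rewrite ffunE => def_z.
  by move: lt_j; rewrite def_z permK /= ltnNge leq_addr.
rewrite eqxx; apply/esym/orP; right; apply/codomP.
have lt_r : ((t^-1)%g z - j < r.+2)%N by rewrite ltn_subLR // -def_m.
exists (Ordinal lt_r); rewrite ffunE -[LHS](permKV t); congr (t _).
by apply: val_inj; rewrite /= subnKC.
Qed.

Lemma colN0 (t : 'S_m) z z' : tableau_col lam t z = tableau_col lam t z' ->
  tableau_col lam t z != 0%N -> z = z'.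
Proof.
rewrite /tableau_col !(proj2 (hook_box (ltn_ord _))).
case: ltnP => // _; case: ltnP => [_ /val_inj/perm_inj //|_ ->]; by rewrite eqxx.
Qed.

(** All columns of a hook but the first consist of one box, so the column stabilizer is the full
    symmetric group on the entries of the first column, extended by the identity. *)
Lemma hook_col_stab (t : 'S_m) : col_stab lam t = ext_perm (@col_entries_inj t) @: setT.
Proof.
apply/setP=> s; rewrite inE; apply/forallP/imsetP => [stab_s | [u _ ->] z]; last first.
  have [/codomP[l ->] | out_z] := boolP (z \in codom (col_entries t)).
    have /eqP-> : tableau_col lam t (col_entries t l) == 0%N by rewrite col0P codom_f.
    by rewrite ext_permE col0P codom_f.
  by rewrite ext_perm_out.
have s_col l : s (col_entries t l) \in codom (col_entries t).
  by rewrite -col0P (eqP (stab_s _)) col0P codom_f.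
pose u l := iinv (s_col l).
have uE l : col_entries t (u l) = s (col_entries t l) by exact: f_iinv.
have inj_u : injective u.
  move=> l1 l2 eq_u; apply: (@col_entries_inj t); apply: (@perm_inj _ s).
  by rewrite -!uE eq_u.
exists (perm inj_u) => //; apply/permP=> z.
have [/codomP[l ->] | out_z] := boolP (z \in codom (col_entries t)).
  by rewrite ext_permE permE uE.
by rewrite ext_perm_out //; apply: (@colN0 t); rewrite ?(eqP (stab_s z)) // col0P.
Qed.

(** A tabloid of hook shape is determined by the entries of its leg, read from top to bottom: every
    other entry lies in row 0. Only injective tuples are recovered from the result. *)
Definition tup_tabloid (y : tup r.+1) : {ffun 'I_m -> 'I_(size lam).+1} :=
  [ffun x => if [pick l | y l == x] is Some l then inord l.+1 else ord0].

Lemma size_hook : size lam = r.+3.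
Proof. by rewrite def_lam /= size_nseq. Qed.

Lemma tabloid_leg t : tabloid_of lam t = tup_tabloid (leg_entries t).
Proof.
apply/ffunP=> x; rewrite !ffunE (proj1 (hook_box (ltn_ord _))).
case: pickP => [l|]; rewrite ?ffunE.
  move=> /eqP <-; rewrite permK /= ltnNge leq_addr /=; congr (inord _.+1).
  by rewrite addKn.
move=> out_x; case: ltnP => [_ | le_j].
  by apply: val_inj; rewrite /= inordK.
have lt_r : ((t^-1)%g x - j < r.+2)%N by rewrite ltn_subLR // -def_m.
have := out_x (Ordinal lt_r); rewrite ffunE -{2}[x](permKV t) (inj_eq perm_inj) -val_eqE /=.
by rewrite subnKC ?eqxx.
Qed.

Lemma tup_tabloid_inj (y y' : tup r.+1) : injective y -> tup_tabloid y = tup_tabloid y' -> y = y'.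
Proof.
move=> inj_y /ffunP eq_y; apply/ffunP=> l; have := eq_y (y l); rewrite !ffunE.
case: pickP => [l' /eqP/inj_y-> | /(_ l)/eqP //].
have lt (i : 'I_r.+2) : (i.+1 < (size lam).+1)%N by rewrite size_hook ltnS ltnS ltnW.
case: pickP => [l'' /eqP <- | _] /(congr1 val); rewrite /= !inordK //.
by case=> /val_inj->.
Qed.

Let L : 'M[k]_(_, #|{: tup r.+1}|) := pullmx k tup_tabloid.

(** A column permutation reorders the first column, and the tabloid remembers only the leg of the
    result. The signed sum over all orderings of the column with the head forgotten is the boundary
    of the simplex on the column. *)
Lemma polytabloid_hook t :
  polytabloid k lam t *m L = osimplex k (col_entries t) *m boundary k 'I_m r.+1.
Proof.
apply: ev_inj => y; rewrite ev_pull ev_polytabloid ev_boundary.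
rewrite hook_col_stab big_imset /= => [|u v _ _]; last exact: ext_perm_inj.
under [RHS]eq_bigr => v _ do rewrite ev_osimplex.
rewrite exchange_big /=.
apply: eq_big => [u|u _]; first by rewrite inE.
rewrite odd_ext_perm -mulr_sumr; congr (_ * _).
rewrite tabloid_leg leg_entriesM.
have -> : [ffun l => ext_perm (@col_entries_inj t) u (leg_entries t l)]
    = face ord0 [ffun l => col_entries t (u l)] :> tup r.+1.
  apply/ffunP=> l; rewrite [LHS]ffunE [RHS]ffunE [RHS]ffunE.
  by rewrite -(ext_permE (@col_entries_inj t)) [col_entries t _]tconsS.
set x : tup r.+2 := [ffun l => _].
have inj_x : injective (face ord0 x).
  by move=> l1 l2; rewrite ![face _ _ _]ffunE ![x _]ffunE => /(@col_entries_inj t)/perm_inj/lift_inj.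
rewrite (bigD1 (x ord0)) //= big1 => [|v neq_v]; last first.
  case: eqP => // def_x; case/eqP: neq_v.
  by rewrite def_x tcons0.
rewrite addr0; congr (nat_of_bool _)%:R.
apply/eqP/eqP => [/(tup_tabloid_inj inj_x) <- | ->]; first by rewrite tcons_face.
by rewrite face_tcons.
Qed.

Lemma hook_tableau (x : tup r.+2) : injectiveb x -> exists t, col_entries t = x.
Proof.
move=> inj_x.
have [t def_t] := @perm_extend _ (codom (col_entries 1%g)) (codom x)
  (introT (injectiveP _) (@col_entries_inj 1%g)) inj_x (etrans (size_codom _) (esym (size_codom _))).
exists t; apply/ffunP=> l.
have: nth (x l) (map t (codom (col_entries 1%g))) l = nth (x l) (codom x) l by rewrite def_t.
rewrite (nth_map (x l)) ?size_codom ?card_ord //.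
have nthc (z : tup r.+2) : nth (x l) (codom z) l = z l.
  rewrite /codom /image_mem (nth_map l) ?size_enum_ord //.
  by rewrite nth_ord_enum.
rewrite !nthc => <-; rewrite /col_entries.
have [l' ->|->] := unliftP ord0 l; first by rewrite !tconsS !ffunE perm1.
by rewrite !tcons0 perm1.
Qed.

Lemma tup_tabloid_act (y : tup r.+1) (s : 'S_m) :
  tabloid_act (tup_tabloid y) s = tup_tabloid [ffun l => s (y l)].
Proof.
apply/ffunP=> x; rewrite !ffunE.
have eqp : (fun l => y l == (s^-1)%g x) =1 (fun l => [ffun l => s (y l)] l == x).
  by move=> l; rewrite ffunE -{2}[x](permKV s) (inj_eq perm_inj).
by rewrite (eq_pick eqp).
Qed.

(** Polytabloids become boundaries of simplices of dimension r + 2, and by exactness of the full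
    simplex these span the cycles of dimension r + 1. Nothing is lost under [L], because
    polytabloids involve only tabloids of the form [tup_tabloid y]. *)
Lemma embeds_hook :
  embeds (specht_repr k m lam) (tuple_repr k (perm_action 'I_m) r.+1)
    (fun z => alt z /\ z *m boundary k 'I_m r = 0).
Proof.
apply: embeds_ext (embeds_hom (sigma' := tuple_repr k (perm_action 'I_m) r.+1)
  (A := L) _ _ (embeds_submod (specht_module k m lam))) => [z | s _ u _ | u Uu uL0].
- split=> [[u /sub_sumsmxP[w ->] ->] | [altz dz0]].
    have multiple t : exists a, w t *m <<polytabloid k lam t>>%MS = a *: polytabloid k lam t.
      have /submxP[a ->] : (w t *m <<polytabloid k lam t>> <= polytabloid k lam t)%MS.
        by rewrite (submx_trans (submxMl _ _)) ?genmxE.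
      by exists (a 0 0); rewrite [a]mx11_scalar mul_scalar_mx !mxE.
    split; rewrite ?mulmx_suml.
      apply: alt_sum => t _; have [a ->] := multiple t.
      by rewrite -scalemxAl polytabloid_hook; apply/altZ/alt_boundary/alt_osimplex.
    rewrite big1 // => t _; have [a ->] := multiple t.
    by rewrite -!scalemxAl polytabloid_hook boundaryK scaler0.
  have [b altb def_z] := full_exact char0 corner altz dz0.
  (* A preimage of the boundary of [x]: the polytabloid of some tableau with first column [x]. The
     default 0 serves the non-injective tuples, whose coefficient in [b] vanishes. *)
  pose e (x : tup r.+2) : 'rV[k]_#|{: {ffun 'I_m -> 'I_(size lam).+1}}| :=
    if [pick t | col_entries t == x] is Some t then polytabloid k lam t else 0.
  exists ((r.+3)`!%:R^-1 *: \sum_x ev b x *: e x).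
    rewrite scalemx_sub // summx_sub // => x _; rewrite scalemx_sub // /e.
    case: pickP => [t _ | _]; last exact: sub0mx.
    by rewrite (sumsmx_sup t) ?genmxE.
  rewrite -def_z {1}(alt_expand char0 altb) -!scalemxAl !mulmx_suml; congr (_ *: _).
  apply: eq_bigr => x _; rewrite -!scalemxAl.
  have [inj_x | ninj_x] := boolP (injectiveb x); last first.
    by rewrite (altf_noninj char0 altb ninj_x) !scale0r.
  rewrite /e; case: pickP => [t /eqP <- | no_t]; first by rewrite polytabloid_hook.
  by have [t def_t] := hook_tableau inj_x; have /eqP := no_t t.
- apply: ev_inj => y; rewrite ev_pull !ev_permutation ev_pull.
  congr (ev u _); rewrite /= tup_tabloid_act; congr tup_tabloid.
apply: ev_inj => T; rewrite ev0.
case: (pickP (fun y : tup r.+1 => tup_tabloid y == T)) => [y /eqP <- | noT].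
  by rewrite -[LHS](ev_pull tup_tabloid) uL0 ev0.
have /sub_sumsmxP[w ->] := Uu; rewrite ev_sum big1 // => t _.
have /submxP[a ->] : (w t *m <<polytabloid k lam t>> <= polytabloid k lam t)%MS.
  by rewrite (submx_trans (submxMl _ _)) ?genmxE.
rewrite [a]mx11_scalar mul_scalar_mx evZ ev_polytabloid big1 ?mulr0 // => s _.
by rewrite tabloid_leg noT mulr0.
Qed.

End Hook.

(** * Geometry of the cube: stars and special tetrahedra *)

Ltac eqcase := repeat (rewrite ?eqxx /=; match goal with
  |- context [?x == ?y] => let E := fresh in let N := fresh in
     case: (eqVneq x y) => [E|N];
     [first [subst x | subst y];
      try (match goal with H : is_true (negb (?z == ?z)) |- _ => by rewrite eqxx in H end)
     | rewrite ?(eq_sym y x) ?(negPf N)] end).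

Lemma z2P (x : 'Z_2) : x = 0 \/ x = 1.
Proof. by case: x => [[|[|//]] ?]; [left | right]; apply: val_inj. Qed.

Ltac z2ring := apply/rowP => ?; rewrite ?mxE;
  repeat match goal with |- context [fun_of_matrix ?u 0 ?i] =>
    let x := fresh in
    move: (fun_of_matrix u 0 i) => x; case: (z2P x) => {x}-> end;
  by apply/eqP.

Section Cube.
Variable n : nat.
Notation V := 'rV['Z_2]_n.
Implicit Types (u v x y : V) (a b c d : option 'I_n).

Lemma z2_natr_eq0 m : (m%:R == 0 :> 'Z_2) = ~~ odd m.
Proof. by rewrite -val_eqE /= val_Zp_nat // modn2; case: odd. Qed.

Lemma addxx x : x + x = 0.
Proof.
apply/rowP=> i; rewrite !mxE -mulr2n -mulr_natr.
by apply/eqP; rewrite (_ : 2%:R = 0) ?mulr0 //; apply/eqP; rewrite z2_natr_eq0.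
Qed.

Lemma addvK x y : y + x + x = y.
Proof. by rewrite -addrA addxx addr0. Qed.

Lemma oppv x : - x = x.
Proof. by apply/eqP; rewrite eq_sym -addr_eq0 addxx. Qed.

Lemma addv_eq0 x y : (x + y == 0) = (x == y).
Proof. by rewrite addr_eq0 oppv. Qed.

(* The unit vectors, together with 0 for the index None. *)
Fact e_key : unit. Proof. by []. Qed.
Definition e a : V := locked_with e_key (\row_i (a == Some i)%:R).

Lemma eE a i : e a 0 i = (a == Some i)%:R.
Proof. by rewrite /e unlock mxE. Qed.

Lemma e0 : e None = 0.
Proof. by apply/rowP=> i; rewrite eE mxE. Qed.

Definition esum (s : seq (option 'I_n)) : V := \sum_(a <- s) e a.

(** Coordinate i of the sum counts the occurrences of [Some i] modulo 2. The index [None] is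
    invisible in the sum; its parity follows from the even length of the list. *)
Lemma esum_parity s p : esum s = 0 -> ~~ odd (size s) -> ~~ odd (count_mem p s).
Proof.
move=> s0 even_s; have evenS i : ~~ odd (count_mem (Some i) s).
  rewrite -z2_natr_eq0; have /rowP/(_ i) := s0; rewrite summxE mxE => <-.
  rewrite -sum1_count natr_sum big_mkcond; apply/eqP/eq_bigr => a _.
  by rewrite eE /=; case: eqP.
case: p => [i|]; first exact: evenS.
apply: contra even_s => odd0; suff -> : size s = \sum_(a : option 'I_n) count_mem a s.
  rewrite (bigD1 None) //= oddD odd0 /=.
  apply: (big_ind (fun m => ~~ odd m)) => // [m1 m2 o1 o2|[i|] //].
  by rewrite oddD (negPf o1).
elim: (s) => [|a s' IHs] /=; first by rewrite big1.
rewrite big_split /= -IHs (bigD1 a) //= eqxx big1 ?addn0 // => b neq_ba.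
by rewrite eq_sym (negPf neq_ba).
Qed.

Lemma e4 a b c d : e a + e b + e c + e d = 0 ->
  [|| (a == b) && (c == d), (a == c) && (b == d) | (a == d) && (b == c)].
Proof.
move=> s0; have par p : ~~ odd (count_mem p [:: a; b; c; d]).
  by apply: esum_parity => //; rewrite /esum !big_cons big_nil addr0 !addrA.
by have /= := par a; have /= := par b; have /= := par c; rewrite !oddD !oddb /=; clear par s0; eqcase.
Qed.

Lemma e_inj : injective e.
Proof.
move=> a b eq_ab.
have : e a + e b + e None + e None = 0 by rewrite eq_ab addxx add0r addxx.
by case/e4/or3P=> /andP[/eqP eq1 /eqP eq2]; rewrite eq1 ?eq2.
Qed.

Definition phi v a : V := v + e a.

Lemma phi_inj v : injective (phi v).
Proof. by move=> a b /addrI/e_inj. Qed.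

(** Two shared vertices give e_a + e_a' + e_b + e_b' = 0. If a' differs from a, then [e4] forces a'
    = b, and the pair a, c likewise forces a' = c, contradicting b != c. So distinct stars meet in
    at most two vertices. *)
Lemma star_uniq v u a b c a' b' c' :
    a != b -> a != c -> b != c ->
  phi v a = phi u a' -> phi v b = phi u b' -> phi v c = phi u c' -> v = u.
Proof.
move=> nab nac nbc eqa eqb eqc.
have rel d d' d1 d1' : phi v d = phi u d' -> phi v d1 = phi u d1' ->
    e d + e d' + e d1 + e d1' = 0.
  rewrite /phi => eq1 eq2.
  have -> : e d' = u + v + e d by rewrite -addrA eq1 addrA addxx add0r.
  have -> : e d1' = u + v + e d1 by rewrite -addrA eq2 addrA addxx add0r.
  have -> : e d + (u + v + e d) + e d1 + (u + v + e d1)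
    = 0 by z2ring.
  by [].
have := e4 (rel _ _ _ _ eqa eqb); have := e4 (rel _ _ _ _ eqa eqc).
rewrite (negPf nab) (negPf nac) /=; have [eq_a _ _ | _ /=] := eqVneq a a'.
  by move: eqa; rewrite -eq_a => /addIr.
by case/andP=> _ /eqP -> /andP[_ /eqP eq_c]; rewrite -eq_c eqxx in nbc.
Qed.

Lemma hamming_phi x a b : (hamming x (x + e a + e b) <= 2)%N.
Proof.
rewrite /hamming -(card_imset _ (@Some_inj _)).
apply: leq_trans (_ : #|[set a; b]| <= 2)%N; last by rewrite cards2; case: (_ != _).
apply/subset_leq_card/subsetP=> _ /imsetP[i + ->]; rewrite !inE !mxE !eE.
by apply: contraR; rewrite negb_or ![Some i == _]eq_sym => /andP[/negPf-> /negPf->]; rewrite !addr0.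
Qed.

Lemma hammingP x y : reflect (exists a b, y = x + e a + e b) (hamming x y <= 2)%N.
Proof.
apply: (iffP idP) => [le2 | [a [b ->]]]; last exact: hamming_phi.
have coord i : y 0 i = x 0 i + (x 0 i != y 0 i)%:R.
  by case: (z2P (x 0 i)) => ->; case: (z2P (y 0 i)) => ->; apply/eqP.
move: le2 coord; rewrite /hamming; set D := [set i | _]; move=> le2 coord.
have {}coord i : y 0 i = x 0 i + (i \in D)%:R by rewrite inE.
move: D coord le2 => D coord; rewrite leq_eqVlt ltnS leq_eqVlt ltnS leqn0.
case/or3P=> [/cards2P[i [j [neq_ij def_D]]] | /cards1P[i def_D] | /eqP/cards0_eq def_D].
- exists (Some i), (Some j); apply/rowP=> l; rewrite coord def_D !mxE !eE !inE -addrA.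
  congr (_ + _); rewrite ![Some _ == Some l](inj_eq (@Some_inj _)) ![_ == l]eq_sym.
  by have [-> | _] := eqVneq l i; [rewrite (negPf neq_ij) addr0 | rewrite add0r].
- exists (Some i), None; apply/rowP=> l; rewrite coord def_D !mxE !eE !inE -addrA addr0.
  by rewrite (inj_eq (@Some_inj _)) eq_sym.
by exists None, None; apply/rowP=> l; rewrite coord def_D e0 !addr0 inE addr0.
Qed.

Lemma rips_tuple i (x : {ffun 'I_i.+1 -> V}) :
  (x @: 'I_i.+1 \in rips n 2) <-> (forall j l, (hamming (x j) (x l) <= 2)%N).
Proof.
rewrite inE; split=> [/andP[_ /forall_inP dx] j l | dx].
  by have /forall_inP := dx (x j) (imset_f _ isT); apply; rewrite imset_f.
apply/andP; split; first by apply/set0Pn; exists (x ord0); rewrite imset_f.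
by apply/forall_inP=> _ /imsetP[j _ ->]; apply/forall_inP=> _ /imsetP[l _ ->].
Qed.

Lemma e6 a b c d f g p : e a + e b + e c + e d + e f + e g = 0 ->
  (a == p) (+) (b == p) (+) (c == p) (+) (d == p) (+) (f == p) (+) (g == p) = false.
Proof.
move=> s0; have := @esum_parity [:: a; b; c; d; f; g] p; rewrite /esum !big_cons big_nil addr0.
by rewrite !addrA => /(_ s0 isT); rewrite /= !oddD !oddb /= addbF !addbA => /negPf.
Qed.

(** The three differences give a relation between six unit vectors, two for each edge. By parity the
    pairs of the two edges at [x0] share an index, and shifting [x0] by that index gives the
    centre. *)
Lemma triangle_star x0 x1 x2 :
    x0 != x1 -> x0 != x2 -> x1 != x2 ->
    (hamming x0 x1 <= 2)%N -> (hamming x0 x2 <= 2)%N -> (hamming x1 x2 <= 2)%N ->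
  exists v a b c, [/\ x0 = phi v a, x1 = phi v b & x2 = phi v c].
Proof.
move=> n01 n02 n12 /hammingP[a [b def1]] /hammingP[c [d def2]] /hammingP[f [g def3]].
have s0 : e a + e b + e c + e d + e f + e g = 0.
  have : x2 + x2 = 0 by rewrite addxx.
  by rewrite {1}def2 def3 def1 => <-; z2ring.
have nab : a != b by apply: contraNneq n01 => eq_ab; rewrite def1 eq_ab addvK.
have ncd : c != d by apply: contraNneq n02 => eq_cd; rewrite def2 eq_cd addvK.
have nfg : f != g by apply: contraNneq n12 => eq_fg; rewrite def3 eq_fg addvK.
have [eq1|n1] := eqVneq a c.
  by exists (x0 + e a), a, b, d; rewrite /phi addvK; split=> //; rewrite def2 eq1.
have [eq1|n2] := eqVneq a d.
  by exists (x0 + e a), a, b, c; rewrite /phi addvK; split=> //; rewrite def2 eq1 addrAC.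
have [eq1|n3] := eqVneq b c.
  exists (x0 + e b), b, a, d; rewrite /phi addvK; split=> //; first by rewrite def1 addrAC.
  by rewrite def2 eq1.
have [eq1|n4] := eqVneq b d.
  exists (x0 + e b), b, a, c; rewrite /phi addvK; split=> //; first by rewrite def1 addrAC.
  by rewrite def2 eq1 addrAC.
exfalso; have := e6 a s0; have := e6 b s0; have := e6 c s0; clear - nab ncd nfg n1 n2 n3 n4.
rewrite !eqxx (eq_sym b a) (eq_sym c a) (eq_sym c b) (eq_sym d a) (eq_sym d b) (eq_sym d c).
rewrite (negPf nab) (negPf ncd) (negPf n1) (negPf n2) (negPf n3) (negPf n4) /=.
by eqcase.
Qed.

(** Write [x] from each of the three vertices with two unit vectors. If those from [phi v a] avoid
    a, the parity of a in the comparison with b puts a among those from [phi v b]; the parity of c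
    in the comparison of b with c then leaves only the two alternatives. *)
Lemma tetra_star_or_special v a b c x :
    a != b -> a != c -> b != c ->
    (hamming (phi v a) x <= 2)%N -> (hamming (phi v b) x <= 2)%N ->
    (hamming (phi v c) x <= 2)%N ->
  (exists d, x = phi v d) \/ x = v + e a + e b + e c.
Proof.
move=> nab nac nbc /hammingP[f [g deff]] /hammingP[h [i defh]] /hammingP[j [l defj]].
move: deff defh defj; rewrite /phi => deff defh defj.
have [eq1|nfa] := eqVneq f a; first by left; exists g; rewrite deff eq1 addvK.
have [eq1|nga] := eqVneq g a; first by left; exists f; rewrite deff eq1 addrAC addvK.
have sfh : e a + e f + e g + e b + e h + e i = 0.
  have : x + x = 0 by rewrite addxx.
  by rewrite {1}deff defh => <-; z2ring.
have sfj : e b + e h + e i + e c + e j + e l = 0.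
  have : x + x = 0 by rewrite addxx.
  by rewrite {1}defh defj => <-; z2ring.
have := e6 a sfh; rewrite eqxx (eq_sym b a) (negPf nfa) (negPf nga) (negPf nab) /=.
have [eq_h | nha] := eqVneq h a.
  move=> _; have := e6 c sfj; rewrite eqxx eq_h (negPf nbc) (negPf nac) /=.
  have [eq_i _ | nic] := eqVneq i c.
    by right; rewrite defh eq_h eq_i; z2ring.
  have [eq_j _ | njc] := eqVneq j c.
    by left; exists l; rewrite defj eq_j addvK.
  have [eq_l _ | nlc] := eqVneq l c => //.
  by left; exists j; rewrite defj eq_l addrAC addvK.
have [eq_i _ | nia] //= := eqVneq i a.
have := e6 c sfj; rewrite eqxx eq_i (negPf nbc) (negPf nac) /=.
have [eq_h _ | nhc] := eqVneq h c.
  by right; rewrite defh eq_h eq_i; z2ring.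
have [eq_j _ | njc] := eqVneq j c.
  by left; exists l; rewrite defj eq_j addvK.
have [eq_l _ | nlc] := eqVneq l c => //.
by left; exists j; rewrite defj eq_l addrAC addvK.
Qed.

Lemma special_not_star v u a b c : a != b -> a != c -> b != c ->
  ~ exists a' b' c' d', [/\ phi v a = phi u a', phi v b = phi u b', phi v c = phi u c'
     & v + e a + e b + e c = phi u d'].
Proof.
move=> nab nac nbc [a' [b' [c' [d' [eqa eqb eqc]]]]].
rewrite -(star_uniq nab nac nbc eqa eqb eqc) /phi -!addrA => /addrI eq_e.
have: e a + e b + e c + e d' = 0 by rewrite -eq_e; z2ring.
by move/e4; rewrite (negPf nab) (negPf nac) (negPf nbc) /= andbF.
Qed.

(** The two vertices differ by four distinct vectors [e], at most one of them zero, so their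
    distance is at least 3. Hence a special tetrahedron has no further neighbour in the star. *)
Lemma special_isolated v a b c d : a != b -> a != c -> b != c ->
    d != a -> d != b -> d != c ->
  ~~ (hamming (phi v d) (v + e a + e b + e c) <= 2)%N.
Proof.
move=> nab nac nbc nda ndb ndc; apply/negP=> /hammingP[f [g]]; rewrite /phi => eq_e.
have s0 : e a + e b + e c + e d + e f + e g = 0.
  have : (v + e a + e b + e c) + (v + e a + e b + e c) = 0 by rewrite addxx.
  by rewrite {2}eq_e => <-; z2ring.
have := e6 a s0; have := e6 b s0; have := e6 c s0; clear - nab nac nbc nda ndb ndc.
rewrite !eqxx (negPf nda) (negPf ndb) (negPf ndc) (eq_sym b a) (eq_sym c a) (eq_sym c b).
rewrite (negPf nab) (negPf nac) (negPf nbc) /=.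
by eqcase.
Qed.

Lemma tuple_star i (x : {ffun 'I_i.+1 -> V}) v :
  (forall j, exists d, x j = phi v d) -> exists t, x = tcomp (phi v) t.
Proof.
move=> star; exists [ffun j => odflt None [pick d | x j == phi v d]].
apply/ffunP=> j; rewrite !ffunE; case: pickP => [d /eqP // | no_d].
by have [d def_d] := star j; have /eqP := no_d d.
Qed.

(** For three distinct coordinates these are alternate vertices of a 3-dimensional face; if one of
    three distinct indices is [None], they are the four vertices of a square. *)
Definition special v a b c : {ffun 'I_4 -> V} :=
  T4 (phi v a) (phi v b) (phi v c) (v + e a + e b + e c).

Lemma simplex3 (x : {ffun 'I_3 -> V}) : injectiveb x ->
  x @: 'I_3 \in rips n 2 -> exists v t, x = tcomp (phi v) t.
Proof.
have [x0 [x1 [x2 ->]]] := T3P x; rewrite injective_T3 => /and3P[n01 n02 n12] /rips_tuple dx.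
have [|||v [a [b [c [-> -> ->]]]]] := triangle_star n01 n02 n12.
- by have := dx ord0 (lift ord0 ord0); rewrite tcons0 tconsS tcons0.
- by have := dx ord0 (lift ord0 (lift ord0 ord0)); rewrite tcons0 !tconsS tcons0.
- by have := dx (lift ord0 ord0) (lift ord0 (lift ord0 ord0)); rewrite !tconsS !tcons0.
by exists v, (T3 a b c); rewrite tcomp_T3.
Qed.

Lemma simplex4 (x : {ffun 'I_4 -> V}) : injectiveb x -> x @: 'I_4 \in rips n 2 ->
  (exists v t, x = tcomp (phi v) t) \/ (exists v a b c, x = special v a b c).
Proof.
have [x0 [x1 [x2 [x3 ->]]]] := T4P x.
rewrite injective_T4 => /and5P[n01 n02 n03 n12 /andP[n13 n23]] /rips_tuple dx.
pose o1 : 'I_4 := lift ord0 ord0; pose o2 : 'I_4 := lift ord0 (lift ord0 ord0).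
pose o3 : 'I_4 := lift ord0 (lift ord0 (lift ord0 ord0)).
have [x0E x1E x2E x3E] : [/\ T4 x0 x1 x2 x3 ord0 = x0, T4 x0 x1 x2 x3 o1 = x1,
    T4 x0 x1 x2 x3 o2 = x2 & T4 x0 x1 x2 x3 o3 = x3].
  by rewrite /T4 /T3 /T2 /T1 /o1 /o2 /o3 !tconsS !tcons0.
have := dx ord0 o1; have := dx ord0 o2; have := dx o1 o2.
have := dx ord0 o3; have := dx o1 o3; have := dx o2 o3.
rewrite x0E x1E x2E x3E => d23 d13 d03 d12 d02 d01.
have [v [a [b [c [eq0 eq1 eq2]]]]] := triangle_star n01 n02 n12 d01 d02 d12.
move: n01 n02 n12 d23 d13 d03; rewrite eq0 eq1 eq2 !(inj_eq (@phi_inj v)).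
move=> nab nac nbc dc db da; have [[d ->] | ->] := tetra_star_or_special nab nac nbc da db dc.
  by left; exists v, (T4 a b c d); rewrite tcomp_T4.
by right; exists v, a, b, c.
Qed.

(** Three vertices fix the star. A vertex outside it would be the fourth vertex of a special
    tetrahedron, and a fifth vertex, lying in the star, would be too far from it by
    [special_isolated]. *)
Lemma simplex5 i (x : {ffun 'I_i.+1 -> V}) : (4 <= i)%N -> injectiveb x ->
  x @: 'I_i.+1 \in rips n 2 -> exists v t, x = tcomp (phi v) t.
Proof.
move=> i_ge4 /injectiveP inj_x /rips_tuple dx.
pose o m : 'I_i.+1 := inord m.
have neq_o m m' : (m < 5)%N -> (m' < 5)%N -> m != m' -> x (o m) != x (o m').
  move=> lt_m lt_m' neq_m; rewrite (inj_eq inj_x) -val_eqE /= !inordK //.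
    by apply: leq_trans lt_m' _.
  by apply: leq_trans lt_m _.
have [|||v [a [b [c [eq0 eq1 eq2]]]]] :=
  triangle_star (neq_o 0 1 isT isT isT) (neq_o 0 2 isT isT isT) (neq_o 1 2 isT isT isT).
1-3: exact: dx.
have := neq_o 0 1 isT isT isT; have := neq_o 0 2 isT isT isT; have := neq_o 1 2 isT isT isT.
rewrite eq0 eq1 eq2 !(inj_eq (@phi_inj v)) => nbc nac nab.
have dich j : (exists d, x j = phi v d) \/ x j = v + e a + e b + e c.
  by apply: tetra_star_or_special => //; rewrite -?eq0 -?eq1 -?eq2; apply: dx.
exists v; apply: tuple_star => j; have [// | def_j] := dich j.
(* The assumption that the dimension is at least 4 supplies a vertex besides the three fixed ones
   and [j]. *)
have: (0 < #|~: [set o 0; o 1; o 2; j]|)%N.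
  have le4 : (#|[set o 0; o 1; o 2; j]| <= 4)%N.
    apply: leq_trans (leq_card_setU _ _) _; rewrite cards1 addn1 ltnS.
    apply: leq_trans (leq_card_setU _ _) _; rewrite cards1 addn1 ltnS.
    by apply: leq_trans (leq_card_setU _ _) _; rewrite !cards1.
  by rewrite cardsCs setCK card_ord subn_gt0 ltnS (leq_trans le4).
case/card_gt0P=> l; rewrite !inE !negb_or -!andbA => /and4P[nl0 nl1 nl2 nlj].
have [[d def_l] | def_l] := dich l; last first.
  by case/eqP: nlj; apply: inj_x; rewrite def_j def_l.
have nda : d != a by apply: contraNneq nl0 => eq_d; apply/eqP/inj_x; rewrite def_l eq_d eq0.
have ndb : d != b by apply: contraNneq nl1 => eq_d; apply/eqP/inj_x; rewrite def_l eq_d eq1.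
have ndc : d != c by apply: contraNneq nl2 => eq_d; apply/eqP/inj_x; rewrite def_l eq_d eq2.
by have /negP[] := special_isolated v nab nac nbc nda ndb ndc; rewrite -def_l -def_j; apply: dx.
Qed.

End Cube.

Lemma tcons_inj (V : finType) i (a b : V) (x y : {ffun 'I_i -> V}) :
  tcons a x = tcons b y -> a = b /\ x = y.
Proof.
move/ffunP=> eq_t; split; first by have := eq_t ord0; rewrite !tcons0.
by apply/ffunP=> j; have := eq_t (lift ord0 j); rewrite !tconsS.
Qed.

Lemma T4_inj (V : finType) (a b c d a' b' c' d' : V) :
  T4 a b c d = T4 a' b' c' d' -> [/\ a = a', b = b', c = c' & d = d'].
Proof. by do 4!case/tcons_inj=> ->. Qed.

(** * Chains carried by the stars *)

Section Stars.
Variables (k : fieldType) (char0 : [pchar k] =i pred0) (n : nat).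
Notation V := 'rV['Z_2]_n.
Notation A := (option 'I_n).
Notation atup i := {ffun 'I_i.+1 -> A}.
Notation vtup i := {ffun 'I_i.+1 -> V}.
Local Notation K := (rips n 2).
Local Notation bd := (boundary k _ _).

Definition starsum i (t : V -> 'rV[k]_#|{: atup i}|) : 'rV[k]_#|{: vtup i}| :=
  \sum_v t v *m push k (phi v) i.

Lemma alt_starsum i (t : V -> 'rV_#|{: atup i}|) : (forall v, alt (t v)) -> alt (starsum t).
Proof. by move=> altt; apply: alt_sum => v _; apply: alt_push. Qed.

Lemma starsum_boundary i (t : V -> 'rV_#|{: atup i.+1}|) :
  starsum t *m bd = starsum (fun v => t v *m bd).
Proof. by rewrite mulmx_suml; apply: eq_bigr => v _; rewrite push_boundary. Qed.

Lemma starsumD i (t s : V -> 'rV_#|{: atup i}|) :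
  starsum (fun v => t v + s v) = starsum t + starsum s.
Proof. by rewrite -big_split; apply: eq_bigr => v _; rewrite mulmxDl. Qed.

Lemma starsum_out i (t : V -> 'rV_#|{: atup i}|) x :
  ev (starsum t) x != 0 -> exists v a, x = tcomp (phi v) a.
Proof.
move=> nz_x; case: (pickP (fun p : V * atup i => x == tcomp (phi p.1) p.2)) => [[v a] /eqP -> | out_x].
  by exists v, a.
rewrite ev_sum big1 ?eqxx // in nz_x => v _; apply: ev_push_out => a def_x.
by have /eqP[] := out_x (v, a).
Qed.

Lemma star_simplex v i (a : atup i) : tcomp (phi v) a @: 'I_i.+1 \in K.
Proof.
apply/rips_tuple => j l; rewrite !ffunE; apply/hammingP; exists (a j), (a l).
by rewrite /phi; z2ring.
Qed.

Lemma starsum_chain i (t : V -> 'rV_#|{: atup i}|) :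
  (forall v, alt (t v)) -> (starsum t <= chains k K i)%MS.
Proof.
move=> altt; apply/(chainsP char0); split; first exact: alt_starsum.
by move=> x /starsum_out[v [a ->]]; apply: star_simplex.
Qed.

Lemma tcomp_star_uniq j (v u : V) (a b : atup j.+2) :
  injectiveb a -> tcomp (phi v) a = tcomp (phi u) b -> v = u.
Proof.
move=> /injectiveP inj_a /ffunP eq_t.
pose o1 : 'I_j.+3 := lift ord0 ord0; pose o2 : 'I_j.+3 := lift ord0 (lift ord0 ord0).
have eqj i : phi v (a i) = phi u (b i) by have := eq_t i; rewrite !ffunE.
by apply: (star_uniq _ _ _ (eqj ord0) (eqj o1) (eqj o2)); rewrite (inj_eq inj_a).
Qed.

Lemma ev_starsum j (t : V -> 'rV_#|{: atup j.+2}|) v (a : atup j.+2) : injectiveb a ->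
  ev (starsum t) (tcomp (phi v) a) = ev (t v) a.
Proof.
move=> inj_a; rewrite ev_sum (bigD1 v) //= (ev_push_in (@phi_inj _ v)) big1 ?addr0 // => u neq_uv.
apply: ev_push_out => b /esym/(tcomp_star_uniq inj_a) eq_vu.
by rewrite eq_vu eqxx in neq_uv.
Qed.

(** The index [j.+2] means at least three vertices, so that each simplex determines its star and the
    component at [v] is just the restriction to that star. *)
Lemma star_decomp j (c : 'rV_#|{: vtup j.+2}|) : alt c ->
    (forall x : vtup j.+2, injectiveb x -> ev c x != 0 -> exists v a, x = tcomp (phi v) a) ->
  c = starsum (fun v => c *m pull k (phi v) j.+2).
Proof.
move=> altc star_c; apply: ev_inj => x.
have alts : alt (starsum (fun v => c *m pull k (phi v) j.+2)).
  by apply: alt_starsum => v; apply: alt_pull.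
have [inj_x | ninj_x] := boolP (injectiveb x); last first.
  by rewrite !(altf_noninj char0 _ ninj_x).
case: (pickP (fun p : V * atup j.+2 => x == tcomp (phi p.1) p.2)) => [[v a] /eqP/= def_x | out_x].
  by move: inj_x; rewrite def_x (injective_tcomp (@phi_inj _ _)) => /ev_starsum->; rewrite ev_pull.
transitivity (0 : k); apply/eqP; last rewrite eq_sym.
  by apply/negPn/negP=> /(star_c _ inj_x)[v [a def_x]]; have /eqP[] := out_x (v, a).
by apply/negPn/negP=> /starsum_out[v [a def_x]]; have /eqP[] := out_x (v, a).
Qed.

Lemma sum_star v (F : V -> k) : (forall u, F u != 0 -> exists d, u = phi v d) ->
  \sum_u F u = \sum_d F (phi v d).
Proof.
move=> starF; rewrite (bigID [in phi v @: setT]) /= [X in _ + X]big1 ?addr0 => [|u out_u].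
  rewrite big_imset => [|a b _ _ /phi_inj //]; by apply: eq_bigl => a; rewrite inE.
by apply: contraNeq out_u => /starF[d ->]; apply: imset_f.
Qed.

Lemma cyclesP i (c : 'rV_#|{: vtup i.+1}|) :
  (c <= cycles k K i.+1)%MS <-> (c <= chains k K i.+1)%MS /\ c *m bd = 0.
Proof.
rewrite sub_capmx; split=> [/andP[-> /sub_kermxP] // | [-> dc0]].
by apply/sub_kermxP.
Qed.

Lemma boundariesP i (c : 'rV_#|{: vtup i}|) :
  (c <= boundaries k K i)%MS <-> exists2 b, (b <= chains k K i.+1)%MS & c = b *m bd.
Proof.
rewrite genmxE; split=> [/submxP[x ->] | [b bK ->]]; last exact: submxMr.
by exists (x *m chains k K i.+1); rewrite ?submxMl ?mulmxA.
Qed.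

Lemma star_fill i (t : V -> 'rV_#|{: atup i.+1}|) :
    (forall v, alt (t v)) -> (forall v, t v *m bd = 0) ->
  (starsum t <= boundaries k K i.+1)%MS.
Proof.
move=> altt dt0.
have /fin_all_exists2[s alts ds] v := full_exact char0 None (altt v) (dt0 v).
apply/boundariesP; exists (starsum s); first exact: starsum_chain.
by rewrite starsum_boundary; apply: eq_bigr => v _; rewrite ds.
Qed.

(** The faces here still have at least three vertices and so belong to a single star. Boundaries of
    different components therefore cannot cancel: each component is a cycle of a full simplex and is
    filled there. *)
Lemma star_cycle_boundary j (c : 'rV_#|{: vtup j.+3}|) : alt c -> c *m bd = 0 ->
    (forall x : vtup j.+3, injectiveb x -> ev c x != 0 -> exists v a, x = tcomp (phi v) a) ->
  (c <= boundaries k K j.+3)%MS.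
Proof.
move=> altc dc0 star_c; rewrite (star_decomp altc star_c).
have altp v : alt (c *m pull k (phi v) j.+3) by apply: alt_pull.
apply: star_fill => // v; apply: ev_inj => b; rewrite ev0.
have [inj_b | ninj_b] := boolP (injectiveb b); last first.
  rewrite (altf_noninj char0 _ ninj_b) //; apply: alt_boundary; exact: altp.
rewrite ev_boundary.
transitivity (ev (c *m bd) (tcomp (phi v) b)); last by rewrite dc0 ev0.
rewrite ev_boundary (@sum_star v) => [|u nz_u].
  by apply: eq_bigr => d _; rewrite ev_pull tcomp_tcons.
have inj_u : injectiveb (tcons u (tcomp (phi v) b)).
  by apply: contraNT nz_u => ninj_u; rewrite (altf_noninj char0 altc ninj_u).
have [w [a def_a]] := star_c _ inj_u nz_u.
move: def_a; rewrite -(tcons_face a) tcomp_tcons => /tcons_inj[def_u def_b].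
by exists (a ord0); rewrite (tcomp_star_uniq inj_b def_b).
Qed.

Lemma chain_simplex i (c : 'rV_#|{: vtup i}|) x :
  (c <= chains k K i)%MS -> ev c x != 0 -> injectiveb x /\ x @: 'I_i.+1 \in K.
Proof.
move=> /(chainsP char0)[altc suppc] nz_x; split; last exact: suppc.
by apply: contraNT nz_x => ninj_x; rewrite (altf_noninj char0 altc ninj_x).
Qed.

Lemma homology_high i : (4 <= i)%N -> (cycles k K i <= boundaries k K i)%MS.
Proof.
case: i => [|[|[|i]]] // i_ge4; apply/row_subP=> l.
have /cyclesP[chain_c dc0] := row_sub l (cycles k K i.+3).
have [altc _] := (proj1 (chainsP char0 _ _) chain_c).
apply: star_cycle_boundary => // x inj_x nz_x.
exact: simplex5 (proj2 (chain_simplex chain_c nz_x)).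
Qed.

End Stars.

(** * Chains of special tetrahedra *)

Section Special.
Variables (k : fieldType) (char0 : [pchar k] =i pred0) (n : nat).
Notation V := 'rV['Z_2]_n.
Notation A := (option 'I_n).
Notation atup i := {ffun 'I_i.+1 -> A}.
Notation vtup i := {ffun 'I_i.+1 -> V}.
Local Notation K := (rips n 2).
Local Notation bd := (boundary k _ _).

Definition distinct3 (a b c : A) := [&& a != b, a != c & b != c].

Lemma special_inj v u (a b c a' b' c' : A) : distinct3 a b c ->
  special v a b c = special u a' b' c' -> [/\ v = u, a = a', b = b' & c = c'].
Proof.
case/and3P=> nab nac nbc /T4_inj[eqa eqb eqc _].
have eq_v := star_uniq nab nac nbc eqa eqb eqc.
by rewrite -eq_v in eqa eqb eqc *; split=> //; apply: (@phi_inj _ v).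
Qed.

Lemma special_swap01 v (a b c : A) :
  special v b a c = T4 (phi v b) (phi v a) (phi v c) (v + e a + e b + e c).
Proof. by rewrite /special; congr T4; z2ring. Qed.

Lemma special_swap12 v (a b c : A) :
  special v a c b = T4 (phi v a) (phi v c) (phi v b) (v + e a + e b + e c).
Proof. by rewrite /special; congr T4; z2ring. Qed.

(** The same four vertices can be based at v + e_a + e_b, with the other parity-opposite labelling
    of the last two. This change of base is why the functions on special tetrahedra must be
    invariant under v -> v + e_a + e_b. *)
Lemma special_swap23 v (a b c : A) :
  special (v + e a + e b) b a c = T4 (phi v a) (phi v b) (v + e a + e b + e c) (phi v c).
Proof. by rewrite /special /phi; congr T4; z2ring. Qed.

Lemma special_simplex v (a b c : A) : special v a b c @: 'I_4 \in K.
Proof.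
have hamC (x y : V) : hamming x y = hamming y x.
  by congr #|pred_of_set _|; apply/setP=> i; rewrite !inE eq_sym.
have ham x y (a' b' : A) : y = x + e a' + e b' -> (hamming x y <= 2)%N /\ (hamming y x <= 2)%N.
  by move=> ->; split; last rewrite hamC; apply: hamming_phi.
pose w := v + e a + e b + e c.
have [ab ba] : (hamming (phi v a) (phi v b) <= 2)%N /\ (hamming (phi v b) (phi v a) <= 2)%N.
  by apply: (ham _ _ a b); rewrite /phi; z2ring.
have [ac ca] : (hamming (phi v a) (phi v c) <= 2)%N /\ (hamming (phi v c) (phi v a) <= 2)%N.
  by apply: (ham _ _ a c); rewrite /phi; z2ring.
have [bc cb] : (hamming (phi v b) (phi v c) <= 2)%N /\ (hamming (phi v c) (phi v b) <= 2)%N.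
  by apply: (ham _ _ b c); rewrite /phi; z2ring.
have [aw wa] : (hamming (phi v a) w <= 2)%N /\ (hamming w (phi v a) <= 2)%N.
  by apply: (ham _ _ b c); rewrite /w /phi; z2ring.
have [bw wb] : (hamming (phi v b) w <= 2)%N /\ (hamming w (phi v b) <= 2)%N.
  by apply: (ham _ _ a c); rewrite /w /phi; z2ring.
have [cw wc] : (hamming (phi v c) w <= 2)%N /\ (hamming w (phi v c) <= 2)%N.
  by apply: (ham _ _ a b); rewrite /w /phi; z2ring.
have refl x : (hamming x x <= 2)%N by apply/hammingP; exists None, None; rewrite e0 !addr0.
have coord (i : 'I_4) : [|| special v a b c i == phi v a, special v a b c i == phi v b,
    special v a b c i == phi v c | special v a b c i == w].
  by have := codom_f (special v a b c) i; rewrite /special 3!codom_tcons codom_T1.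
apply/rips_tuple => i j.
by have /or4P[] := coord i => /eqP->; have /or4P[] := coord j => /eqP->.
Qed.

(* The value on the simplex [special v a b c] of the chain that corresponds   *)
(* to the family [f] of alternating functions.                                *)
Variable f : V -> 'rV[k]_#|{: atup 2}|.
Hypothesis altF : forall v, alt (f v).
Hypothesis invF : forall v a b c, ev (f (v + e a + e b)) (T3 a b c) = ev (f v) (T3 a b c).

Definition special_fun (x : vtup 3) : k :=
  oapp (fun q : V * A * A * A => ev (f q.1.1.1) (T3 q.1.1.2 q.1.2 q.2)) 0
    [pick q : V * A * A * A | distinct3 q.1.1.2 q.1.2 q.2
                              && (x == special q.1.1.1 q.1.1.2 q.1.2 q.2)].

Lemma special_funE v a b c : distinct3 a b c ->
  special_fun (special v a b c) = ev (f v) (T3 a b c).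
Proof.
move=> dabc; rewrite /special_fun; case: pickP => [[[[u a'] b'] c'] /= | no_q].
  by case/andP=> _ /eqP/(special_inj dabc)[-> -> -> ->].
by have := no_q (v, a, b, c); rewrite /= dabc eqxx.
Qed.

Lemma special_fun_out x : special_fun x != 0 ->
  exists v a b c, distinct3 a b c /\ x = special v a b c.
Proof.
rewrite /special_fun; case: pickP => [[[[v a] b] c] /= /andP[dabc /eqP def_x] _ | _].
  by exists v, a, b, c.
by rewrite eqxx.
Qed.

Lemma special_fun_opp x x' :
    (forall v a b c, distinct3 a b c -> x = special v a b c -> special_fun x' = - special_fun x) ->
    (forall v a b c, distinct3 a b c -> x' = special v a b c -> special_fun x = - special_fun x') ->
  special_fun x = - special_fun x'.
Proof.
move=> xx' x'x; have [x0 | ] := eqVneq (special_fun x) 0; last first.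
  by case/special_fun_out=> v [a [b [c [dabc def_x]]]]; rewrite (xx' v a b c) ?opprK.
have [x'0 | ] := eqVneq (special_fun x') 0; first by rewrite x0 x'0 oppr0.
by case/special_fun_out=> v [a [b [c [dabc def_x]]]]; rewrite (x'x v a b c).
Qed.

Lemma altf_special_fun : altf special_fun.
Proof.
have swap01 v a b c x0 x1 x2 x3 : distinct3 a b c -> T4 x0 x1 x2 x3 = special v a b c ->
    special_fun (T4 x1 x0 x2 x3) = - special_fun (T4 x0 x1 x2 x3).
  move=> dabc def_x; rewrite def_x; case/T4_inj: def_x => -> -> -> ->.
  rewrite -special_swap01 !special_funE //; first exact: altf_T3l (@altF v).
  by case/and3P: dabc => nab nac nbc; rewrite /distinct3 eq_sym nab nbc nac.
have swap12 v a b c x0 x1 x2 x3 : distinct3 a b c -> T4 x0 x1 x2 x3 = special v a b c ->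
    special_fun (T4 x0 x2 x1 x3) = - special_fun (T4 x0 x1 x2 x3).
  move=> dabc def_x; rewrite def_x; case/T4_inj: def_x => -> -> -> ->.
  rewrite -special_swap12 !special_funE //; first exact: altf_T3r (@altF v).
  by case/and3P: dabc => nab nac nbc; rewrite /distinct3 [c == b]eq_sym nab nbc nac.
(* Exchanging the last two vertices changes the base point, so this is where [invF] enters. *)
have swap23 v a b c x0 x1 x2 x3 : distinct3 a b c -> T4 x0 x1 x2 x3 = special v a b c ->
    special_fun (T4 x0 x1 x3 x2) = - special_fun (T4 x0 x1 x2 x3).
  move=> dabc def_x; rewrite def_x; case/T4_inj: def_x => -> -> -> ->.
  rewrite -special_swap23 !special_funE //; last first.
    by case/and3P: dabc => nab nac nbc; rewrite /distinct3 eq_sym nab nbc nac.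
  by rewrite (altf_T3l _ _ _ (@altF _)) invF.
apply: altf4 => x0 x1 x2 x3; apply: special_fun_opp => v a b c dabc def_x.
- exact: swap01 def_x.
- exact: swap01 def_x.
- exact: swap12 def_x.
- exact: swap12 def_x.
- exact: swap23 def_x.
exact: swap23 def_x.
Qed.

Definition special_chain : 'rV[k]_#|{: vtup 3}| := fv special_fun.

Lemma alt_special_chain : alt special_chain.
Proof. by move=> x s; rewrite !ev_fv altf_special_fun. Qed.

Lemma special_chain_in : (special_chain <= chains k K 3)%MS.
Proof.
apply/(chainsP char0); split; first exact: alt_special_chain.
by move=> x; rewrite ev_fv => /special_fun_out[v [a [b [c [_ ->]]]]]; apply: special_simplex.
Qed.

Lemma altf_rot (F : vtup 3 -> k) u a b c : altf F -> F (T4 u a b c) = - F (T4 a b c u).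
Proof.
by move=> aF; rewrite (altf_T4l _ _ _ _ aF) (altf_T4m _ _ _ _ aF) opprK (altf_T4r _ _ _ _ aF).
Qed.

Lemma T4_special_star v a b c y u a' b' c' : distinct3 a b c ->
  T4 (phi v a) (phi v b) (phi v c) y = special u a' b' c' -> y = v + e a + e b + e c.
Proof.
case/and3P=> nab nac nbc /T4_inj[eqa eqb eqc ->].
have eq_v := star_uniq nab nac nbc eqa eqb eqc.
by move: eqa eqb eqc; rewrite -eq_v => /phi_inj-> /phi_inj-> /phi_inj->.
Qed.

(** A triangle v + e_a, v + e_b, v + e_c has only one special coface, with apex v + e_a + e_b + e_c.
    The boundary puts the apex first and [special] puts it last; this is an odd permutation, whence
    the sign. *)
Lemma special_chain_boundary : special_chain *m bd = - starsum f.
Proof.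
have altb : alt (special_chain *m bd) by apply/alt_boundary/alt_special_chain.
have alts : alt (starsum f) by apply: alt_starsum.
apply: ev_inj => y; rewrite evN.
have [inj_y | ninj_y] := boolP (injectiveb y); last first.
  by rewrite !(altf_noninj char0 _ ninj_y) ?oppr0.
case: (pickP (fun p : V * atup 2 => y == tcomp (phi p.1) p.2)) => [[v t] /eqP/= def_y | out_y].
  move: inj_y; rewrite def_y (injective_tcomp (@phi_inj _ v)) => inj_t; rewrite ev_starsum //.
  have [a [b [c def_t]]] := T3P t; move: inj_t; rewrite def_t injective_T3 => dabc.
  rewrite tcomp_T3 ev_boundary (bigD1 (v + e a + e b + e c)) //= big1 ?addr0 => [|u neq_u].
    by rewrite ev_fv (altf_rot _ _ _ _ altf_special_fun) special_funE.
  rewrite ev_fv (altf_rot _ _ _ _ altf_special_fun); apply/eqP; rewrite oppr_eq0.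
  apply: contraNT neq_u => /special_fun_out[u' [a' [b' [c' [_ def_x]]]]].
  by rewrite (T4_special_star dabc def_x).
have -> : ev (starsum f) y = 0.
  apply/eqP/negPn/negP=> /starsum_out[v [a def_x]]; by have /eqP[] := out_y (v, a).
rewrite oppr0 ev_boundary big1 // => u _; have [y0 [y1 [y2 def_y]]] := T3P y.
rewrite def_y ev_fv (altf_rot _ _ _ _ altf_special_fun); apply/eqP; rewrite oppr_eq0.
apply/negPn/negP=> /special_fun_out[v [a [b [c [_ /T4_inj[eq0 eq1 eq2 _]]]]]].
by have /eqP[] := out_y (v, T3 a b c); rewrite tcomp_T3 def_y eq0 eq1 eq2.
Qed.

End Special.

Section CubeFunction.
Variables (k : fieldType) (char0 : [pchar k] =i pred0) (n : nat).
Notation V := 'rV['Z_2]_n.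
Notation A := (option 'I_n).
Notation atup i := {ffun 'I_i.+1 -> A}.
Notation vtup i := {ffun 'I_i.+1 -> V}.
Local Notation K := (rips n 2).
Local Notation bd := (boundary k _ _).

Definition spec v (t : atup 2) : vtup 3 :=
  special v (t ord0) (t (lift ord0 ord0)) (t (lift ord0 (lift ord0 ord0))).

Lemma spec_T3 v a b c : spec v (T3 a b c) = special v a b c.
Proof. by rewrite /spec /T3 /T2 /T1 !tconsS !tcons0. Qed.

Variable c : 'rV[k]_#|{: vtup 3}|.
Hypothesis altc : alt c.

Definition cube_fun v : 'rV[k]_#|{: atup 2}| := c *m pullmx k (spec v).

Lemma ev_cube_fun v a b d : ev (cube_fun v) (T3 a b d) = ev c (special v a b d).
Proof. by rewrite ev_pull spec_T3. Qed.

Lemma alt_cube_fun v : alt (cube_fun v).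
Proof.
apply: altf3 => a b d; rewrite !ev_cube_fun.
  by rewrite special_swap01 [LHS](altf_T4l _ _ _ _ altc).
by rewrite special_swap12 [LHS](altf_T4m _ _ _ _ altc).
Qed.

Lemma cube_fun_inv v a b d :
  ev (cube_fun (v + e a + e b)) (T3 a b d) = ev (cube_fun v) (T3 a b d).
Proof.
have alt_v := @alt_cube_fun (v + e a + e b).
rewrite (altf_T3l _ _ _ alt_v) !ev_cube_fun special_swap23.
by rewrite (altf_T4r _ _ _ _ altc) opprK.
Qed.

Hypothesis cycle_c : (c <= cycles k K 3)%MS.

(** The tetrahedra over a triangle of the star of [v] are those of the star and one special
    tetrahedron. Vanishing of the boundary of [c] at the triangle equates their two
    contributions. *)
Lemma cube_fun_boundary v : cube_fun v = c *m pull k (phi v) 3 *m bd.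
Proof.
have [chain_c dc0] := proj1 (cyclesP _) cycle_c.
apply: ev_inj => t.
have altp : alt (c *m pull k (phi v) 3 *m bd) by apply/alt_boundary/alt_pull.
have [inj_t | ninj_t] := boolP (injectiveb t); last first.
  by rewrite !(altf_noninj char0 _ ninj_t) //; apply: alt_cube_fun.
have [a [b [d def_t]]] := T3P t; move: inj_t; rewrite def_t injective_T3 => dabd.
have [nab nad nbd] := and3P dabd.
have : ev (c *m bd) (T3 (phi v a) (phi v b) (phi v d)) = 0 by rewrite dc0 ev0.
rewrite !ev_boundary ev_cube_fun.
pose w := v + e a + e b + e d.
have not_star : w \notin phi v @: [set: A].
  apply/imsetP=> -[d' _ def_w]; case: (@special_not_star _ v v a b d nab nad nbd).
  by exists a, b, d, d'.
rewrite (bigD1 w) //= -/(T4 w _ _ _) (altf_rot _ _ _ _ altc).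
rewrite (bigID [in phi v @: setT]) /= [X in _ + (_ + X)]big1 ?addr0 => [|u /andP[neq_uw out_u]]; last first.
  have nbd' : distinct3 a b d by [].
  rewrite -/(T4 u _ _ _) (altf_rot _ _ _ _ altc); apply/eqP; rewrite oppr_eq0.
  apply: contraNT out_u => nz_u; have [inj_u simp_u] := chain_simplex char0 chain_c nz_u.
  have [[u' [t' def_x]] | [u' [a' [b' [d' def_x]]]]] := simplex4 inj_u simp_u.
    move: def_x; have [a' [b' [d' [f' ->]]]] := T4P t'; rewrite tcomp_T4 => /T4_inj[eqa eqb eqd ->].
    by rewrite (star_uniq nab nad nbd eqa eqb eqd); apply: imset_f.
  by rewrite (T4_special_star nbd' def_x) eqxx in neq_uw.
rewrite addrC => /eqP; rewrite subr_eq0 => /eqP <-.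
rewrite (eq_bigl [in phi v @: setT]) => [|u]; last first.
  by apply: andb_idl => star_u; apply: contraNneq not_star => <-.
rewrite big_imset => [|x y _ _ /phi_inj //].
by apply: eq_big => [x|x _]; rewrite ?inE // ev_pull tcomp_tcons tcomp_T3.
Qed.

End CubeFunction.

Section LowDegree.
Variables (k : fieldType) (n : nat).
Notation V := 'rV['Z_2]_n.
Notation A := (option 'I_n).
Notation atup i := {ffun 'I_i.+1 -> A}.

(** An edge joining v + e_a to v + e_b lies in exactly two stars, those of v and of v + e_a + e_b;
    in the second the two indices are exchanged. *)
Lemma ev_starsum_edge (t : V -> 'rV[k]_#|{: atup 1}|) v (a b : A) : a != b ->
  ev (starsum t) (T2 (phi v a) (phi v b))
    = ev (t v) (T2 a b) + ev (t (v + e a + e b)) (T2 b a).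
Proof.
move=> nab; set w := v + e a + e b.
have neq_wv : w != v.
  apply: contraNneq nab => eq_w; apply/eqP/e_inj.
  have -> : e a = v + w + e b by rewrite /w; z2ring.
  by rewrite eq_w addxx add0r.
rewrite ev_sum (bigD1 v) //= (bigD1 w) //= addrA big1 ?addr0 => [|u /andP[neq_uv neq_uw]].
  rewrite -!tcomp_T2 (ev_push_in (@phi_inj _ v)) tcomp_T2; congr (_ + _).
  have -> : T2 (phi v a) (phi v b) = tcomp (phi w) (T2 b a).
    by rewrite tcomp_T2 /phi /w; congr T2; z2ring.
  exact: (ev_push_in (@phi_inj _ w)).
apply: ev_push_out => t'; have [a' [b' ->]] := T2P t'; rewrite tcomp_T2 /phi.
case/tcons_inj=> eqa /tcons_inj[eqb _].
have s0 : e a + e b + e a' + e b' = 0.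
  have -> : e a' = u + v + e a by rewrite -addrA -eqa; z2ring.
  have -> : e b' = u + v + e b by rewrite -addrA -eqb; z2ring.
  z2ring.
have /or3P[] := e4 s0; first by rewrite (negPf nab).
  case/andP=> /eqP eq_a _; move: eqa; rewrite eq_a => /addIr eq_uv.
  by rewrite eq_uv eqxx in neq_uv.
case/andP=> _ /eqP eq_b; case/eqP: neq_uw.
by apply: (@addIr _ (e a')); rewrite eqa /w -eq_b addvK.
Qed.

Lemma sum_T1 (V' : finType) (F : {ffun 'I_1 -> V'} -> k) : \sum_t F t = \sum_a F (T1 a).
Proof.
rewrite (reindex_onto (@T1 V') (fun t => t ord0)) => [|t _]; last by rewrite -T1P.
by apply: eq_bigl => a; rewrite tcons0 eqxx.
Qed.

Lemma ev_starsum_vertex (t : V -> 'rV[k]_#|{: atup 0}|) x :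
  ev (starsum t) (T1 x) = \sum_a ev (t (x + e a)) (T1 a).
Proof.
rewrite ev_sum; under eq_bigr => v _ do rewrite ev_lmx sum_T1.
rewrite exchange_big; apply: eq_bigr => a _ /=.
rewrite (bigD1 (x + e a)) //= big1 => [|v neq_v].
  by rewrite tcomp_T1 /phi addvK eqxx mulr1 addr0.
rewrite tcomp_T1; case: eqP => [/tcons_inj[def_x _] | _]; last by rewrite mulr0.
by rewrite -def_x /phi addvK eqxx in neq_v.
Qed.

End LowDegree.

(** * Homology in low degrees *)

Section Fourier.
Variables (k : fieldType) (char0 : [pchar k] =i pred0) (n : nat).
Notation V := 'rV['Z_2]_n.
Notation A := (option 'I_n).
Implicit Types (w : {set 'I_n}) (u v : V) (a b c d : A).

Definition chi w v : k := \prod_(i in w) (-1) ^+ v 0 i.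

Lemma z2_signD (x y : 'Z_2) : (-1) ^+ (x + y)%R = (-1) ^+ x * (-1) ^+ y :> k.
Proof.
by case: (z2P x) => ->; case: (z2P y) => ->; rewrite ?(addr0, add0r) /= ?expr0 ?expr1 ?mulrNN ?mul1r ?mulr1.
Qed.

Lemma chiD w u v : chi w (u + v) = chi w u * chi w v.
Proof. by rewrite -big_split; apply: eq_bigr => i _; rewrite mxE z2_signD. Qed.

Lemma chi0 w : chi w 0 = 1.
Proof. by rewrite /chi big1 // => i _; rewrite mxE. Qed.

Lemma chi_sqr w v : chi w v * chi w v = 1.
Proof. by rewrite -chiD addxx chi0. Qed.

Lemma chi_eS w i : chi w (e (Some i)) = (-1) ^+ (i \in w).
Proof.
rewrite /chi; have [w_i | wN_i] := boolP (i \in w).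
  rewrite (bigD1 i) //= eE eqxx big1 ?mulr1 // => j /andP[_ neq_ji].
  by rewrite eE (inj_eq (@Some_inj _)) eq_sym (negPf neq_ji).
rewrite big1 // => j w_j; rewrite eE (inj_eq (@Some_inj _)).
by case: eqP => // eq_ij; rewrite eq_ij w_j in wN_i.
Qed.

Lemma chi_sign w v : chi w v = 1 \/ chi w v = -1.
Proof.
rewrite /chi; elim/big_ind: _ => [|x y [->|->] [->|->]|i _]; rewrite ?mulrNN ?mul1r ?mulr1; auto.
by case: (z2P (v 0 i)) => ->; auto.
Qed.

Lemma neq1N1 : (1 == -1 :> k) = false.
Proof.
by apply/negP=> /eqP eq1; have /eqP := eq_oppr0 char0 eq1; rewrite oner_eq0.
Qed.

Lemma sum_chi v : \sum_w chi w v = if v == 0 then 2%:R ^+ n else 0.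
Proof.
transitivity (\prod_(i < n) ((-1) ^+ v 0 i + 1 : k)).
  rewrite bigA_distr; apply: eq_bigr => w _.
  by rewrite /chi big_mkcond.
case: eqP => [-> | /eqP nz_v].
  rewrite (eq_bigr (fun=> 2%:R)) => [|i _]; last by rewrite mxE.
  by rewrite prodr_const card_ord.
have /existsP[i nz_vi] : [exists i, v 0 i != 0].
  rewrite -negb_forall; apply: contra nz_v => /forallP v0.
  by apply/eqP/rowP=> i; rewrite mxE; apply/eqP.
rewrite (bigD1 i) //=; case: (z2P (v 0 i)) nz_vi => -> //= _.
by rewrite expr1 addNr mul0r.
Qed.

Definition four (F : V -> k) w : k := \sum_v chi w v * F v.
Definition ifour (G : {set 'I_n} -> k) v : k := (2%:R ^+ n)^-1 * \sum_w chi w v * G w.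

Lemma fourK F v : ifour (four F) v = F v.
Proof.
rewrite /ifour; under eq_bigr => w _ do rewrite mulr_sumr.
rewrite exchange_big (bigD1 v) //= [X in _ + X]big1 ?addr0 => [|u neq_uv].
  rewrite (eq_bigr (fun=> F v)) => [|w _]; last by rewrite mulrA chi_sqr mul1r.
  rewrite (eq_bigl [in [set: {set 'I_n}]]) => [|w]; last by rewrite inE.
  rewrite sumr_const -[F v *+ _]mulr_natl mulrA -powersetT card_powerset.
  by rewrite cardsT card_ord natrX mulVf ?mul1r //; apply: expf_neq0; exact: (@char0_natf_neq0 k char0 2 isT).
under eq_bigr => w _ do rewrite mulrA -chiD.
by rewrite -mulr_suml sum_chi addv_eq0 eq_sym (negPf neq_uv) mul0r.
Qed.

Lemma eq_ifour G G' v : (forall w, G w = G' w) -> ifour G v = ifour G' v.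
Proof. by move=> eqG; congr (_ * _); apply: eq_bigr => w _; rewrite eqG. Qed.

Lemma ifour_sum (I : finType) (G : I -> {set 'I_n} -> k) v :
  \sum_i ifour (G i) v = ifour (fun w => \sum_i G i w) v.
Proof.
rewrite -mulr_sumr; congr (_ * _); rewrite exchange_big; apply: eq_bigr => w _.
by rewrite mulr_sumr.
Qed.

Lemma ifourN G v : ifour (fun w => - G w) v = - ifour G v.
Proof.
rewrite /ifour -mulrN; congr (_ * _); rewrite -sumrN.
by apply: eq_bigr => w _; rewrite mulrN.
Qed.

Lemma ifour_shift G v u : (forall w, G w != 0 -> chi w u = 1) -> ifour G (v + u) = ifour G v.
Proof.
move=> suppG; congr (_ * _); apply: eq_bigr => w _.
have [-> | nzG] := eqVneq (G w) 0; first by rewrite !mulr0.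
by rewrite chiD (suppG w nzG) mulr1.
Qed.

Lemma four_shift F u w : four (fun v => F (v + u)) w = chi w u * four F w.
Proof.
rewrite /four mulr_sumr (reindex_inj (@addIr _ u)) /=; apply: eq_bigr => v _.
by rewrite addvK chiD mulrCA mulrA mulrAC -mulrA mulrA.
Qed.

Lemma four_sum (I : finType) (F : I -> V -> k) w :
  \sum_i four (F i) w = four (fun v => \sum_i F i v) w.
Proof. by rewrite exchange_big; apply: eq_bigr => v _; rewrite mulr_sumr. Qed.

(** The sign of [chi] on the vectors [e] divides the indices into two blocks, with [None] always in
    the block of sign 1. By [same_chi] this indicator is (1 + chi(e_a) chi(e_b)) / 2, so sums over a
    block come from plain and twisted sums. *)
Definition same w a b : k := (chi w (e a) == chi w (e b))%:R.
Definition blk w a : k := \sum_b same w b a.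

Lemma sameC w a b : same w a b = same w b a. Proof. by rewrite /same eq_sym. Qed.

Lemma same_neq0 w a b : same w a b != 0 -> chi w (e a) = chi w (e b).
Proof. by rewrite /same; case: (chi w (e a) =P _); rewrite ?eqxx. Qed.

Lemma same1 w a b : chi w (e a) = chi w (e b) -> same w a b = 1.
Proof. by rewrite /same => ->; rewrite eqxx. Qed.

Lemma blk_neq0 w a : blk w a != 0.
Proof.
rewrite /blk -natr_sum (char0_natf_neq0 char0) // (bigD1 a) //= eqxx.
by rewrite addn_gt0.
Qed.

Lemma blk_eq w a b : chi w (e a) = chi w (e b) -> blk w a = blk w b.
Proof. by move=> eq_ab; rewrite /blk /same eq_ab. Qed.

Lemma same_chi w a b : 2%:R * same w a b = 1 + chi w (e a) * chi w (e b).
Proof.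
rewrite /same; have N11 : (-1 == 1 :> k) = false by rewrite eq_sym neq1N1.
by case: (chi_sign w (e a)) => ->; case: (chi_sign w (e b)) => ->;
  rewrite ?eqxx ?neq1N1 ?N11 ?mulrNN ?mulr1 ?mul1r ?mulr0 ?subrr //.
Qed.

Lemma same_chi1 w a b : same w a b != 0 -> chi w (e a + e b) = 1.
Proof. by move=> /same_neq0 eq_ab; rewrite chiD eq_ab chi_sqr. Qed.

(* Over each character of the translation group the two lemmas below are the  *)
(* contraction of the simplices on the two blocks {a | chi(e_a) = 1} and      *)
(* {a | chi(e_a) = -1}, averaged over the apex of the cone.                   *)
Lemma fill_vertices (D : V -> A -> k) :
    (forall v, \sum_a D v a = 0) -> (forall v, \sum_a D (v + e a) a = 0) ->
  exists f : V -> A -> A -> k, [/\ forall v a b, f v a b = - f v b a,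
    forall v a b, f (v + e a + e b) a b = f v a b
  & forall v a, \sum_d f v d a = D v a].
Proof.
move=> sum1 sum2; pose hD w a := four (D^~ a) w.
(* The two hypotheses say that the plain and the [chi]-twisted sums of [hD w] vanish; combining them
   gives the vanishing over each block separately. *)
have block0 w a : \sum_d same w d a * hD w d = 0.
  have h1 : \sum_d hD w d = 0 by rewrite four_sum /four big1 // => v _; rewrite sum1 mulr0.
  have h2 : \sum_d chi w (e d) * hD w d = 0.
    under eq_bigr => d _ do rewrite -(four_shift (D^~ d)).
    by rewrite (four_sum (fun d v => D (v + e d) d)) /four big1 // => v _; rewrite sum2 mulr0.
  have: 2%:R * (\sum_d same w d a * hD w d) = 0.
    transitivity (\sum_d hD w d + chi w (e a) * \sum_d chi w (e d) * hD w d).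
      rewrite !mulr_sumr -big_split; apply: eq_bigr => d _.
      by rewrite mulrA same_chi /=; ring.
    by rewrite h1 h2 mulr0 addr0.
  by move/eqP; rewrite mulf_eq0 (negPf (char0_natf_neq0 char0 (isT : 0 < 2)%N)) //= => /eqP.
pose G a b w := same w a b / blk w b * (hD w b - hD w a).
have suppG a b w : G a b w != 0 -> same w a b != 0.
  by apply: contraNneq => s0; rewrite /G s0 !mul0r.
exists (fun v a b => ifour (G a b) v); split=> [v a b|v a b|v a].
- rewrite -ifourN; apply: eq_ifour => w; rewrite /G sameC -mulrN opprB.
  have [-> | /same_neq0 eq_ab] := eqVneq (same w b a) 0; first by rewrite !mul0r.
  by rewrite (blk_eq eq_ab).
- by rewrite -addrA; apply: ifour_shift => w /suppG; exact: same_chi1.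
rewrite ifour_sum -[RHS](fourK (D^~ a)); apply: eq_ifour => w.
under eq_bigr => d _ do rewrite /G mulrBr.
rewrite sumrB -[\sum_d _ * hD w a]mulr_suml -mulr_suml divff ?blk_neq0 // mul1r.
under eq_bigr => d _ do rewrite mulrAC.
by rewrite -mulr_suml block0 mul0r subr0.
Qed.

Lemma fill_edges (g : V -> A -> A -> k) :
    (forall v a b, g v a b = - g v b a) ->
    (forall v a b, g (v + e a + e b) a b = g v a b) ->
    (forall v a, \sum_d g v d a = 0) ->
  exists f : V -> A -> A -> A -> k, [/\ forall v a b c, f v a b c = - f v b a c,
    forall v a b c, f v a b c = - f v a c b,
    forall v a b c, f (v + e a + e b) a b c = f v a b c
  & forall v a b, \sum_d f v d a b = g v a b].
Proof.
move=> altg invg sumg; pose h w a b := four (fun v => g v a b) w.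
have alth w a b : h w a b = - h w b a.
  by rewrite /h /four -sumrN; apply: eq_bigr => v _; rewrite altg mulrN.
(* Invariance of [g] under v -> v + e_a + e_b gives chi(e_a + e_b) h = h, so [h] lives on pairs
   inside one block. *)
have supph w a b : h w a b = same w a b * h w a b.
  have: chi w (e a + e b) * h w a b = h w a b.
    rewrite /h -four_shift; apply: eq_bigr => v _.
    by rewrite addrA invg.
  rewrite chiD => eq_h.
  have: 2%:R * (same w a b * h w a b) = 2%:R * h w a b.
    by rewrite mulrA same_chi mulrDl mul1r eq_h -[2%:R]/(1 + 1) mulrDl !mul1r.
  by move/(mulfI (char0_natf_neq0 char0 (isT : 0 < 2)%N)).
have sumh w a : \sum_d h w d a = 0.
  by rewrite four_sum /four big1 // => v _; rewrite sumg mulr0.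
pose G a b c w := same w a b * same w b c / blk w b * (h w a b + h w b c + h w c a).
exists (fun v a b c => ifour (G a b c) v); split=> [v a b c|v a b c|v a b c|v a b].
- rewrite -ifourN; apply: eq_ifour => w; rewrite /G (sameC w b a).
  have [-> | /same_neq0 eq_ab] := eqVneq (same w a b) 0; first by rewrite !mul0r oppr0.
  rewrite (blk_eq eq_ab) (alth w b a) (alth w a c) (alth w c b) -mulrN !opprD !opprK.
  rewrite /same eq_ab; ring.
- rewrite -ifourN; apply: eq_ifour => w; rewrite /G (sameC w c b).
  have [-> | /same_neq0 eq_bc] := eqVneq (same w b c) 0.
    by rewrite !(mulr0, mul0r) oppr0.
  rewrite (blk_eq eq_bc) (alth w a c) (alth w c b) (alth w b a) -mulrN !opprD !opprK.
  rewrite /same eq_bc; ring.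
- rewrite -addrA; apply: ifour_shift => w nzG; apply: same_chi1.
  by apply: contraNneq nzG => s0; rewrite /G s0 !mul0r.
rewrite ifour_sum -[RHS](fourK (fun v => g v a b)); apply: eq_ifour => w; rewrite -/(h w a b).
have [s0 | nz_s] := eqVneq (same w a b) 0.
  by rewrite supph s0 mul0r big1 // => d _; rewrite /G s0 mulr0 !mul0r.
have eq_ab := same_neq0 nz_s.
under eq_bigr => d _ do rewrite /G (same1 eq_ab) mulr1 !mulrDr.
rewrite !big_split /=.
have -> : \sum_d same w d a / blk w a * h w d a = 0.
  under eq_bigr => d _ do rewrite mulrAC -supph.
  by rewrite -mulr_suml sumh mul0r.
have -> : \sum_d same w d a / blk w a * h w b d = 0.
  under eq_bigr => d _ do rewrite mulrAC alth mulrN {1}/same eq_ab -/(same w d b) -supph.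
  by rewrite -mulr_suml sumrN sumh oppr0 mul0r.
by rewrite addr0 add0r -mulr_suml -mulr_suml divff ?blk_neq0 // mul1r.
Qed.

End Fourier.

Section Vanishing.
Variables (k : fieldType) (char0 : [pchar k] =i pred0) (n : nat).
Notation V := 'rV['Z_2]_n.
Notation A := (option 'I_n).
Notation atup i := {ffun 'I_i.+1 -> A}.
Local Notation K := (rips n 2).
Local Notation bd := (boundary k _ _).

(** The two stars containing an edge see it with opposite orientations and, by invariance, with
    equal coefficients, so the contributions cancel. *)
Lemma starsum_edge0 (f : V -> 'rV[k]_#|{: atup 1}|) :
    (forall v, alt (f v)) ->
    (forall v a b, ev (f (v + e a + e b)) (T2 a b) = ev (f v) (T2 a b)) ->
  starsum f = 0.
Proof.
move=> altF invF; apply: ev_inj => y; rewrite ev0.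
have [inj_y | ninj_y] := boolP (injectiveb y); last first.
  by rewrite (altf_noninj char0 _ ninj_y) //; apply: alt_starsum.
apply/eqP/negPn/negP=> nz_y; have [v [t def_y]] := starsum_out nz_y.
have [a [b def_t]] := T2P t; move: inj_y nz_y; rewrite def_y (injective_tcomp (@phi_inj _ v)) def_t.
rewrite injective_T2 tcomp_T2 => nab; rewrite ev_starsum_edge //.
by rewrite (altf_T2 b a (altF _)) invF subrr eqxx.
Qed.

Lemma sum_alt2 (B : finType) (c : 'rV[k]_#|{: {ffun 'I_2 -> B}}|) :
  alt c -> \sum_a \sum_b ev c (T2 b a) = 0.
Proof.
move=> altc; apply: (eq_oppr0 char0); rewrite [LHS]exchange_big -sumrN; apply: eq_bigr => a _.
by rewrite -sumrN; apply: eq_bigr => b _; exact: altf_T2.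
Qed.

(** The cycle is shared between the stars, and [D v] is the boundary of the share of the star of
    [v]. Its two vanishing sums come from the augmentation and from the cycle condition. The family
    [f] of [fill_vertices] has the same boundaries and sums to zero, so subtracting it leaves cycles
    of the stars with the same total. *)
Lemma homology1 : (cycles k K 1 <= boundaries k K 1)%MS.
Proof.
apply/row_subP=> l; have /cyclesP[chain_c dc0] := row_sub l (cycles k K 1).
have [altc _] := (proj1 (chainsP char0 _ _) chain_c).
move: (row l _) chain_c dc0 altc => c chain_c dc0 altc {l}.
have nz2 : 2%:R != 0 :> k := char0_natf_neq0 char0 (isT : 0 < 2)%N.
(* Each edge lies in two stars, so half of it is assigned to each. *)
pose g v := 2%:R^-1 *: (c *m pull k (phi v) 1).
have altg v : alt (g v) by apply/altZ/alt_pull.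
have ev_g v a b : ev (g v) (T2 a b) = 2%:R^-1 * ev c (T2 (phi v a) (phi v b)).
  by rewrite evZ ev_pull tcomp_T2.
have def_c : c = starsum g.
  apply: ev_inj => y; have [inj_y | ninj_y] := boolP (injectiveb y); last first.
    by rewrite !(altf_noninj char0 _ ninj_y) //; apply: alt_starsum.
  have edge_y : y @: 'I_2 \in K -> ev c y = ev (starsum g) y.
    have [x0 [x1 def_y]] := T2P y; move/rips_tuple/(_ ord0 (lift ord0 ord0)).
    rewrite def_y tconsS !tcons0 => /hammingP[a [b def_x1]].
    have [v [def_x0 {}def_x1]] : exists v, x0 = phi v a /\ x1 = phi v b.
      by exists (x0 + e a); rewrite /phi addvK.
    move: inj_y; rewrite def_y def_x0 def_x1 injective_T2 (inj_eq (@phi_inj _ v)) => nab.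
    rewrite ev_starsum_edge // !ev_g.
    have -> : T2 (phi (v + e a + e b) b) (phi (v + e a + e b) a) = T2 (phi v a) (phi v b).
      by rewrite /phi; congr T2; z2ring.
    by rewrite -mulrDr -mulr2n -[ev c _ *+ 2]mulr_natl mulKf.
  have [c0 | /(chain_simplex char0 chain_c)[_ /edge_y //]] := eqVneq (ev c y) 0.
  rewrite c0; have [-> // | /starsum_out[v [t def_y]]] := eqVneq (ev (starsum g) y) 0.
  by rewrite -c0; apply: edge_y; rewrite def_y; apply: star_simplex.
pose D v a := ev (g v *m bd) (T1 a).
have D_E v a : D v a = \sum_b ev (g v) (T2 b a) by rewrite /D ev_boundary.
have sum1 v : \sum_a D v a = 0.
  by under eq_bigr => a _ do rewrite D_E; apply: sum_alt2.
have sum2 v : \sum_a D (v + e a) a = 0.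
  have := congr1 (fun u => ev u (T1 v)) dc0.
  by rewrite def_c starsum_boundary ev_starsum_vertex ev0.
have [f [altf invf df]] := fill_vertices char0 sum1 sum2.
pose h v : 'rV[k]_#|{: atup 1}| := fv (fun t : atup 1 => f v (t ord0) (t (lift ord0 ord0))).
have ev_h v a b : ev (h v) (T2 a b) = f v a b by rewrite ev_fv tconsS !tcons0.
have alth v : alt (h v) by apply: altf2 => a b; rewrite !ev_h altf.
have h0 : starsum h = 0 by apply: starsum_edge0 => // v a b; rewrite !ev_h invf.
have -> : c = starsum (fun v => g v - h v).
  rewrite def_c -[LHS]addr0 -[X in _ + X]oppr0 -h0 -sumrN -big_split.
  by apply: eq_bigr => v _; rewrite mulmxBl.
apply: star_fill => // v; first by apply: altD => //; rewrite -scaleN1r; apply: altZ.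
apply: ev_inj => t; rewrite ev0 [t]T1P mulmxBl evD evN -/(D v _) -df ev_boundary.
by apply/eqP; rewrite subr_eq0; apply/eqP/eq_bigr => b _; rewrite -ev_h.
Qed.

(** The restrictions [t v] sum to the cycle, and the cycle condition on an edge makes their
    boundaries [g] invariant. [fill_edges] gives 2-chains [h v] with these boundaries that satisfy
    the invariance of special chains; then the [t v - h v] are cycles of the stars, and the sum of
    the [h v] bounds special tetrahedra. *)
Lemma homology2 : (cycles k K 2 <= boundaries k K 2)%MS.
Proof.
apply/row_subP=> l; have /cyclesP[chain_c dc0] := row_sub l (cycles k K 2).
have [altc _] := (proj1 (chainsP char0 _ _) chain_c).
move: (row l _) chain_c dc0 altc => c chain_c dc0 altc {l}.
pose t v := c *m pull k (phi v) 2.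
have altt v : alt (t v) by apply: alt_pull.
have def_c : c = starsum t.
  apply: star_decomp => // x inj_x nz_x.
  exact: simplex3 (proj2 (chain_simplex char0 chain_c nz_x)).
pose g v a b := ev (t v *m bd) (T2 a b).
have altdt v : alt (t v *m bd) by apply: alt_boundary.
have altg v a b : g v a b = - g v b a by rewrite /g (altf_T2 a b (altdt v)).
have invg v a b : g (v + e a + e b) a b = g v a b.
  have [-> | nab] := eqVneq a b; first by rewrite addvK.
  have := congr1 (fun u => ev u (T2 (phi v a) (phi v b))) dc0.
  rewrite def_c starsum_boundary ev_starsum_edge // ev0 -/(g _ _ _) -/(g _ _ _).
  by rewrite [X in _ + X]altg => /eqP; rewrite subr_eq0 => /eqP.
have sumg v a : \sum_d g v d a = 0.
  have := congr1 (fun u => ev u (T1 a)) (boundary_boundary char0 (altt v)).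
  by rewrite ev0 ev_boundary.
have [f [altf0 altf1 invf df]] := fill_edges char0 altg invg sumg.
pose h v : 'rV[k]_#|{: atup 2}| :=
  fv (fun t : atup 2 => f v (t ord0) (t (lift ord0 ord0)) (t (lift ord0 (lift ord0 ord0)))).
have ev_h v a b d : ev (h v) (T3 a b d) = f v a b d by rewrite ev_fv !tconsS !tcons0.
have alth v : alt (h v).
  by apply: altf3 => a b d; rewrite !ev_h; [exact: altf0 | exact: altf1].
have invh v a b d : ev (h (v + e a + e b)) (T3 a b d) = ev (h v) (T3 a b d) by rewrite !ev_h.
have -> : c = starsum (fun v => t v - h v) - special_chain h *m bd.
  rewrite (special_chain_boundary char0 alth invh) opprK def_c -starsumD.
  by apply: eq_bigr => v _; rewrite subrK.
rewrite addmx_sub //.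
  apply: star_fill => // v; first by apply: altD => //; rewrite -scaleN1r; apply: altZ.
  apply: ev_inj => x; have [a [b ->]] := T2P x; rewrite ev0 mulmxBl evD evN -/(g v a b) -df.
  rewrite ev_boundary; apply/eqP; rewrite subr_eq0; apply/eqP/eq_bigr => d _.
  by rewrite -ev_h.
rewrite eqmx_opp; apply/boundariesP; exists (special_chain h) => //.
exact: special_chain_in.
Qed.

Lemma rdegree_homology0 i : (cycles k K i <= boundaries k K i)%MS ->
  rdegree (rips_homology k n 2 i) = 0%N.
Proof.
move=> sZB; rewrite /rips_homology /homology_repr /=.
by apply/eqP; rewrite mxrank_eq0 -submx0 genmxE submx0 in_factmod_eq0.
Qed.

End Vanishing.

Lemma sum_option (R : nmodType) (I : finType) (F : option I -> R) :
  \sum_a F a = F None + \sum_i F (Some i).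
Proof.
rewrite (bigD1 None) //=; congr (_ + _).
rewrite (eq_bigl [in Some @: [set: I]]) => [|[i|]]; last 2 first.
- by rewrite imset_f.
- by apply/esym/imsetP=> -[].
rewrite big_imset => [|i j _ _ [] //].
by apply: eq_bigl => i; rewrite inE.
Qed.

(** * Homology in degree 3 *)

Section CubeModule.
Variables (n : nat).
Notation V := 'rV['Z_2]_n.

Lemma perm_coord_e s (a : option 'I_n) : perm_coord s (e a) = e (omap s a).
Proof.
apply/rowP=> i; rewrite mxE !eE; case: a => [j|] //=.
by rewrite !(inj_eq (@Some_inj _)) -{2}[i](permKV s) (inj_eq perm_inj).
Qed.

Lemma vertex_act_e v (a : option 'I_n) g :
  vertex_act (v + e a) g = vertex_act v g + e (omap (hperm g) a).
Proof. by rewrite /vertex_act perm_coordD perm_coord_e addrA. Qed.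

Definition cube_idx := (V * {ffun 'I_3 -> 'I_n})%type.

Definition cube_act (p : cube_idx) (g : hyperoct n) : cube_idx :=
  (vertex_act p.1 g, tcomp (hperm g) p.2).

Lemma cube_act1 : cube_act^~ 1%g =1 id.
Proof.
move=> [v t]; rewrite /cube_act vertex_act1; congr (_, _).
by apply/ffunP=> j; rewrite ffunE perm1.
Qed.

Lemma cube_actM p : act_morph cube_act p.
Proof.
move=> g h; rewrite /cube_act vertex_actM; congr (_, _).
by apply/ffunP=> j; rewrite !ffunE hpermM permM.
Qed.

Definition cube_action := TotalAction cube_act1 cube_actM.

End CubeModule.

Section H3.
Variables (k : fieldType) (char0 : [pchar k] =i pred0) (n : nat).
Notation V := 'rV['Z_2]_n.
Notation A := (option 'I_n).
Notation atup i := {ffun 'I_i.+1 -> A}.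
Notation vtup i := {ffun 'I_i.+1 -> V}.
Local Notation K := (rips n 2).
Local Notation bd := (boundary k _ _).
Local Notation E i := (e (Some i)).

Definition cube_module := permutation_repr k (cube_action n).

Implicit Types f : 'rV[k]_#|{: cube_idx n}|.

Definition cube_alt f := forall v, altf (fun t => ev f (v, t)).
Definition dcube f v a b : k := \sum_c ev f (v, T3 a b c).

(** The third condition is the second one with the index [None] in place of one direction: on a
    cycle, [dcube] is up to sign the value at (a, b, [None]), and e [None] is zero. *)
Definition cube_image f :=
  [/\ cube_alt f,
      forall v a b c, ev f (v + E a + E b, T3 a b c) = ev f (v, T3 a b c)
    & forall v a b, dcube f (v + E a) a b = dcube f v a b].

Definition cube_map : 'M[k]_(#|{: vtup 3}|, #|{: cube_idx n}|) :=
  pullmx k (fun p : cube_idx n => spec p.1 (tcomp Some p.2)).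

Lemma ev_cube_map c v t :
  ev (c *m cube_map) (v, t) = ev (cube_fun c v) (tcomp Some t).
Proof. by rewrite !ev_pull. Qed.

Lemma ev_cube_map3 c v i j l :
  ev (c *m cube_map) (v, T3 i j l) = ev (cube_fun c v) (T3 (Some i) (Some j) (Some l)).
Proof. by rewrite ev_cube_map tcomp_T3. Qed.

Lemma tuple_act_spec v t (g : hyperoct n) :
  tuple_act (vertex_action n) (spec v (tcomp Some t)) g
    = spec (vertex_act v g) (tcomp Some (tcomp (hperm g) t)).
Proof.
have [a [b [c ->]]] := T3P t; rewrite !tcomp_T3 !spec_T3 /special.
have -> (x : vtup 3) : tuple_act (vertex_action n) x g = tcomp (@vertex_act n ^~ g) x.
  by apply/ffunP=> j; rewrite !ffunE.
by rewrite tcomp_T4 /phi !vertex_act_e.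
Qed.

Lemma cube_map_hom g :
  tuple_repr k (vertex_action n) 3 g *m cube_map = cube_map *m cube_module g.
Proof.
apply: matrix_pt_eq => x; rewrite !mulmxA; apply: ev_inj => -[v t].
by rewrite ev_pull !ev_permutation ev_pull /= tuple_act_spec.
Qed.

Lemma altf_tcomp (B B' : finType) (phi : B -> B') i (F : {ffun 'I_i -> B'} -> k) :
  altf F -> altf (fun t => F (tcomp phi t)).
Proof. by move=> aF t s; rewrite -aF; congr F; apply/ffunP=> j; rewrite !ffunE. Qed.

Lemma cube_map_alt c : alt c -> cube_alt (c *m cube_map).
Proof.
move=> altc v t s; rewrite !ev_cube_map.
exact: (altf_tcomp Some (alt_cube_fun altc v) t s).
Qed.

Lemma cube_map_star (s : V -> 'rV[k]_#|{: atup 3}|) :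
  (forall v, alt (s v)) -> starsum s *m cube_map = 0.
Proof.
move=> alts; have altss : alt (starsum s) by apply: alt_starsum.
apply: ev_inj => -[v t]; rewrite ev0.
have [inj_t | ninj_t] := boolP (injectiveb t); last first.
  exact: (altf_noninj char0 (cube_map_alt altss v) ninj_t).
have [a [b [c def_t]]] := T3P t; move: inj_t; rewrite def_t injective_T3 => /and3P[nab nac nbc].
rewrite ev_cube_map3 ev_cube_fun; apply/eqP/negPn/negP=> /starsum_out[u [t' def_x]].
have neqS i j : i != j -> Some i != Some j :> A by rewrite (inj_eq (@Some_inj _)).
apply: (@special_not_star _ v u _ _ _ (neqS _ _ nab) (neqS _ _ nac) (neqS _ _ nbc)).
have [a' [b' [c' [d' def_t']]]] := T4P t'.
by exists a', b', c', d'; move: def_x; rewrite def_t' tcomp_T4 => /T4_inj[].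
Qed.

(** The function [cube_fun c v] is a boundary in the full simplex on the star, hence a cycle. Its
    coefficient at an edge expresses the value at [None] through the values at the coordinates. *)
Lemma dcube_cycle (c : 'rV[k]_#|{: vtup 3}|) v i j : (c <= cycles k K 3)%MS -> alt c ->
  dcube (c *m cube_map) v i j = - ev (cube_fun c v) (T3 (Some i) (Some j) None).
Proof.
move=> cyc_c altc; have alt_v := alt_cube_fun altc v.
have := congr1 (fun u => ev u (T2 (Some i) (Some j)))
  (boundary_boundary char0 (alt_pull (phi v) altc)).
rewrite -(cube_fun_boundary char0 altc cyc_c) ev0 ev_boundary sum_option => /eqP.
have rot a : ev (cube_fun c v) (tcons a (T2 (Some i) (Some j)))
    = ev (cube_fun c v) (T3 (Some i) (Some j) a).
  by rewrite -/(T3 _ _ _) (altf_T3l _ _ _ alt_v) (altf_T3r _ _ _ alt_v) opprK.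
rewrite rot addrC addr_eq0 => /eqP <-; apply: eq_bigr => l _.
by rewrite ev_cube_map3 rot.
Qed.

(** A 4-chain is carried by the stars, so its boundary vanishes on special tetrahedra. Conversely,
    if the values at triples of coordinates vanish, those involving [None] vanish by [dcube_cycle];
    then the cycle is carried by the stars and bounds. *)
Lemma cube_map_kernel (c : 'rV[k]_#|{: vtup 3}|) : (c <= cycles k K 3)%MS ->
  c *m cube_map = 0 <-> (c <= boundaries k K 3)%MS.
Proof.
move=> cyc_c; have [chain_c dc0] := proj1 (cyclesP _) cyc_c.
have [altc _] := (proj1 (chainsP char0 _ _) chain_c).
split=> [c0 | /boundariesP[b chain_b ->]]; last first.
  have [altb _] := (proj1 (chainsP char0 _ _) chain_b).
  have -> := star_decomp char0 altb (fun x inj_x nz_x => simplex5 (isT : 4 <= 4)%N inj_x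
    (proj2 (chain_simplex char0 chain_b nz_x))).
  rewrite starsum_boundary; apply: cube_map_star => v.
  by apply/alt_boundary/alt_pull.
apply: star_cycle_boundary => // x inj_x nz_x.
have [//| [v [a [b [d def_x]]]]] := simplex4 inj_x (proj2 (chain_simplex char0 chain_c nz_x)).
case/eqP: nz_x; rewrite def_x -ev_cube_fun.
have alt_v := alt_cube_fun altc v.
have cSSS i j l : ev (cube_fun c v) (T3 (Some i) (Some j) (Some l)) = 0.
  by rewrite -ev_cube_map3 c0 ev0.
have cSSN i j : ev (cube_fun c v) (T3 (Some i) (Some j) None) = 0.
  apply/eqP; rewrite -oppr_eq0 -(dcube_cycle _ _ _ cyc_c altc) /dcube big1 // => l _.
  by rewrite c0 ev0.
have cSN i y : ev (cube_fun c v) (T3 (Some i) y None) = 0.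
  case: y => [j|]; first exact: cSSN.
  by rewrite (altf_noninj char0 alt_v) // injective_T3 eqxx !andbF.
have cN i j : ev (cube_fun c v) (T3 None i j) = 0.
  rewrite (altf_T3l _ _ _ alt_v) (altf_T3r _ _ _ alt_v) opprK.
  case: i => [i|]; first by rewrite cSN.
  by rewrite (altf_noninj char0 alt_v) // injective_T3 eqxx !andbF.
case: a {def_x} => [i|]; last exact: cN.
case: b => [j|]; last by rewrite (altf_T3l _ _ _ alt_v) cN oppr0.
by case: d => [l|].
Qed.

Lemma cube_map_image (c : 'rV[k]_#|{: vtup 3}|) : (c <= cycles k K 3)%MS -> cube_image (c *m cube_map).
Proof.
move=> cyc_c; have [chain_c dc0] := proj1 (cyclesP _) cyc_c.
have [altc _] := (proj1 (chainsP char0 _ _) chain_c).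
split=> [|v a b d|v a b]; first exact: cube_map_alt.
  by rewrite !ev_cube_map3 cube_fun_inv.
rewrite !dcube_cycle //; congr (- _).
rewrite [LHS](altf_T3r _ _ _ (alt_cube_fun altc _)).
rewrite [RHS](altf_T3r _ _ _ (alt_cube_fun altc _)).
by rewrite -(cube_fun_inv altc v) e0 addr0.
Qed.

(** The function is extended to the index [None] so that each [h v] becomes a cycle. The chain
    [special_chain h] has boundary minus the sum of the [h v]; fillings [s v] of the [h v] inside
    the stars complete it to a cycle without changing its values on special tetrahedra. *)
Lemma cube_map_onto f : cube_image f ->
  exists2 c : 'rV[k]_#|{: vtup 3}|, (c <= cycles k K 3)%MS & f = c *m cube_map.
Proof.
case=> altF invF dF.
have altd v i j : dcube f v i j = - dcube f v j i.
  by rewrite -sumrN; apply: eq_bigr => l _; apply: (altf_T3l _ _ _ (altF v)).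
(* The values with one [None] are forced by [dcube_cycle] and alternation; those with two or more
   are 0. *)
pose F v (a b c : A) : k := match a, b, c with
  | Some i, Some j, Some l => ev f (v, T3 i j l)
  | None, Some i, Some j => - dcube f v i j
  | Some i, None, Some j => dcube f v i j
  | Some i, Some j, None => - dcube f v i j
  | _, _, _ => 0
  end.
pose h v : 'rV[k]_#|{: atup 2}| :=
  fv (fun t : atup 2 => F v (t ord0) (t (lift ord0 ord0)) (t (lift ord0 (lift ord0 ord0)))).
have ev_h v a b c : ev (h v) (T3 a b c) = F v a b c by rewrite ev_fv !tconsS !tcons0.
have alth v : alt (h v).
  apply: altf3 => -[i|] [j|] [l|]; rewrite !ev_h /= ?oppr0 ?opprK //.
    exact: (altf_T3l _ _ _ (altF v)).
  exact: (altf_T3r _ _ _ (altF v)).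
have dF2 v i j : dcube f (v + E j) i j = dcube f v i j by rewrite altd dF -altd.
have invh v a b c : ev (h (v + e a + e b)) (T3 a b c) = ev (h v) (T3 a b c).
  by rewrite !ev_h; case: a b c => [i|] [j|] [l|] //=; rewrite ?e0 ?addr0 ?dF2 ?dF.
have sumd v i : \sum_d dcube f v d i = 0.
  apply: (eq_oppr0 char0); rewrite [LHS]exchange_big -sumrN; apply: eq_bigr => d _.
  rewrite -sumrN; apply: eq_bigr => l _.
  rewrite (altf_T3l l i d (altF v)) (altf_T3r i l d (altF v)) opprK.
  exact: (altf_T3l i d l (altF v)).
have dh v : h v *m bd = 0.
  apply: ev_inj => t; have [a [b ->]] := T2P t; rewrite ev0 ev_boundary sum_option.
  under eq_bigr => i _ do rewrite -/(T3 _ _ _) ev_h.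
  rewrite -/(T3 _ _ _) ev_h; case: a b => [i|] [j|] /=.
  - apply/eqP; rewrite addrC subr_eq0; apply/eqP; apply: eq_bigr => l _.
    by rewrite (altf_T3l l i j (altF v)) (altf_T3r i l j (altF v)) opprK.
  - by rewrite add0r sumrN sumd oppr0.
  - by rewrite add0r sumd.
  by rewrite big1 ?addr0.
have /fin_all_exists2[s alts ds] v := full_exact char0 None (alth v) (dh v).
exists (special_chain h + starsum s).
  apply/cyclesP; split.
    rewrite addmx_sub ?starsum_chain //; exact: special_chain_in.
  rewrite mulmxDl (special_chain_boundary char0 alth invh) starsum_boundary addrC.
  by apply/eqP; rewrite subr_eq0; apply/eqP/eq_bigr => v _; rewrite ds.
rewrite mulmxDl cube_map_star // addr0; apply: ev_inj => -[v t].
have [inj_t | ninj_t] := boolP (injectiveb t); last first.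
  rewrite (altf_noninj char0 (altF v) ninj_t).
  by rewrite (altf_noninj char0 (cube_map_alt (alt_special_chain alth invh) v) ninj_t).
have [a [b [c def_t]]] := T3P t; move: inj_t; rewrite def_t injective_T3 => dabc.
by rewrite ev_cube_map3 ev_cube_fun ev_fv special_funE ?ev_h.
Qed.

Lemma embeds_homology3 : embeds (rips_homology k n 2 3) cube_module cube_image.
Proof.
have sBZ : (boundaries k K 3 <= cycles k K 3)%MS.
  by apply: boundaries_sub_cycles => B C; apply: rips_down.
apply: embeds_ext (embeds_section (sigma' := cube_module) _ _ sBZ
  (fun g _ => cube_map_hom g) cube_map_kernel) => f.
by split=> [[c cyc_c ->] | /cube_map_onto //]; apply: cube_map_image.
Qed.

End H3.

(** * Isotypic components and induced representations *)

Section Isotypic.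
Variables (k : fieldType) (char0 : [pchar k] =i pred0) (n : nat).
Notation V := 'rV['Z_2]_n.
Notation tri := {ffun 'I_3 -> 'I_n}.
Local Notation E i := (e (Some i)).
Local Notation chi := (chi k).
Local Notation M := 'rV[k]_#|{: cube_idx n}|.
Implicit Types (f : M) (w : {set 'I_n}).

Definition slice f v : 'rV[k]_#|{: tri}| := f *m pullmx k (fun t : tri => (v, t) : cube_idx n).

Lemma ev_slice f v t : ev (slice f v) t = ev f (v, t).
Proof. exact: ev_pull. Qed.

Lemma slice_inj f f' : (forall v, slice f v = slice f' v) -> f = f'.
Proof. by move=> eq_f; apply: ev_inj => -[v t]; rewrite -!ev_slice eq_f. Qed.

Lemma sliceD f f' v : slice (f + f') v = slice f v + slice f' v.
Proof. exact: mulmxDl. Qed.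

Lemma slice_sum (I : finType) (P : pred I) (F : I -> M) v :
  slice (\sum_(i | P i) F i) v = \sum_(i | P i) slice (F i) v.
Proof. exact: mulmx_suml. Qed.

Definition unslice (zs : V -> 'rV[k]_#|{: tri}|) : M := fv (fun p => ev (zs p.1) p.2).

Lemma slice_unslice zs v : slice (unslice zs) v = zs v.
Proof. by apply: ev_inj => t; rewrite ev_slice ev_fv. Qed.

Definition iso w f := forall v, slice f v = chi w v *: slice f 0.

Lemma iso_inj w f f' : iso w f -> iso w f' -> slice f 0 = slice f' 0 -> f = f'.
Proof.
by move=> isof isof' eq0; apply: slice_inj => v; rewrite isof isof' eq0.
Qed.

Definition isocomp w f : M :=
  unslice (fun v => chi w v *: ((2%:R ^+ n)^-1 *: \sum_u chi w u *: slice f u)).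

Lemma comp_iso w f : iso w (isocomp w f).
Proof. by move=> v; rewrite !slice_unslice chi0 scale1r. Qed.

Lemma sum_comp f : \sum_w isocomp w f = f.
Proof.
apply: slice_inj => v; apply: ev_inj => t; rewrite slice_sum ev_sum ev_slice.
rewrite -[RHS](fourK char0 (fun v => ev f (v, t)) v) /ifour mulr_sumr.
apply: eq_bigr => w _; rewrite slice_unslice !evZ ev_sum mulrCA; congr (_ * (_ * _)).
by apply: eq_bigr => u _; rewrite evZ ev_slice.
Qed.

Lemma sum_chi_chi w w' : \sum_v chi w v * chi w' v = if w == w' then 2%:R ^+ n else 0.
Proof.
have [-> | neq_w] := eqVneq w w'.
  rewrite (eq_bigr (fun=> 1)) => [|v _]; last exact: chi_sqr.
  rewrite (eq_bigl [in [set: V]]) => [|v]; last by rewrite inE.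
  by rewrite sumr_const cardsT card_mx card_ord mul1n -natrX.
have [i neq_i] : exists i, (i \in w) != (i \in w').
  apply/existsP; rewrite -negb_forall; apply: contra neq_w => /forallP eq_w.
  by apply/eqP/setP=> i; apply/eqP.
apply: (eq_oppr0 char0); rewrite -sumrN (reindex_inj (@addIr _ (E i))) /=.
apply: eq_bigr => v _; rewrite !chiD !chi_eS.
case: (i \in w) neq_i; case: (i \in w') => //= _; rewrite ?expr0 ?expr1 !(mulr1, mulrN1);
  by rewrite ?mulNr ?mulrN.
Qed.

Definition iso_proj w : 'M[k]_(#|{: cube_idx n}|) :=
  lmx (fun p q => (2%:R ^+ n)^-1 * chi w p.1 * chi w q.1 * (p.2 == q.2)%:R).

Lemma iso_projP w w' f : iso w f -> f *m iso_proj w' = if w == w' then f else 0.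
Proof.
move=> isof; apply: ev_inj => -[v t]; rewrite ev_lmx.
transitivity (\sum_u \sum_t' ev f (u, t') *
    ((2%:R ^+ n)^-1 * chi w' u * chi w' v * (t' == t)%:R)).
  by rewrite pair_big; apply: eq_bigr => -[u t'].
transitivity (\sum_u (2%:R ^+ n)^-1 * chi w' v * ev f (0, t) * (chi w u * chi w' u)).
  apply: eq_bigr => u _; rewrite (bigD1 t) //= eqxx mulr1.
  rewrite big1 ?addr0 => [|t' /negPf->]; last by rewrite !mulr0.
  by rewrite -ev_slice isof evZ ev_slice; move: (_^-1) => q; ring.
rewrite -mulr_sumr sum_chi_chi; case: eqP => [<- | _]; last by rewrite mulr0 ev0.
have nz2 : 2%:R ^+ n != 0 :> k by apply: expf_neq0; exact: (char0_natf_neq0 char0 (isT : 0 < 2)%N).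
by rewrite mulrC !mulrA mulfV // mul1r -[RHS]ev_slice isof evZ ev_slice.
Qed.

End Isotypic.

Lemma set_transitive (T : finType) (A B : {set T}) :
  #|A| = #|B| -> exists s : {perm T}, s @: A = B.
Proof.
move=> eq_card; have [|s def_s] := @perm_extend _ (enum A) (enum B) (enum_uniq _) (enum_uniq _).
  by rewrite -!cardE.
exists s; apply/setP=> x; rewrite -(mem_enum B) -def_s.
by apply/imsetP/mapP => -[y]; rewrite ?mem_enum => Ay ->; exists y; rewrite ?mem_enum.
Qed.

Lemma widen_ord_injective m n (le_mn : (m <= n)%N) : injective (widen_ord le_mn).
Proof. by move=> i j [] /val_inj. Qed.

Lemma imset_permC (T : finType) (s : {perm T}) (A : {set T}) : s @: (~: A) = ~: (s @: A).
Proof.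
apply/setP=> x; rewrite -[x](permKV s) inE !mem_imset ?inE //; exact: perm_inj.
Qed.

Lemma mem_imset_perm (T : finType) (s : {perm T}) (A : {set T}) x :
  (x \in s @: A) = ((s^-1)%g x \in A).
Proof. by rewrite -{1}[x](permKV s) mem_imset //; apply: perm_inj. Qed.

Lemma imset_permM (T : finType) (s t : {perm T}) (A : {set T}) :
  (s * t)%g @: A = t @: (s @: A).
Proof. by rewrite -imset_comp; apply: eq_imset => x; rewrite /= permM. Qed.

Lemma imset_perm1 (T : finType) (A : {set T}) : (1%g : {perm T}) @: A = A.
Proof. by rewrite -[RHS]imset_id; apply: eq_imset => x; rewrite perm1. Qed.

Section PushAction.
Variables (k : fieldType) (m n i : nat) (iota : 'I_m -> 'I_n).

Lemma pt_push (a : {ffun 'I_i.+1 -> 'I_m}) : pt k a *m push k iota i = pt k (tcomp iota a).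
Proof.
apply: ev_inj => y; rewrite ev_lmx (bigD1 a) //= !ev_pt eqxx mul1r big1 ?addr0 // => b.
by rewrite ev_pt eq_sym => /negPf->; rewrite mul0r.
Qed.

Lemma push_act (s : 'S_m) (t : 'S_n) (z : 'rV_#|{: {ffun 'I_i.+1 -> 'I_m}}|) :
    (forall j, t (iota j) = iota (s j)) ->
  z *m tuple_repr k (perm_action 'I_m) i s *m push k iota i
    = z *m push k iota i *m tuple_repr k (perm_action 'I_n) i t.
Proof.
move=> ts; rewrite -!mulmxA; congr (_ *m _); apply: matrix_pt_eq => a.
rewrite !mulmxA pt_push !pt_act pt_push; congr (pt k _).
by apply/ffunP=> j; rewrite !ffunE /= /aperm ts.
Qed.

End PushAction.

Section Family.
Variables (k : fieldType) (char0 : [pchar k] =i pred0) (n : nat).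
Notation tri := {ffun 'I_3 -> 'I_n}.
Local Notation chi := (chi k).
Local Notation M := 'rV[k]_#|{: cube_idx n}|.
Local Notation sigma := (cube_module k n).
Local Notation taun := (tuple_repr k (perm_action 'I_n) 2).
Implicit Types (f : M) (T w : {set 'I_n}) (z : 'rV[k]_#|{: tri}|).

Lemma slice_act f g v :
  slice (f *m sigma g) v = slice f (vertex_act v g^-1%g) *m taun (hperm g).
Proof. by apply: ev_inj => t; rewrite ev_slice !ev_permutation ev_slice. Qed.

Lemma chi_act w v g :
  chi (hperm g @: w) (vertex_act v g) = chi (hperm g @: w) (hshift g) * chi w v.
Proof.
rewrite chiD; congr (_ * _); rewrite /chi big_imset => [|i j _ _ /perm_inj //].
by apply: eq_bigr => i _; rewrite mxE permK.
Qed.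

Lemma chi_actV w v g :
  chi w (vertex_act v g^-1%g) = chi (hperm g @: w) (hshift g) * chi (hperm g @: w) v.
Proof.
have := chi_act w (vertex_act v g^-1%g) g; rewrite -vertex_actM mulVg vertex_act1 => ->.
by rewrite mulrA chi_sqr mul1r.
Qed.

Lemma slice0_act w f g : iso w f -> slice (f *m sigma g) 0
  = chi (hperm g @: w) (hshift g) *: (slice f 0 *m taun (hperm g)).
Proof.
by move=> isof; rewrite slice_act isof chi_actV chi0 mulr1 scalemxAl.
Qed.

Lemma iso_act w f g : iso w f -> iso (hperm g @: w) (f *m sigma g).
Proof.
move=> isof v; rewrite (slice0_act g isof) slice_act isof chi_actV.
by rewrite -scalemxAl scalerA mulrC.
Qed.

Variable R : {set 'I_n} -> 'rV[k]_#|{: tri}| -> Prop.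
Hypothesis RZ : forall T z a, R T z -> R T (a *: z).
Hypothesis R_act : forall T z (s : 'S_n), R T z -> R (s @: T) (z *m taun s).

(** A function of character [w] is determined by its slice at the origin, and [R] constrains that
    slice. *)
Definition isofam w f := iso w f /\ R w (slice f 0).

Lemma isofam_act w f g : isofam w f -> isofam (hperm g @: w) (f *m sigma g).
Proof.
by case=> isof Rf; split; [exact: iso_act | rewrite (slice0_act g isof); apply/RZ/R_act].
Qed.

Definition isofam_sum p f :=
  exists2 F : {set 'I_n} -> M, forall w, #|w| == p -> isofam w (F w)
    & f = \sum_(w : {set 'I_n} | #|w| == p) F w.

Variable p : nat.
Hypothesis le_pn : (p <= n)%N.

Lemma card_last_coords : #|~: first_coords n p| = p.
Proof.
have eq_card : #|first_coords n p| = (n - p)%N.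
  rewrite -[RHS]card_ord -(card_imset _ (@widen_ord_injective _ _ (leq_subr p n))).
  congr #|pred_of_set _|; apply/setP=> i; rewrite inE; apply/idP/imsetP => [lt_i | [j _ ->] /=].
    by exists (Ordinal lt_i) => //; apply: val_inj.
  exact: ltn_ord.
by rewrite cardsCs setCK eq_card card_ord subKn.
Qed.

(** The group permutes the characters of Z_2^n as subsets of the coordinates, transitively on those
    of size p, and the stabilizer of the last p coordinates is the Young subgroup. So inducing
    spreads the component at one character over all characters of that size. *)
Lemma embeds_young d (rho : mx_representation k (young_group n p) d) :
    embeds rho (subg_repr sigma (subsetT _)) (isofam (~: first_coords n p)) ->
  embeds (induced_repr rho) sigma (isofam_sum p).
Proof.
set w0 := ~: first_coords n p => emb.
apply: (embeds_induced (kappa := fun g => hperm g @: w0) (O := fun w => #|w| == p)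
  (Q := isofam) (pi := @iso_proj k n) _ _ _ _ emb) => [g h|w|g u|w w' u _ [isou _]].
- rewrite !imset_permC (inj_eq (can_inj (@setCK _))) [RHS]inE hpermM imset_permM.
  rewrite -[LHS](inj_eq (imset_inj (@perm_inj _ (hperm h)^-1%g))) -!imset_permM mulgV.
  by rewrite imset_perm1.
- apply: (iffP eqP) => [card_w | [g <-]]; last first.
    by rewrite card_imset ?card_last_coords //; apply: perm_inj.
  have [s def_s] := set_transitive (etrans card_last_coords (esym card_w)).
  by exists (Hyperoct 0 s).
- split=> [|Qu]; first exact: isofam_act.
  have := isofam_act g^-1%g Qu; rewrite -imset_permM mulgV imset_perm1.
  by rewrite -mulmxA -repr_mxM ?inE // mulgV repr_mx1 mulmx1.
exact: iso_projP.
Qed.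

End Family.

Section Block.
Variables (k : fieldType) (char0 : [pchar k] =i pred0) (n m : nat).
Notation V := 'rV['Z_2]_n.
Local Notation chi := (chi k).
Local Notation sigma := (cube_module k n).
Variables (iota : 'I_m -> 'I_n) (inj_iota : injective iota).
Local Notation taum := (tuple_repr k (perm_action 'I_m) 2).
Implicit Type z : 'rV[k]_#|{: {ffun 'I_3 -> 'I_m}}|.

(** Extends a function of triples of one block of coordinates by a function [phi] of the vertex. It
    is used with a character for bipartition modules and with the indicator of a face for
    [cube0]. *)
Definition blockmx (phi : V -> k) : 'M[k]_(#|{: {ffun 'I_3 -> 'I_m}}|, #|{: cube_idx n}|) :=
  lmx (fun t' p => phi p.1 * (tcomp iota t' == p.2)%:R).

Lemma slice_block phi z v : slice (z *m blockmx phi) v = phi v *: (z *m push k iota 2).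
Proof.
apply: ev_inj => t; rewrite ev_slice evZ !ev_lmx mulr_sumr.
by apply: eq_bigr => t' _; rewrite mulrCA.
Qed.

Lemma block_hom (phi : V -> k) (g : hyperoct n) (s : 'S_m) c z :
    (forall j, hperm g (iota j) = iota (s j)) ->
    (forall v, phi (vertex_act v g) = c * phi v) -> c * c = 1 ->
  c *: (z *m taum s *m blockmx phi) = z *m blockmx phi *m sigma g.
Proof.
move=> block_g phi_g c2; apply: slice_inj => v.
rewrite slice_act slice_block -scalemxAl -(push_act _ block_g).
have -> : slice (c *: (z *m taum s *m blockmx phi)) v
    = c *: slice (z *m taum s *m blockmx phi) v by rewrite /slice -scalemxAl.
rewrite slice_block scalerA; congr (_ *: _).
have := phi_g (vertex_act v g^-1%g); rewrite -vertex_actM mulVg vertex_act1 => ->.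
by rewrite mulrA c2 mul1r.
Qed.

Lemma block_inj (phi : V -> k) z : phi 0 != 0 -> z *m blockmx phi = 0 -> z = 0.
Proof.
move=> nz_phi zB0; apply: (@push_inj k _ _ iota inj_iota); rewrite mul0mx; apply/eqP.
have /eqP : slice (z *m blockmx phi) 0 = 0 by rewrite zB0 /slice mul0mx.
by rewrite slice_block scaler_eq0 (negPf nz_phi).
Qed.

Lemma block_iso w z : iso w (z *m blockmx (chi w)).
Proof. by move=> v; rewrite !slice_block chi0 scale1r. Qed.

Lemma block_image w (P R : _ -> Prop) f :
    (forall u, R u <-> exists2 z, P z & u = z *m push k iota 2) ->
  (exists2 z, P z & f = z *m blockmx (chi w)) <-> iso w f /\ R (slice f 0).
Proof.
move=> RP; split=> [[z Pz ->] | [isof /RP[z Pz slice_f]]].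
  split; first exact: block_iso.
  by apply/RP; exists z; rewrite ?slice_block ?chi0 ?scale1r.
exists z => //; apply: (iso_inj isof (block_iso w z)).
by rewrite slice_f slice_block chi0 scale1r.
Qed.

End Block.

Lemma is_linear_pullback (k : fieldType) (aT rT : finGroupType) (D : {group aT})
    (h : {morphism D >-> rT}) d (rG : mx_representation k [set: rT] d) chi :
  is_linear rG chi -> is_linear (pullback_repr h rG) (fun g => chi (h g)).
Proof. by case=> d1 lin; split=> // g Dg; apply: lin; rewrite inE. Qed.

Lemma embeds_pullback (k : fieldType) (aT rT : finGroupType) (D : {group aT})
    (h : {morphism D >-> rT}) d N (rho : mx_representation k [set: rT] d)
    (sigma : mx_representation k [set: rT] N) P :
  embeds rho sigma P -> embeds (pullback_repr h rho) (pullback_repr h sigma) P.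
Proof.
by case=> B [freeB homB imB]; exists B; split=> // g Dg; apply: homB; rewrite inE.
Qed.

Section Bipartition.
Variables (k : fieldType) (char0 : [pchar k] =i pred0) (n : nat) (lam mu : seq nat).
Local Notation p := (sumn mu).
Hypothesis le_pn : (p <= n)%N.
Local Notation chi := (chi k).
Local Notation sigma := (cube_module k n).
Local Notation w0 := (~: first_coords n p).

Lemma last_lt (j : 'I_p) : (n - p + j < n)%N.
Proof. by rewrite -[X in (_ < X)%N](subnK le_pn) ltn_add2l. Qed.
Definition last_inj j : 'I_n := Ordinal (last_lt j).
Definition first_inj : 'I_(n - p) -> 'I_n := widen_ord (leq_subr p n).

Lemma last_inj_inj : injective last_inj.
Proof. by move=> i j [] /addnI/val_inj. Qed.

Lemma first_inj_inj : injective first_inj. Proof. exact: widen_ord_injective. Qed.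

Lemma imset_last_inj : last_inj @: setT = w0.
Proof.
apply/setP=> i; rewrite !inE -leqNgt; apply/imsetP/idP => [[j _ ->] | le_i].
  exact: leq_addr.
have lt_j : (i - (n - p) < p)%N by rewrite ltn_subLR // subnK.
by exists (Ordinal lt_j) => //; apply: val_inj; rewrite /= subnKC.
Qed.

Lemma imset_first_inj : first_inj @: setT = ~: w0.
Proof.
apply/setP=> i; rewrite !inE negbK; apply/imsetP/idP => [[j _ ->] | lt_i].
  exact: (ltn_ord j).
by exists (Ordinal lt_i) => //; apply: val_inj.
Qed.

Lemma hperm_last g j : g \in young_group n p ->
  hperm g (last_inj j) = last_inj (last_block_perm p g j).
Proof.
move=> Yg; apply: val_inj => /=.
exact: (block_permE (block_fix_last Yg) (erefl : last_inj j = (n - p + j)%N :> nat)).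
Qed.

Lemma hperm_first g j : g \in young_group n p ->
  hperm g (first_inj j) = first_inj (first_block p g j).
Proof.
move=> Yg; apply: val_inj => /=.
exact: (block_permE (block_fix_first Yg) (erefl : first_inj j = (0 + j)%N :> nat)).
Qed.

Lemma young_w0 g : g \in young_group n p -> hperm g @: w0 = w0.
Proof. by rewrite inE imset_permC => /eqP->. Qed.

Lemma chi_young g v : g \in young_group n p ->
  chi w0 (vertex_act v g) = chi w0 (hshift g) * chi w0 v.
Proof. by move=> Yg; have := chi_act k w0 v g; rewrite young_w0. Qed.

Lemma is_linear_sign : is_linear (sign_repr k n p) (fun g => chi w0 (hshift g)).
Proof.
split=> // g _; congr (_%:M); apply: eq_bigl => i.
by rewrite !inE -leqNgt.
Qed.

Variables (P : 'rV[k]_#|{: {ffun 'I_3 -> 'I_p}}| -> Prop).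
Variables (P' : 'rV[k]_#|{: {ffun 'I_3 -> 'I_(n - p)}}| -> Prop).
Variable R : {set 'I_n} -> 'rV[k]_#|{: {ffun 'I_3 -> 'I_n}}| -> Prop.
Hypothesis RZ : forall T z a, R T z -> R T (a *: z).
Hypothesis R_act : forall T z (s : 'S_n), R T z ->
  R (s @: T) (z *m tuple_repr k (perm_action 'I_n) 2 s).

(** The character acts on the last block, which is [w0], and the module of [mu] is realized on
    triples inside it; the first block acts trivially. *)
Lemma embeds_last :
    lam = int_part (n - p) ->
    embeds (specht_repr k p mu) (tuple_repr k (perm_action 'I_p) 2) P ->
    (forall u, R w0 u <-> exists2 z, P z & u = z *m push k last_inj 2) ->
  embeds (bipartition_repr k n lam mu) sigma (isofam_sum R p).
Proof.
move=> lam_triv emb_mu RP; apply: (embeds_young char0 RZ R_act le_pn).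
have lin := is_linear_prod is_linear_sign
  (is_linear_pullback (first_block_morphism n p) (specht_trivial k lam_triv)).
have embl := embeds_prodl (sigma' := subg_repr sigma (subsetT _)) (A := blockmx last_inj (chi w0))
  lin (embeds_pullback (last_block_perm_morphism n p) emb_mu).
apply: embeds_ext (embl _ _) => [f | g Yg z Pz | z Pz].
- exact: block_image.
- apply: block_hom => [j|v|]; first exact: hperm_last.
    by rewrite mulr1 chi_young.
  by rewrite !mulr1 chi_sqr.
by apply: block_inj; [exact: last_inj_inj | rewrite chi0 oner_eq0].
Qed.

(** Here the module of [lam] is realized on triples in the complement of [w0], the coordinates on
    which the character is trivial. *)
Lemma embeds_first :
    mu = int_part p ->
    embeds (specht_repr k (n - p) lam) (tuple_repr k (perm_action 'I_(n - p)) 2) P' ->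
    (forall u, R w0 u <-> exists2 z, P' z & u = z *m push k first_inj 2) ->
  embeds (bipartition_repr k n lam mu) sigma (isofam_sum R p).
Proof.
move=> mu_triv emb_lam RP; apply: (embeds_young char0 RZ R_act le_pn).
apply: embeds_prodr.
  exact: is_linear_pullback (specht_trivial k mu_triv).
have embl := embeds_prodl (sigma' := subg_repr sigma (subsetT _)) (A := blockmx first_inj (chi w0))
  is_linear_sign (embeds_pullback (first_block_morphism n p) emb_lam).
apply: embeds_ext (embl _ _) => [f | g Yg z Pz | z Pz].
- exact: block_image.
- apply: block_hom => [j|v|]; first exact: hperm_first.
    by rewrite chi_young.
  by rewrite chi_sqr.
by apply: block_inj; [exact: first_inj_inj | rewrite chi0 oner_eq0].
Qed.

End Bipartition.

(** * Cycles and coboundaries of a full simplex on a subset of the coordinates *)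

Section Supported.
Variables (k : fieldType) (char0 : [pchar k] =i pred0).
Local Notation bd := (boundary k _ _).

Definition supported n i (T : {set 'I_n}) (z : 'rV[k]_#|{: {ffun 'I_i.+1 -> 'I_n}}|) :=
  forall t, ev z t != 0 -> forall j, t j \in T.

Definition cyc n i (T : {set 'I_n}) (z : 'rV[k]_#|{: {ffun 'I_i.+2 -> 'I_n}}|) :=
  [/\ alt z, supported T z & z *m bd = 0].

(** The simplicial coboundary from functions on pairs to functions on triples. *)
Definition dmx n : 'M[k]_(#|{: {ffun 'I_2 -> 'I_n}}|, #|{: {ffun 'I_3 -> 'I_n}}|) :=
  pullmx k (fun t : {ffun 'I_3 -> 'I_n} => T2 (t ord0) (t (lift ord0 ord0)))
  + pullmx k (fun t : {ffun 'I_3 -> 'I_n} => T2 (t (lift ord0 ord0)) (t (lift ord0 (lift ord0 ord0))))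
  + pullmx k (fun t : {ffun 'I_3 -> 'I_n} => T2 (t (lift ord0 (lift ord0 ord0))) (t ord0)).

Lemma ev_dmx n (y : 'rV_#|{: {ffun 'I_2 -> 'I_n}}|) a b c :
  ev (y *m dmx n) (T3 a b c) = ev y (T2 a b) + ev y (T2 b c) + ev y (T2 c a).
Proof.
by rewrite !mulmxDr !evD !ev_pull /T3 /T2 /T1 !tconsS !tcons0.
Qed.

(* The coboundary of [y] in the full simplex on [T]. *)
Definition delta n (T : {set 'I_n}) (y : 'rV_#|{: {ffun 'I_2 -> 'I_n}}|) :
    'rV[k]_#|{: {ffun 'I_3 -> 'I_n}}| :=
  fv (fun t : {ffun 'I_3 -> 'I_n} => [forall j, t j \in T]%:R * ev (y *m dmx n) t).

Lemma forall_T3 n (T : {set 'I_n}) a b c :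
  [forall j, T3 a b c j \in T] = [&& a \in T, b \in T & c \in T].
Proof.
apply/forallP/and3P => [inT | [Ta Tb Tc] j].
  have := inT ord0; have := inT (lift ord0 ord0); have := inT (lift ord0 (lift ord0 ord0)).
  by rewrite /T3 /T2 /T1 !tconsS !tcons0.
have := codom_f (T3 a b c) j; rewrite 2!codom_tcons codom_T1.
by case/or3P=> /eqP->.
Qed.

Lemma ev_delta n (T : {set 'I_n}) y a b c : ev (delta T y) (T3 a b c)
  = [&& a \in T, b \in T & c \in T]%:R * (ev y (T2 a b) + ev y (T2 b c) + ev y (T2 c a)).
Proof. by rewrite ev_fv forall_T3 ev_dmx. Qed.

Lemma deltaT n y : delta [set: 'I_n] y = y *m dmx n.
Proof.
apply: ev_inj => t; have [a [b [c ->]]] := T3P t.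
by rewrite ev_delta ev_dmx !inE mul1r.
Qed.

Lemma alt_delta n (T : {set 'I_n}) y : alt y -> alt (delta T y).
Proof.
move=> alty; apply: altf3 => a b c; rewrite !ev_delta.
  by rewrite (altf_T2 b a alty) (altf_T2 a c alty) (altf_T2 c b alty) andbCA; ring.
by rewrite (altf_T2 a c alty) (altf_T2 c b alty) (altf_T2 b a alty) [(b \in T) && _]andbC; ring.
Qed.

Lemma supported_delta n (T : {set 'I_n}) y : supported T (delta T y).
Proof.
move=> t; rewrite ev_fv; case: forallP => [inT _ // | _].
by rewrite mul0r eqxx.
Qed.

Lemma supported_T2 n (T : {set 'I_n}) (y : 'rV_#|{: {ffun 'I_2 -> 'I_n}}|) a b :
  supported T y -> ev y (T2 a b) != 0 -> a \in T /\ b \in T.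
Proof.
move=> suppy /suppy inT; have := inT ord0; have := inT (lift ord0 ord0).
by rewrite /T2 /T1 tconsS !tcons0.
Qed.

(** The combinatorial Laplacian of the full simplex on T is multiplication by the number of
    vertices, and on a cycle only the boundary of the coboundary remains of it. *)
Lemma delta_boundary n (T : {set 'I_n}) (y : 'rV_#|{: {ffun 'I_2 -> 'I_n}}|) :
  cyc T y -> delta T y *m bd = #|T|%:R *: y.
Proof.
case=> alty suppy dy0; apply: ev_inj => t; have [a [b ->]] := T2P t.
rewrite ev_boundary evZ; under eq_bigr => c _ do rewrite -/(T3 _ _ _) ev_delta.
have sum0 d : \sum_c ev y (T2 c d) = 0.
  by rewrite -(ev_boundary y (T1 d)) dy0 ev0.
have cardT : \sum_c (c \in T)%:R = #|T|%:R :> k.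
  by rewrite -sum1_card natr_sum [RHS]big_mkcond; apply: eq_bigr => c _; case: (c \in T).
have y_out c d : ~~ ((c \in T) && (d \in T)) -> ev y (T2 c d) = 0.
  by move=> out; apply/eqP; apply: contraNT out => /(supported_T2 suppy)[-> ->].
have [/andP[Ta Tb] | out_ab] := boolP ((a \in T) && (b \in T)); last first.
  rewrite y_out // mulr0 big1 // => c _.
  by rewrite andbF mul0r.
rewrite (eq_bigr (fun c => ev y (T2 c a) + (c \in T)%:R * ev y (T2 a b) - ev y (T2 c b))) => [|c _].
  by rewrite sumrB big_split /= !sum0 subr0 add0r -mulr_suml cardT.
rewrite andbT (altf_T2 b c alty) !mulrDr.
case: (boolP (c \in T)) => [Tc|outc]; first by rewrite !mul1r.
by rewrite !mul0r !y_out ?subr0 ?addr0 ?(negPf outc).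
Qed.

Lemma boundary_supported n i (T : {set 'I_n}) (z : 'rV_#|{: {ffun 'I_i.+2 -> 'I_n}}|) :
  supported T z -> supported T (z *m bd).
Proof.
move=> suppz t nz_t j; have [v nz_v] : exists v, ev z (tcons v t) != 0.
  apply/existsP; apply: contraNT nz_t; rewrite negb_exists => /forallP z0.
  by rewrite ev_boundary big1 // => v _; apply/eqP; move: (z0 v); rewrite negbK.
by have := suppz _ nz_v (lift ord0 j); rewrite tconsS.
Qed.

(** A simplex in the support must use all of T as its vertex set. Its face opposite to the first
    vertex then has no other coface in T, so the boundary there is the coefficient itself. *)
Lemma cyc_small n i (T : {set 'I_n}) (z : 'rV_#|{: {ffun 'I_i.+2 -> 'I_n}}|) :
  cyc T z -> (#|T| <= i.+2)%N -> z = 0.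
Proof.
case=> altz suppz dz0 le_T; apply: ev_inj => t; rewrite ev0; apply/eqP/negPn/negP=> nz_t.
have inj_t : injectiveb t.
  by apply: contraNT nz_t => ninj; rewrite (altf_noninj char0 altz ninj).
have def_T : T = t @: 'I_i.+2.
  apply/esym/eqP; rewrite eqEcard card_imset ?card_ord //; last exact/injectiveP.
  by rewrite le_T andbT; apply/subsetP=> _ /imsetP[j _ ->]; apply: suppz.
have := congr1 (fun u => ev u (face ord0 t)) dz0; rewrite ev0 ev_boundary.
rewrite (bigD1 (t ord0)) //= tcons_face big1 => [|v neq_v]; last first.
  apply/eqP/negPn/negP=> nz_v; have inj_v : injectiveb (tcons v (face ord0 t)).
    by apply: contraNT nz_v => ninj; rewrite (altf_noninj char0 altz ninj).
  have := suppz _ nz_v ord0; rewrite tcons0 def_T => /imsetP[j _ def_v].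
  have [l def_j|def_j] := unliftP ord0 j; last by rewrite def_v def_j eqxx in neq_v.
  move: inj_v; rewrite injective_tcons => /andP[/codomP[]]; exists l.
  by rewrite ffunE def_v def_j.
by rewrite addr0 => z0; rewrite z0 eqxx in nz_t.
Qed.

Lemma cyc0 n i (T : {set 'I_n}) : @cyc n i T 0.
Proof.
by split; rewrite ?mul0mx //; [exact: alt0 | move=> t; rewrite ev0 eqxx].
Qed.

Lemma cycZ n i (T : {set 'I_n}) (z : 'rV_#|{: {ffun 'I_i.+2 -> 'I_n}}|) a :
  cyc T z -> cyc T (a *: z).
Proof.
case=> altz suppz dz0; split; first exact: altZ.
  by move=> t; rewrite evZ mulf_eq0 negb_or => /andP[_ /suppz].
by rewrite -scalemxAl dz0 scaler0.
Qed.

Lemma tuple_repr_alt n i (s : 'S_n) (z : 'rV_#|{: {ffun 'I_i.+1 -> 'I_n}}|) :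
  alt z -> alt (z *m tuple_repr k (perm_action 'I_n) i s).
Proof.
move=> altz t u; rewrite !ev_permutation -altz; congr (ev z _).
by apply/ffunP=> j; rewrite !ffunE.
Qed.

Lemma tuple_repr_supported n i T (s : 'S_n) (z : 'rV_#|{: {ffun 'I_i.+1 -> 'I_n}}|) :
  supported T z -> supported (s @: T) (z *m tuple_repr k (perm_action 'I_n) i s).
Proof.
move=> suppz t; rewrite ev_permutation => /suppz Tt j.
by have := Tt j; rewrite ffunE mem_imset_perm.
Qed.

Lemma cyc_act n i T (s : 'S_n) (z : 'rV_#|{: {ffun 'I_i.+2 -> 'I_n}}|) :
  cyc T z -> cyc (s @: T) (z *m tuple_repr k (perm_action 'I_n) i.+1 s).
Proof.
case=> altz suppz dz0; split; first exact: tuple_repr_alt.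
  exact: tuple_repr_supported.
by rewrite -mulmxA -boundary_act mulmxA dz0 mul0mx.
Qed.

Definition cob n (T : {set 'I_n}) (z : 'rV[k]_#|{: {ffun 'I_3 -> 'I_n}}|) :=
  exists2 y, cyc T y & z = delta T y.

Lemma deltaZ n (T : {set 'I_n}) a y : delta T (a *: y) = a *: delta T y.
Proof. by apply: ev_inj => t; rewrite evZ !ev_fv -scalemxAl evZ mulrCA. Qed.

Lemma delta0 n (T : {set 'I_n}) : delta T 0 = 0.
Proof. by rewrite -(scale0r 0) deltaZ scale0r. Qed.

Lemma cob0 n (T : {set 'I_n}) : cob T 0.
Proof. by exists 0; rewrite ?delta0 //; apply: cyc0. Qed.

Lemma cobZ n (T : {set 'I_n}) z a : cob T z -> cob T (a *: z).
Proof. by case=> y cycy ->; exists (a *: y); rewrite ?deltaZ //; apply: cycZ. Qed.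

Lemma dmx_act n (s : 'S_n) : dmx n *m tuple_repr k (perm_action 'I_n) 2 s
  = tuple_repr k (perm_action 'I_n) 1 s *m dmx n.
Proof.
apply: matrix_pt_eq => x; rewrite !mulmxA; apply: ev_inj => t.
have [a [b [c ->]]] := T3P t; rewrite ev_permutation /= /tuple_act.
have -> (d : {ffun 'I_3 -> 'I_n}) : [ffun j => perm_action 'I_n (d j) s^-1%g]
    = tcomp (s^-1)%g d by apply/ffunP=> j; rewrite !ffunE.
rewrite tcomp_T3 !ev_dmx !ev_permutation /= /tuple_act.
have actE (d : {ffun 'I_2 -> 'I_n}) : [ffun j => perm_action 'I_n (d j) s^-1%g]
    = tcomp (s^-1)%g d by apply/ffunP=> j; rewrite !ffunE.
by rewrite !actE !tcomp_T2.
Qed.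

Lemma cob_act n (T : {set 'I_n}) z (s : 'S_n) :
  cob T z -> cob (s @: T) (z *m tuple_repr k (perm_action 'I_n) 2 s).
Proof.
case=> y cycy ->; exists (y *m tuple_repr k (perm_action 'I_n) 1 s); first exact: cyc_act.
apply: ev_inj => t; rewrite ev_permutation !ev_fv -mulmxA -dmx_act mulmxA ev_permutation.
congr (_%:R * _); congr (nat_of_bool _); apply: eq_forallb => j.
by rewrite ffunE mem_imset_perm.
Qed.

Section Push.
Variables (m n : nat) (iota : 'I_m -> 'I_n) (inj_iota : injective iota).
Variable T : {set 'I_n}.
Hypothesis im_iota : iota @: setT = T.

Lemma supported_tcomp i (t : {ffun 'I_i.+1 -> 'I_n}) :
  (forall j, t j \in T) -> exists t', t = tcomp iota t'.
Proof.
move=> Tt; have /fin_all_exists[f def_f] j : exists l, t j = iota l.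
  by have := Tt j; rewrite -im_iota => /imsetP[l _ ->]; exists l.
by exists [ffun j => f j]; apply/ffunP=> j; rewrite !ffunE.
Qed.

Lemma push_supported i (z : 'rV_#|{: {ffun 'I_i.+1 -> 'I_m}}|) : supported T (z *m push k iota i).
Proof.
move=> t nz_t j; apply: contraNT nz_t => out_j; apply/eqP/ev_push_out => a def_t.
by case/negP: out_j; rewrite -def_t ffunE -im_iota imset_f.
Qed.

Lemma push_pull i (z : 'rV_#|{: {ffun 'I_i.+1 -> 'I_n}}|) : supported T z ->
  z *m pull k iota i *m push k iota i = z.
Proof. by move=> suppz; apply: pullK => // t /suppz/supported_tcomp. Qed.

Lemma cyc_push i (z : 'rV_#|{: {ffun 'I_i.+2 -> 'I_n}}|) :
  cyc T z <-> exists2 z', alt z' /\ z' *m bd = 0 & z = z' *m push k iota i.+1.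
Proof.
split=> [[altz suppz dz0] | [z' [altz dz0] ->]]; last first.
  split; [exact: alt_push | exact: push_supported |].
  by rewrite push_boundary dz0 mul0mx.
exists (z *m pull k iota i.+1); last by rewrite push_pull.
split; first exact: alt_pull.
by apply: (push_inj inj_iota); rewrite mul0mx -push_boundary push_pull.
Qed.

Lemma push_dmx (y : 'rV_#|{: {ffun 'I_2 -> 'I_m}}|) :
  y *m dmx m *m push k iota 2 = delta T (y *m push k iota 1).
Proof.
apply: ev_inj => t; have [out_t | /negbNE/forallP/supported_tcomp[t' ->]] :=
  boolP (~~ [forall j, t j \in T]).
  rewrite ev_fv (negPf out_t) mul0r; apply/ev_push_out => a def_t.
  by case/negP: out_t; apply/forallP=> j; rewrite -def_t ffunE -im_iota imset_f.
rewrite (ev_push_in inj_iota); have [a [b [c ->]]] := T3P t'.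
rewrite tcomp_T3 ev_delta ev_dmx -!tcomp_T2 !(ev_push_in inj_iota).
by rewrite -im_iota !imset_f // mul1r.
Qed.

Lemma cob_push z : cob T z <-> exists2 z', (exists2 y, alt y /\ y *m bd = 0 & z' = y *m dmx m)
  & z = z' *m push k iota 2.
Proof.
split=> [[y /cyc_push[y' cycy' ->] ->] | [_ [y cycy ->] ->]].
  by exists (y' *m dmx m); [exists y' | rewrite push_dmx].
exists (y *m push k iota 1); last by rewrite push_dmx.
by apply/cyc_push; exists y.
Qed.

End Push.

(** The hook (j, 1^2) is the space of 1-cycles; by [delta_boundary] the coboundary is injective on
    it and moves it to functions on triples. *)
Lemma embeds_hook2 m j lam : (0 < j)%N -> lam = j :: nseq 2 1%N -> m = (j + 2)%N ->
  embeds (specht_repr k m lam) (tuple_repr k (perm_action 'I_m) 2)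
    (fun z => exists2 y, alt y /\ y *m bd = 0 & z = y *m dmx m).
Proof.
move=> j_gt0 def_lam def_m; have m_gt0 : (0 < m)%N by rewrite def_m addn_gt0 j_gt0.
apply: embeds_hom (embeds_hook char0 (r := 0) j_gt0 def_lam def_m) => [s _ y _|y [alty dy0] yd0].
  by rewrite -!mulmxA dmx_act.
have := delta_boundary (T := setT) (And3 alty (fun _ _ _ => in_setT _) dy0).
rewrite deltaT yd0 mul0mx cardsT card_ord => /esym/eqP.
by rewrite scaler_eq0 (negPf (char0_natf_neq0 char0 m_gt0)) => /eqP.
Qed.

End Supported.

Lemma big_seq_fibres (R : nmodType) (I : finType) (J : eqType) (r : seq J)
    (h : I -> nat) (c : J -> nat) (G : I -> R) :
    uniq r -> {in r &, injective c} ->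
    (forall i, {in r, forall j, h i != c j} -> G i = 0) ->
  \sum_i G i = \sum_(j <- r) \sum_(i | h i == c j) G i.
Proof.
move=> uniq_r inj_c G0; under [RHS]eq_bigr => j _ do rewrite big_mkcond.
rewrite exchange_big; apply: eq_bigr => i _ /=.
have [/hasP[j rj /eqP hj] | /hasPn out] := boolP (has (fun j => h i == c j) r); last first.
  by rewrite big_seq big1 ?G0 // => j /out/negPf->.
rewrite (bigD1_seq j) //= hj eqxx big_seq_cond big1 ?addr0 // => l /andP[rl neq_lj].
by case: eqP => // /(inj_c _ _ rj rl) eq_jl; rewrite eq_jl eqxx in neq_lj.
Qed.

(** * Splitting the image of H_3 by character and by the sign of the shift *)

Section Totals.
Variables (k : fieldType) (char0 : [pchar k] =i pred0) (n : nat).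
Notation tri := {ffun 'I_3 -> 'I_n}.
Local Notation M := 'rV[k]_#|{: cube_idx n}|.
Local Notation sigma := (cube_module k n).
Implicit Types (f : M) (T w : {set 'I_n}) (z : 'rV[k]_#|{: tri}|).

Section OneFamily.
Variable R : {set 'I_n} -> 'rV[k]_#|{: tri}| -> Prop.
Hypothesis R0 : forall T, R T 0.

Definition isofam_total f :=
  exists2 F : {set 'I_n} -> M, forall w, isofam R w (F w) & f = \sum_w F w.

Lemma isofam0 w : isofam R w 0.
Proof.
have s0 v : slice (0 : M) v = 0 by rewrite /slice mul0mx.
by split=> [v|]; rewrite !s0 ?scaler0.
Qed.

Definition card_proj p : 'M[k]_#|{: cube_idx n}| :=
  \sum_(w : {set 'I_n} | #|w| == p) iso_proj k w.

Lemma card_projP p q f : isofam_sum R p f -> f *m card_proj q = if p == q then f else 0.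
Proof.
case=> F famF ->; have projF w : #|w| == p ->
    F w *m card_proj q = if p == q then F w else 0.
  move=> card_w; have [isow _] := famF w card_w; rewrite mulmx_sumr -(eqP card_w).
  have [card_wq | card_wq] := ifPn.
    rewrite (bigD1 w) //= (iso_projP char0 _ isow) eqxx big1 ?addr0 // => w' /andP[_ neq_w'].
    by rewrite (iso_projP char0 _ isow) eq_sym (negPf neq_w').
  rewrite big1 // => w' card_w'; rewrite (iso_projP char0 _ isow).
  by case: eqP => // eq_w; rewrite eq_w card_w' in card_wq.
rewrite mulmx_suml; case: eqP projF => _ projF; first exact: eq_bigr.
exact: big1.
Qed.

(** The functions are grouped by the size of the character. Characters of a size outside the list
    carry no nonzero function, so nothing is missed. *)
Lemma embeds_total (J : eqType) (r : seq J) (c : J -> nat)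
    (rho : J -> representation k [set: hyperoct n]) :
    uniq r -> {in r &, injective c} ->
    (forall w z, {in r, forall j, #|w| != c j} -> R w z -> z = 0) ->
    {in r, forall j, embeds (rho j) sigma (isofam_sum R (c j))} ->
  embeds (\big[dadd_grepr/grepr0]_(j <- r) rho j) sigma isofam_total.
Proof.
move=> uniq_r inj_c out0 emb.
have pi_c := embeds_bigsum (pi := fun j => card_proj (c j)) uniq_r emb.
apply: embeds_ext (pi_c _) => [f | i j ri rj f famf]; last first.
  by rewrite (card_projP _ famf) (inj_in_eq inj_c).
split=> [[G famG ->] | [F famF ->]].
  (* The component at [w] is recovered by projecting the summand of the size of [w]; the remaining
     sizes get 0. *)
  have /fin_all_exists[F PF] (w : {set 'I_n}) : exists Fw : M, isofam R w Fw /\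
      ({in r, forall j, #|w| != c j} -> Fw = 0) /\
      {in r, forall j, #|w| = c j -> G j *m iso_proj k w = Fw}.
    have [/hasP[j rj /eqP cw] | /hasPn out] := boolP (has (fun j => #|w| == c j) r); last first.
      exists 0; split; first exact: isofam0.
      by split=> // j rj cw; case/eqP: (out j rj).
    have [F famF def_G] := famG j rj; exists (F w); split; first by apply: famF; rewrite cw.
    split=> [out | l rl cw']; first by have := out j rj; rewrite cw eqxx.
    have -> : l = j by apply: inj_c => //; rewrite -cw -cw'.
    rewrite def_G mulmx_suml (bigD1 w) /=; last by rewrite cw.
    have projF w' : #|w'| == c j -> F w' *m iso_proj k w = if w' == w then F w' else 0.
      by move=> cw1; apply: iso_projP => //; case: (famF _ cw1).
    rewrite projF ?cw // eqxx big1 ?addr0 // => w' /andP[cw1 neq_w].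
    by rewrite projF // (negPf neq_w).
  exists F => [w|]; first by case: (PF w).
  rewrite (@big_seq_fibres _ _ _ r (fun w : {set 'I_n} => #|w|) c) // => [|w out]; last first.
    by case: (PF w) => _ [F0 _]; apply: F0.
  rewrite !big_seq; apply: eq_bigr => j rj; have [F' famF' def_G] := famG j rj.
  rewrite def_G; apply: eq_bigr => w cw; case: (PF w) => _ [_ PF3]; rewrite -(PF3 j rj (eqP cw)).
  rewrite def_G mulmx_suml (bigD1 w) //= big1 ?addr0 => [|w' /andP[cw1 neq_w]].
    by rewrite (iso_projP char0 w (proj1 (famF' w cw))) eqxx.
  by rewrite (iso_projP char0 w (proj1 (famF' w' cw1))) (negPf neq_w).
have F0 w : {in r, forall j, #|w| != c j} -> F w = 0.
  move=> out_w; have [isoF RF] := famF w; apply: slice_inj => v.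
  by rewrite isoF (out0 w _ out_w RF) scaler0 /slice mul0mx.
exists (fun j => \sum_(w : {set 'I_n} | #|w| == c j) F w) => [j rj|].
  by exists F.
exact: big_seq_fibres.
Qed.

End OneFamily.
End Totals.

Section Parts.
Variables (k : fieldType) (char0 : [pchar k] =i pred0) (n : nat).
Notation V := 'rV['Z_2]_n.
Notation tri := {ffun 'I_3 -> 'I_n}.
Local Notation E i := (e (Some i)).
Local Notation bd := (boundary k _ _).
Local Notation chi := (chi k).
Local Notation M := 'rV[k]_#|{: cube_idx n}|.
Local Notation sigma := (cube_module k n).
Implicit Types (f : M) (T w : {set 'I_n}) (z : 'rV[k]_#|{: tri}|).

(* The eigenspace of the shift by a direction of the cube. *)
Definition eigencube (s : k) f :=
  (forall v, alt (slice f v)) /\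
  (forall v a b c, ev f (v + E a, T3 a b c) = s * ev f (v, T3 a b c)).

(** For sign -1, [dcube] changes sign under the shift while [cube_image] asks for its invariance, so
    it vanishes: each slice is a cycle. For sign 1 that invariance follows from the shift rule. *)
Definition minus_part f := eigencube (-1) f /\ forall v, slice f v *m bd = 0.
Definition plus_part f := eigencube 1 f.

Lemma alt_slice f : (forall v, alt (slice f v)) <-> cube_alt f.
Proof.
by split=> altf v t s; have := altf v t s; rewrite !ev_slice.
Qed.

Lemma eigencube_shift s f (v : V) (t : tri) (j : 'I_3) : eigencube s f ->
  ev f (v + E (t j), t) = s * ev f (v, t).
Proof.
case=> /alt_slice altf shiftf; have [a [b [c def_t]]] := T3P t.
have shift2 a' b' c' : ev f (v + E b', T3 a' b' c') = s * ev f (v, T3 a' b' c').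
  rewrite (altf_T3l a' b' c' (altf (v + E b'))) shiftf -mulrN.
  by rewrite -(altf_T3l a' b' c' (altf v)).
have := codom_f t j; rewrite def_t 2!codom_tcons codom_T1.
case/or3P=> /eqP ->; [exact: shiftf | exact: shift2 |].
rewrite (altf_T3r a b c (altf (v + E c))) shift2 -mulrN.
by rewrite -(altf_T3r a b c (altf v)).
Qed.

Lemma slice_comp w f : slice (isocomp w f) 0 = (2%:R ^+ n)^-1 *: \sum_u chi w u *: slice f u.
Proof. by rewrite slice_unslice chi0 scale1r. Qed.

(** Shifting the summation variable by a direction of [t] multiplies each term by -1, so the sum is
    zero. Hence sign -1 supports the component on [w], and sign 1 on its complement. *)
Lemma comp_support s w f (t : tri) (j : 'I_3) : eigencube s f -> chi w (E (t j)) * s = -1 ->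
  ev (slice (isocomp w f) 0) t = 0.
Proof.
move=> eigf opp; rewrite slice_comp evZ ev_sum; apply/eqP; rewrite mulf_eq0; apply/orP; right.
apply/eqP/(eq_oppr0 char0); rewrite -[RHS]mulN1r -opp mulr_sumr.
rewrite (reindex_inj (@addIr _ (E (t j)))) /=; apply: eq_bigr => u _.
rewrite [LHS]evZ [in RHS]evZ !ev_slice (eigencube_shift u t j eigf) chiD.
by rewrite [chi w u * _]mulrC mulrACA.
Qed.

Lemma alt_comp w f : (forall v, alt (slice f v)) -> alt (slice (isocomp w f) 0).
Proof.
by move=> altf; rewrite slice_comp; apply/altZ/alt_sum => u _; apply: altZ.
Qed.

Lemma comp_cycle w f : (forall v, slice f v *m bd = 0) -> slice (isocomp w f) 0 *m bd = 0.
Proof.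
move=> cycf; rewrite slice_comp -scalemxAl mulmx_suml big1 ?scaler0 // => u _.
by rewrite -scalemxAl cycf scaler0.
Qed.

Lemma chi_E w i : chi w (E i) = (-1) ^+ (i \in w). Proof. exact: chi_eS. Qed.

Lemma eigencube_iso s w f : iso w f -> alt (slice f 0) ->
  (forall t, ev (slice f 0) t != 0 -> forall j, chi w (E (t j)) = s) -> eigencube s f.
Proof.
move=> isof alt0 supp0; split=> [v|v a b c]; first by rewrite isof; apply: altZ.
rewrite -!ev_slice isof [in RHS]isof !evZ chiD.
have [-> | nz] := eqVneq (ev (slice f 0) (T3 a b c)) 0; first by rewrite !mulr0.
have := supp0 _ nz ord0; rewrite tcons0 => ->.
by rewrite [_ * s]mulrC mulrA.
Qed.

Lemma eigencube_sum s (I : finType) (P : pred I) (F : I -> M) :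
  (forall i, P i -> eigencube s (F i)) -> eigencube s (\sum_(i | P i) F i).
Proof.
move=> eigF; split=> [v|v a b c].
  by rewrite slice_sum; apply: alt_sum => i /eigF[].
by rewrite !ev_sum mulr_sumr; apply: eq_bigr => i /eigF[].
Qed.

Lemma minus_partP f : minus_part f <-> isofam_total (@cyc k n 1) f.
Proof.
split=> [[eigf cycf] | [F famF ->]]; last first.
  have eigF w : eigencube (-1) (F w).
    have [isoF [altF suppF _]] := famF w; apply: eigencube_iso isoF altF _ => t /suppF Tt j.
    by rewrite chi_E Tt.
  split; first exact: eigencube_sum.
  move=> v; rewrite slice_sum mulmx_suml big1 // => w _.
  by have [isoF [_ _ dF]] := famF w; rewrite (isoF v) -scalemxAl dF scaler0.
exists (fun w => isocomp w f) => [w|]; last by rewrite sum_comp.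
split; first exact: comp_iso.
split; [by apply: alt_comp; case: eigf | | exact: comp_cycle].
move=> t nz_t j; apply: contraNT nz_t => out_j.
by rewrite (comp_support (j := j) eigf) // chi_E (negPf out_j) mul1r.
Qed.

Definition alt_supp T z := alt z /\ supported T z.

Lemma plus_partP f : plus_part f <-> isofam_total (fun w => alt_supp (~: w)) f.
Proof.
split=> [eigf | [F famF ->]]; last first.
  apply: eigencube_sum => w _; have [isoF [altF suppF]] := famF w.
  apply: eigencube_iso isoF altF _ => t /suppF Tt j.
  by have := Tt j; rewrite inE chi_E => /negPf->.
exists (fun w => isocomp w f) => [w|]; last by rewrite sum_comp.
split; first exact: comp_iso.
split; first by apply: alt_comp; case: eigf.
move=> t nz_t j; rewrite inE; apply: contraNN nz_t => in_j.
by rewrite (comp_support (j := j) eigf) // chi_E in_j mulr1.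
Qed.

(** A Hodge decomposition: with y the boundary of z divided by the size of T, [delta T y] has the
    same boundary as z by [delta_boundary], so the difference is a cycle. An empty T is treated
    apart because of the division. *)
Lemma alt_suppP T z : alt_supp T z <->
  exists z0 z1, [/\ cob T z0, cyc T z1 & z = z0 + z1].
Proof.
split=> [[altz suppz] | [_ [z1 [[y [alty suppy _] ->] [alt1 supp1 _] ->]]]]; last first.
  split; first by apply: altD => //; apply: alt_delta.
  move=> t; have [z1t | /supp1 //] := eqVneq (ev z1 t) 0.
  by rewrite evD z1t addr0; apply: supported_delta.
have [T0 | T_gt0] := posnP #|T|.
  exists 0, 0; split; [exact: cob0 | exact: cyc0 |].
  apply: ev_inj => t; rewrite evD ev0 addr0; apply/eqP/negPn/negP=> /suppz/(_ ord0).
  by rewrite (cards0_eq T0) inE.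
pose y := #|T|%:R^-1 *: (z *m bd).
have cycy : cyc T y.
  apply: cycZ; split; [exact: alt_boundary | exact: boundary_supported |].
  exact: boundary_boundary.
have cob_y : cob T (delta T y) by exists y.
exists (delta T y), (z - delta T y); split=> //; last by rewrite addrC subrK.
split.
- by apply: altD => //; rewrite -scaleN1r; apply/altZ/alt_delta; case: cycy.
- move=> t; have [zt | /suppz //] := eqVneq (ev z t) 0.
  by rewrite evD evN zt add0r oppr_eq0; apply: supported_delta.
rewrite mulmxBl (delta_boundary cycy) scalerA mulfV ?scale1r ?subrr //.
exact: char0_natf_neq0.
Qed.

Lemma isofam_lift (R : {set 'I_n} -> 'rV[k]_#|{: tri}| -> Prop) w z :
  R w z -> isofam R w (unslice (fun v => chi w v *: z)).
Proof.
by move=> Rz; split=> [v|]; rewrite ?slice_unslice ?chi0 ?scale1r // !slice_unslice chi0 scale1r.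
Qed.

Lemma plus_part_split f : plus_part f <->
  exists u0 u1, [/\ isofam_total (fun w => cob (~: w)) u0,
     isofam_total (fun w => cyc (~: w)) u1 & f = u0 + u1].
Proof.
split=> [/plus_partP[F famF ->] | [_ [_ [[F0 fam0 ->] [F1 fam1 ->] ->]]]].
  have /fin_all_exists2[F0 fam0 famB] w : exists2 F0, isofam (fun w => cob (~: w)) w F0
      & isofam (fun w => cyc (~: w)) w (F w - F0).
    have [isoF /alt_suppP[z0 [z1 [cob0 cyc1 def_F]]]] := famF w.
    have fam0 := isofam_lift (R := fun w => cob (~: w)) cob0.
    have fam1 := isofam_lift (R := fun w => cyc (~: w)) cyc1.
    exists (unslice (fun v => chi w v *: z0)) => //.
    suff -> : F w - unslice (fun v => chi w v *: z0) = unslice (fun v => chi w v *: z1) by [].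
    apply/eqP; rewrite subr_eq; apply/eqP/slice_inj => v.
    by rewrite sliceD !slice_unslice isoF def_F scalerDr addrC.
  exists (\sum_w F0 w), (\sum_w (F w - F0 w)).
  split; [by exists F0 | by exists (fun w => F w - F0 w) |].
  by rewrite -big_split; apply: eq_bigr => w _; rewrite [RHS]addrC subrK.
apply/plus_partP; exists (fun w => F0 w + F1 w) => [w|]; last by rewrite big_split.
have [iso0 R0] := fam0 w; have [iso1 R1] := fam1 w.
split=> [v|]; first by rewrite !sliceD iso0 iso1 scalerDr.
by rewrite sliceD; apply/alt_suppP; exists (slice (F0 w) 0), (slice (F1 w) 0).
Qed.

Lemma cob_cyc0 T z : cob T z -> z *m bd = 0 -> z = 0.
Proof.
case=> y cycy ->; rewrite (delta_boundary cycy) => /eqP; rewrite scaler_eq0 => /orP[].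
  have [T0 _|T_gt0] := posnP #|T|; last by rewrite (negPf (char0_natf_neq0 char0 T_gt0)).
  by rewrite (cyc_small char0 cycy) ?delta0 // T0.
by move/eqP->; rewrite delta0.
Qed.

Lemma plus_part_direct (u : M) : isofam_total (fun w => @cob k n (~: w)) u ->
  isofam_total (fun w => @cyc k n 1 (~: w)) u -> u = 0.
Proof.
case=> F0 fam0 def0 [F1 fam1 def1]; rewrite def0 big1 // => w _.
have projF (R : {set 'I_n} -> 'rV[k]_#|{: tri}| -> Prop) (F : {set 'I_n} -> M) :
    (forall w, isofam R w (F w)) -> (\sum_w F w) *m iso_proj k w = F w.
  move=> famF; rewrite mulmx_suml (bigD1 w) //= (iso_projP char0 w (proj1 (famF w))) eqxx.
  rewrite big1 ?addr0 // => w' neq_w.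
  by rewrite (iso_projP char0 w (proj1 (famF w'))) (negPf neq_w).
have eqF : F0 w = F1 w by rewrite -(projF _ _ fam0) -(projF _ _ fam1) -def0 -def1.
have [iso0 cob_w] := fam0 w; have [_ [_ _ d0]] := fam1 w.
apply: slice_inj => v; rewrite iso0 (cob_cyc0 cob_w) ?scaler0 /slice ?mul0mx //.
by rewrite -/(slice _ _) eqF.
Qed.

Lemma slice_boundary f v : cube_alt f -> (slice f v *m bd = 0) <->
  forall a b, dcube f v a b = 0.
Proof.
move=> altf; have dE a b : dcube f v a b = ev (slice f v *m bd) (T2 a b).
  rewrite ev_boundary; apply: eq_bigr => c _; rewrite ev_slice -/(T3 c a b).
  by rewrite (altf_T3r a b c (altf v)) (altf_T3l a c b (altf v)) opprK.
split=> [d0 a b | d0]; first by rewrite dE d0 ev0.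
by apply: ev_inj => t; have [a [b ->]] := T2P t; rewrite -dE d0 ev0.
Qed.

(** The shift [S] by a direction of the face is an involution, and f is half the sum of f - S f and
    f + S f. The condition on [dcube] is what makes the slices of the first part cycles. *)
Lemma cube_image_split f : cube_image f <->
  exists u1 u2, [/\ minus_part u1, plus_part u2 & f = u1 + u2].
Proof.
have nz2 : 2%:R != 0 :> k := char0_natf_neq0 char0 (isT : 0 < 2)%N.
split=> [[altf invf df] | [u1 [u2 [[eig1 d1] eig2 ->]]]]; last first.
  have alt1 := proj1 eig1; have alt2 := proj1 eig2.
  split=> [|v a b c|v a b].
  - by apply/alt_slice => v; rewrite sliceD; apply: altD.
  - have sh s u : eigencube s u -> ev u (v + E a + E b, T3 a b c) = s * (s * ev u (v, T3 a b c)).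
      move=> eigu; have := eigencube_shift (v + E a) (T3 a b c) (lift ord0 ord0) eigu.
      rewrite tconsS tcons0 => ->; have := eigencube_shift v (T3 a b c) ord0 eigu.
      by rewrite tcons0 => ->.
    by rewrite !evD (sh _ _ eig1) (sh _ _ eig2) !mul1r !mulN1r opprK.
  have dD v' : dcube (u1 + u2) v' a b = dcube u2 v' a b.
    rewrite /dcube; under eq_bigr => c _ do rewrite evD.
    rewrite big_split /= -/(dcube u1 v' a b).
    by rewrite (proj1 (slice_boundary v' (proj1 (alt_slice _) alt1))) ?add0r // d1.
  rewrite !dD; apply: eq_bigr => c _; have := eigencube_shift v (T3 a b c) ord0 eig2.
  by rewrite tcons0 mul1r.
(* The first direction is used; invariance under the double shift [invf] makes the choice of
   direction immaterial, which is why [S] is again alternating. *)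
pose S : M := fv (fun p : cube_idx n => ev f (p.1 + E (p.2 ord0), p.2)).
have ev_S v a b c : ev S (v, T3 a b c) = ev f (v + E a, T3 a b c) by rewrite ev_fv /= tcons0.
have altS : cube_alt S.
  move=> v; apply: altf3 => a b c; rewrite !ev_S.
    have -> : v + E b = v + E a + E a + E b by rewrite addvK.
    by rewrite (altf_T3l b a c (altf _)) invf opprK.
  exact: (altf_T3r a b c (altf _)).
pose u1 : M := 2%:R^-1 *: (f - S).
have sl g g' v : slice (2%:R^-1 *: (g + g')) v = 2%:R^-1 *: (slice g v + slice g' v).
  by rewrite /slice -scalemxAl mulmxDl.
have slN g v : slice (- g) v = - slice g v by rewrite /slice mulNmx.
have alt_f := proj2 (alt_slice f) altf.
have alt_S := proj2 (alt_slice S) altS.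
have SS v a b c : ev f (v + E a + E a, T3 a b c) = ev f (v, T3 a b c) by rewrite addvK.
exists u1, (2%:R^-1 *: (f + S)); split; last first.
- rewrite -scalerDr addrACA addNr addr0 -mulr2n -scaler_nat scalerA mulVf //.
  by rewrite scale1r.
- split=> [v|v a b c]; first by rewrite sl; apply/altZ/altD.
  by rewrite !evZ !evD !ev_S SS mul1r addrC.
split; first split=> [v|v a b c].
- by rewrite sl slN; apply/altZ/altD => //; rewrite -scaleN1r; apply: altZ.
- by rewrite !evZ !evD !evN !ev_S SS mulN1r -mulrN opprB.
have alt1 : cube_alt u1.
  by apply/alt_slice => v; rewrite sl slN; apply/altZ/altD => //; rewrite -scaleN1r; apply: altZ.
move=> v; apply/(slice_boundary v alt1) => a b.
rewrite /dcube; under eq_bigr => c _ do rewrite evZ evD evN ev_S.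
by rewrite -mulr_sumr sumrB -/(dcube f v a b) -/(dcube f (v + E a) a b) df subrr mulr0.
Qed.

Lemma minus_plus_direct u : minus_part u -> plus_part u -> u = 0.
Proof.
case=> [[_ shift1] _] [_ shift2]; apply: ev_inj => -[v t]; rewrite ev0.
have [a [b [c ->]]] := T3P t; apply: (eq_oppr0 char0).
by rewrite -mulN1r -shift1 shift2 mul1r.
Qed.

(** The character [w] has size j + 3. A simplex on at most three vertices has no nonzero 2-cycle, so
    the range of j starts at 1, and j + 3 is at most n. *)
Lemma embeds_hooks : embeds (\big[dadd_grepr/grepr0]_(1 <= j < n - 2)
    bipartition_repr k n (int_part (n - 3 - j)) (j :: nseq 3 1%N)) sigma minus_part.
Proof.
apply: embeds_ext (embeds_total char0 (R := @cyc k n 1) (c := fun j => (j + 3)%N)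
  (fun T => cyc0 k _ T) (iota_uniq _ _) _ _ _) => [f|i j _ _ /addIn //|w z out cycz|j].
- by split=> /minus_partP.
- have := cyc_small char0 cycz; have [le3 | gt3] := leqP #|w| 3; first exact.
  have le_n : (#|w| <= n)%N by rewrite -[X in (_ <= X)%N]card_ord max_card.
  have /out : (#|w| - 3)%N \in index_iota 1 (n - 2) by rewrite mem_index_iota; lia.
  by rewrite subnK ?eqxx // ltnW.
rewrite mem_index_iota => j_range.
have le_pn : (sumn (j :: nseq 3 1%N) <= n)%N by rewrite /=; lia.
have emb_j := @embeds_last k char0 n (int_part (n - 3 - j)) (j :: nseq 3 1%N) le_pn _ (@cyc k n 1).
apply: emb_j => [T z a|T z s|||u].
- exact: cycZ.
- exact: cyc_act.
- by congr int_part; rewrite /=; lia.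
- apply: (embeds_hook char0 (r := 1) (j := j)) => //; by lia.
exact: (cyc_push (@last_inj_inj _ _ le_pn) (imset_last_inj le_pn)).
Qed.

(** Here i is the size of [w], and the simplex lives on the n - i remaining coordinates.
    Coboundaries of 1-cycles (j = 0) need n - i at least 3 and 2-cycles (j = 1) at least 4, which
    are the bounds on i. *)
Lemma embeds_second : embeds
    (\big[dadd_grepr/grepr0]_(0 <= j < 2)
         \big[dadd_grepr/grepr0]_(0 <= i < n - 2 - j)
           bipartition_repr k n ((n - 2 - i - j)%N :: nseq (2 + j) 1%N) (int_part i))
    sigma plus_part.
Proof.
have sum_int i : sumn (int_part i) = i by case: i => //= i; rewrite addn0.
have cardC w : (#|~: w| = n - #|w|)%N by rewrite cardsCs setCK card_ord.
have le_n w : (#|w| <= n)%N by rewrite -[X in (_ <= X)%N]card_ord max_card.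
have emb0 : embeds (\big[dadd_grepr/grepr0]_(0 <= i < n - 2 - 0)
    bipartition_repr k n ((n - 2 - i - 0)%N :: nseq (2 + 0) 1%N) (int_part i)) sigma
    (isofam_total (fun w => cob (~: w))).
  apply: (embeds_total char0 (c := fun i => sumn (int_part i))
    (fun T => cob0 k (~: T)) (iota_uniq _ _)) => [i j _ _|w _ out [y cycy ->]|i].
  - by rewrite !sum_int.
  - rewrite (cyc_small char0 cycy) ?delta0 // cardC.
    have := out #|w|; rewrite mem_index_iota sum_int eqxx; lia.
  rewrite mem_index_iota => i_range.
  have le_pn : (sumn (int_part i) <= n)%N by rewrite sum_int; lia.
  have emb_i := @embeds_first k char0 n ((n - 2 - i - 0)%N :: nseq (2 + 0) 1%N) _ le_pn _
    (fun w => @cob k n (~: w)).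
  apply: emb_i => [T z a|T z s|||u].
  - exact: cobZ.
  - by rewrite -imset_permC; apply: cob_act.
  - by rewrite sum_int.
  - by apply: (embeds_hook2 char0 (j := (n - 2 - i - 0)%N)) => //; rewrite ?sum_int; lia.
  exact: (cob_push (@first_inj_inj _ _) (imset_first_inj _ _)).
have emb1 : embeds (\big[dadd_grepr/grepr0]_(0 <= i < n - 2 - 1)
    bipartition_repr k n ((n - 2 - i - 1)%N :: nseq (2 + 1) 1%N) (int_part i)) sigma
    (isofam_total (fun w => @cyc k n 1 (~: w))).
  apply: (embeds_total char0 (c := fun i => sumn (int_part i))
    (fun T => cyc0 k _ (~: T)) (iota_uniq _ _)) => [i j _ _|w z out cycz|i].
  - by rewrite !sum_int.
  - apply: (cyc_small char0 cycz); rewrite cardC.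
    have := out #|w|; rewrite mem_index_iota sum_int eqxx; lia.
  rewrite mem_index_iota => i_range.
  have le_pn : (sumn (int_part i) <= n)%N by rewrite sum_int; lia.
  apply: (embeds_first char0 le_pn (R := fun w => @cyc k n 1 (~: w))) => [T z a|T z s|||u].
  - exact: cycZ.
  - by rewrite -imset_permC; apply: cyc_act.
  - by rewrite sum_int.
  - by apply: (embeds_hook char0 (r := 1) (j := (n - 2 - i - 1)%N)) => //; rewrite ?sum_int; lia.
  exact: (cyc_push (@first_inj_inj _ _) (imset_first_inj _ _)).
rewrite (@big_ltn _ _ _ 0 2) // (@big_ltn _ _ _ 1 2) // (@big_geq _ _ _ 2 2) //.
have emb10 := embeds_dadd (fun u _ (u0 : u = 0) => u0) emb1 (embeds_grepr0 sigma).
apply: embeds_ext (embeds_dadd _ emb0 emb10) => [f | u fam0 [u1 [_ [fam1 -> def_u]]]]; last first.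
  by apply: plus_part_direct fam0 _; rewrite def_u addr0.
split=> [[u0 [_ [fam0 [u1 [_ [fam1 -> ->]]] ->]]] | /plus_part_split[u0 [u1 [fam0 fam1 ->]]]].
  by apply/plus_part_split; exists u0, u1; rewrite addr0.
by exists u0, u1; split=> //; exists u1, 0; rewrite addr0.
Qed.

End Parts.

(** * One-dimensional induced representations *)

Section Linear.
Variables (k : fieldType) (gT : finGroupType) (H : {group gT}).

Lemma eq_is_linear d (rho : mx_representation k H d) chi chi' :
  {in H, chi =1 chi'} -> is_linear rho chi -> is_linear rho chi'.
Proof. by move=> eq_chi [d1 lin]; split=> // g Hg; rewrite lin ?eq_chi. Qed.

Lemma is_linear_subg (G : {group gT}) (sHG : H \subset G) d (rho : mx_representation k G d) chi :
  is_linear rho chi -> is_linear (subg_repr rho sHG) chi.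
Proof. by case=> d1 lin; split=> // g Hg; apply/lin/(subsetP sHG). Qed.

Lemma linear_embeds d (rho : mx_representation k H d) chi N
    (sigma : mx_representation k H N) (u : 'rV_N) :
  is_linear rho chi -> u != 0 -> {in H, forall g, u *m sigma g = chi g *: u} ->
  embeds rho sigma (fun v => (v <= u)%MS).
Proof.
case=> d1; move: rho; rewrite d1 => rho lin nz_u sigma_u; exists u; split=> // [|g Hg].
  by rewrite /row_free rank_rV nz_u.
by rewrite sigma_u // lin // mul_scalar_mx.
Qed.

(** Inducing from the whole group involves a single coset, so [embeds_induced] is used with a
    one-point index set. *)
Lemma is_linear_induced d (rho : mx_representation k H d) chi :
  H = [set: gT]%G -> is_linear rho chi -> is_linear (induced_repr rho) chi.
Proof.
move=> eqH; move: rho; rewrite {}eqH => rho [d1 lin].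
apply: (is_linear_embeds (sigma := rho) (P := fun=> True) d1) => //.
apply: embeds_ext (embeds_induced (Omega := unit) (kappa := fun=> tt) (O := predT)
  (P := fun=> True) (Q := fun _ _ => True) (pi := fun=> 1%:M) _ _ _ _ _) => //.
- by move=> u; split=> // _; exists (fun=> u); rewrite // big_const card_unit /= addr0.
- by move=> g h; rewrite !inE.
- by move=> []; apply: (iffP idP) => // _; exists 1%g.
- by move=> [] [] u _ _; rewrite mulmx1.
exists 1%:M; split=> [|g _|u]; first by rewrite row_free_unit unitmx1.
  by rewrite mulmx1 mul1mx.
by split=> // _; rewrite submx1.
Qed.

End Linear.

Section LinearBipartitions.
Variables (k : fieldType) (m : nat).

Lemma young_group_full : young_group m 0 = [set: hyperoct m]%G.
Proof.
apply: group_inj; apply/setP=> g; rewrite [RHS]inE; apply/young_setP=> i.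
by rewrite !subn0 !ltn_ord.
Qed.

Lemma is_linear_bipartition lam psi : is_linear (specht_repr k (m - 0) lam) psi ->
  is_linear (bipartition_repr k m lam [::]) (fun g => psi (first_block 0 g)).
Proof.
move=> lin; apply: is_linear_induced; first exact: young_group_full.
have lin_sign := is_linear_sign k m [::].
have lin0 := specht_trivial k (erefl : [::] = int_part 0).
have linp := is_linear_prod (is_linear_prod lin_sign
  (is_linear_pullback (first_block_morphism m 0) lin))
  (is_linear_pullback (last_block_perm_morphism m 0) lin0).
apply: eq_is_linear linp => g _ /=.
rewrite mulr1 /chi big_pred0 ?mul1r // => i.
by rewrite !inE subn0 ltn_ord.
Qed.

Lemma is_linear_trivial_bipartition :
  is_linear (bipartition_repr k m (int_part m) [::]) (fun=> 1).
Proof.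
by apply: (is_linear_bipartition (psi := fun=> 1)); apply: specht_trivial; rewrite subn0.
Qed.

End LinearBipartitions.

Lemma is_linear_sign_bipartition (k : fieldType) :
  is_linear (bipartition_repr k 3 (nseq 3 1%N) [::]) (fun g => (-1) ^+ hperm g).
Proof.
have lin := specht_sign k (erefl (nseq (3 - 0) 1%N)).
apply: eq_is_linear (is_linear_bipartition lin) => g _.
congr (_ ^+ odd_perm _); apply/permP=> j; apply: val_inj.
have Yg : g \in young_group 3 0 by rewrite young_group_full inE.
have := congr1 val (@hperm_first 3 [::] g j Yg) => /= <-.
by congr (val (hperm g _)); apply: val_inj.
Qed.

(** * Functions on the three-dimensional faces of the cube *)

Section Cells.
Variables (k : fieldType) (char0 : [pchar k] =i pred0) (n : nat).
Notation V := 'rV['Z_2]_n.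
Notation tri := {ffun 'I_3 -> 'I_n}.
Local Notation E i := (e (Some i)).
Local Notation M := 'rV[k]_#|{: cube_idx n}|.
Local Notation sigma := (cube_module k n).
Implicit Types (f : M) (D : {set 'I_n}) (p : cube_idx n) (v : V) (t : tri) (g : hyperoct n).

Definition clear_coords D v : V := \row_i (if i \in D then 0 else v 0 i).

(* The 3-dimensional face of the cube spanned at [p.1] by the directions [p.2]. *)
Definition cell p : {set 'I_n} * V := (p.2 @: setT, clear_coords (p.2 @: setT) p.1).

Lemma clear_coords_act D v g : clear_coords (hperm g @: D) (vertex_act v g)
  = clear_coords (hperm g @: D) (vertex_act (clear_coords D v) g).
Proof.
by apply/rowP=> i; rewrite !mxE mem_imset_perm; case: ifP.
Qed.

Lemma imset_tcomp (s : 'S_n) t : tcomp s t @: setT = s @: (t @: setT).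
Proof. by rewrite -imset_comp; apply: eq_imset => j; rewrite ffunE. Qed.

Lemma cell_act p g : cell (cube_action n p g)
  = (hperm g @: (cell p).1, clear_coords (hperm g @: (cell p).1) (vertex_act (cell p).2 g)).
Proof. by rewrite /cell /= imset_tcomp clear_coords_act. Qed.

Lemma eq_cell_act p q g : (cell (cube_action n p g) == cell (cube_action n q g))
  = (cell p == cell q).
Proof.
apply/eqP/eqP => [eq_pq | eq_pq]; last by rewrite !cell_act eq_pq.
by rewrite -[p](actK (cube_action n) g) -[q](actK (cube_action n) g) !(cell_act _ g^-1%g) eq_pq.
Qed.

Lemma cell_shift v t j : cell (v + E (t j), t) = cell (v, t).
Proof.
congr (_, _); apply/rowP=> i; rewrite !mxE eE (inj_eq (@Some_inj _)).
by case: ifPn => //; case: eqP => [<-|]; rewrite ?imset_f // addr0.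
Qed.

Lemma cell_perm v t (s : 'S_3) : cell (v, [ffun j => t (s j)]) = cell (v, t).
Proof.
suff eq_im : [ffun j => t (s j)] @: setT = t @: setT by rewrite /cell /= eq_im.
apply/setP=> i; apply/imsetP/imsetP => -[j _ ->]; first by exists (s j); rewrite ?ffunE.
by exists ((s^-1)%g j); rewrite ?ffunE ?permKV.
Qed.

Definition cell_part w f := plus_part f /\ forall p, ev f p != 0 -> cell p = w.

Definition cell_proj w : 'M[k]_#|{: cube_idx n}| :=
  lmx (fun p q => ((p == q) && (cell q == w))%:R).

Lemma ev_cell_proj w f p : ev (f *m cell_proj w) p = (cell p == w)%:R * ev f p.
Proof.
rewrite ev_lmx (bigD1 p) //= eqxx big1 ?addr0 1?mulrC // => q /negPf->.
by rewrite mulr0.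
Qed.

Lemma cell_part_proj w f : plus_part f -> cell_part w (f *m cell_proj w).
Proof.
case=> altf shiftf; split; last first.
  by move=> p; rewrite ev_cell_proj; have [-> // | _] := eqVneq (cell p) w; rewrite mul0r eqxx.
split=> [v t s|v a b c].
  by rewrite !ev_slice !ev_cell_proj cell_perm -!ev_slice altf mulrCA.
have := cell_shift v (T3 a b c) ord0; rewrite tcons0 => eq_cell.
by rewrite !ev_cell_proj eq_cell shiftf !mul1r.
Qed.

Lemma cell_projP w w' f : cell_part w f -> f *m cell_proj w' = if w == w' then f else 0.
Proof.
case=> _ supp_f; apply: ev_inj => p; rewrite ev_cell_proj.
have [f0 | /supp_f->] := eqVneq (ev f p) 0; last first.
  by case: eqP; rewrite ?mul1r ?mul0r ?ev0.
by rewrite f0 mulr0; case: ifP; rewrite ?ev0.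
Qed.

Lemma plus_part_act f g : plus_part f -> plus_part (f *m sigma g).
Proof.
move=> plusf; have [altf _] := plusf; split=> [v|v a b c].
  by rewrite slice_act; apply: tuple_repr_alt.
have actE u t : cube_action n (u, t) g^-1%g = (vertex_act u g^-1%g, tcomp (hperm g^-1%g) t) by [].
rewrite !ev_permutation !actE vertex_act_e.
have := eigencube_shift (vertex_act v g^-1%g) (tcomp (hperm g^-1%g) (T3 a b c)) ord0 plusf.
by rewrite ffunE tcons0.
Qed.

Lemma cell_part_act p f g : cell_part (cell p) f ->
  cell_part (cell (cube_action n p g)) (f *m sigma g).
Proof.
case=> plusf supp_f; split=> [|q]; first exact: plus_part_act.
rewrite ev_permutation => /supp_f eq_cell.
by apply/eqP; rewrite -[q](actKV (cube_action n) g) eq_cell_act eq_cell.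
Qed.

(** Injectivity of the directions excludes degenerate triples, which do not span a 3-dimensional
    face. *)
Definition proper_cell w := [exists p : cube_idx n, injectiveb p.2 && (cell p == w)].

Lemma plus_part_cells f : plus_part f <->
  exists2 F : _ -> M, forall w, proper_cell w -> cell_part w (F w)
    & f = \sum_(w | proper_cell w) F w.
Proof.
split=> [plusf | [F cellF ->]]; last first.
  by apply: eigencube_sum => w /cellF[].
exists (fun w => f *m cell_proj w) => [w _|]; first exact: cell_part_proj.
apply: ev_inj => p; rewrite ev_sum; have [inj_p | ninj_p] := boolP (injectiveb p.2).
  rewrite (bigD1 (cell p)) /=; last by apply/existsP; exists p; rewrite inj_p eqxx.
  rewrite ev_cell_proj eqxx mul1r big1 ?addr0 // => w /andP[_ neq_w].
  by rewrite ev_cell_proj eq_sym (negPf neq_w) mul0r.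
have f0 : ev f p = 0.
  by case: p ninj_p => v t ninj_t; rewrite -ev_slice (altf_noninj char0 (proj1 plusf v) ninj_t).
by rewrite f0 big1 // => w _; rewrite ev_cell_proj f0 mulr0.
Qed.

End Cells.

Lemma unit_expansion n (v : 'rV['Z_2]_n) : v = \sum_(i | v 0 i != 0) e (Some i).
Proof.
apply/rowP=> j; rewrite summxE (eq_bigr (fun i => (i == j)%:R)) => [|i _]; last first.
  by rewrite eE (inj_eq (@Some_inj _)).
have [v0 | nz_v] := eqVneq (v 0 j) 0; last first.
  rewrite (bigD1 j) //= eqxx big1 ?addr0 => [|i /andP[_ /negPf->]//].
  by case: (z2P (v 0 j)) nz_v => ->; rewrite ?eqxx.
rewrite v0 big1 // => i nz_v; have [def_i | //] := eqVneq i j.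
by rewrite def_i v0 eqxx in nz_v.
Qed.

Section Cubes.
Variables (k : fieldType) (char0 : [pchar k] =i pred0) (n : nat) (n_ge3 : (3 <= n)%N).
Notation V := 'rV['Z_2]_n.
Notation tri := {ffun 'I_3 -> 'I_n}.
Local Notation M := 'rV[k]_#|{: cube_idx n}|.
Local Notation sigma := (cube_module k n).
Implicit Types (f : M) (D : {set 'I_n}) (p : cube_idx n) (v : V) (t : tri) (g : hyperoct n).

Definition last3 : 'I_3 -> 'I_n := @last_inj n (nseq 3 1%N) n_ge3.
Definition corner3 : cube_idx n := (0, tcomp last3 [ffun j => j]).
Local Notation D0 := (~: first_coords n 3).

Lemma last3_inj : injective last3.
Proof. exact: (@last_inj_inj n (nseq 3 1%N) n_ge3). Qed.

Lemma imset_last3 : last3 @: setT = D0.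
Proof. exact: (@imset_last_inj n (nseq 3 1%N) n_ge3). Qed.

Lemma cell_last3 v : cell (v, corner3.2) = (D0, clear_coords D0 v).
Proof.
have im_t : corner3.2 @: setT = D0.
  by rewrite -imset_last3; apply: eq_imset => j; rewrite !ffunE.
by rewrite /cell /= im_t.
Qed.

Lemma clear_coords0 D : clear_coords D (0 : V) = 0.
Proof. by apply/rowP=> i; rewrite !mxE if_same. Qed.

Lemma cell_corner3 : cell corner3 = (D0, 0).
Proof. by rewrite [LHS]cell_last3 clear_coords0. Qed.

Lemma cell_corner3_act g :
  (cell (cube_action n corner3 g) == cell corner3) = (g \in sym_hyp_group n 3).
Proof.
rewrite cell_act cell_corner3 xpair_eqE /= imset_permC (inj_eq (can_inj (@setCK _))).
rewrite [RHS]inE [in RHS]inE; case: eqP => //= ->.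
rewrite /vertex_act perm_coord0 addr0; apply/eqP/forall_inP => [/rowP s0 i Fi | s0].
  by have := s0 i; rewrite !mxE inE Fi /= => ->.
apply/rowP=> i; rewrite !mxE inE; case: ifPn => //; rewrite negbK.
by move/s0/eqP.
Qed.

(** The group acts transitively on 3-dimensional faces: a permutation moves the directions and a
    translation moves the base point. *)
Lemma proper_cellP w :
  reflect (exists g, cell (cube_action n corner3 g) = w) (proper_cell w).
Proof.
apply: (iffP existsP) => [[[v t] /andP[/injectiveP inj_t /eqP <-]] | [g <-]]; last first.
  exists (cube_action n corner3 g); rewrite eqxx andbT /= !injective_tcomp.
  - by apply/injectiveP=> i j; rewrite !ffunE.
  - exact: last3_inj.
  exact: perm_inj.
have [|s def_s] := @set_transitive _ D0 (t @: setT).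
  by rewrite -imset_last3 !card_imset //; apply: last3_inj.
exists (Hyperoct v s); rewrite cell_act cell_corner3 /= def_s /cell /=.
by rewrite /vertex_act perm_coord0 addr0.
Qed.

Lemma plus_part_shift f v t : plus_part f -> clear_coords (t @: setT) v = 0 ->
  ev f (v, t) = ev f (0, t).
Proof.
move=> plusf /rowP maskv; rewrite -{1}[v]add0r [v in 0 + v]unit_expansion; move: {1 3}0.
elim/big_rec: _ => [|i x nz_vi IHx] u; first by rewrite addr0.
rewrite addrA IHx; have := maskv i; rewrite !mxE; case: ifP => [/imsetP[j _ ->] _ | _ vi0].
  by rewrite (eigencube_shift _ _ _ plusf) mul1r.
by rewrite vi0 eqxx in nz_vi.
Qed.

(** On one face the value is unchanged when the base point moves and changes by a sign when the
    directions are reordered, so a single value determines the function. *)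
Lemma cell_part_eq0 f : cell_part (cell corner3) f -> ev f corner3 = 0 -> f = 0.
Proof.
case=> plusf supp_f f0; apply: ev_inj => -[v t]; rewrite ev0; apply/eqP/negPn/negP=> nz_f.
have [im_t mask_v] := supp_f _ nz_f; rewrite clear_coords0 in mask_v.
have inj_t : injective t.
  apply/injectiveP; apply: contraNT nz_f => ninj.
  by rewrite -ev_slice (altf_noninj char0 (proj1 plusf v) ninj).
have /fin_all_exists[s def_s] j : exists l, t j = corner3.2 l.
  have : t j \in corner3.2 @: setT by rewrite -im_t imset_f.
  by case/imsetP=> l _ ->; exists l.
have inj_s : injective s by move=> i j eq_s; apply: inj_t; rewrite !def_s eq_s.
have def_t : t = [ffun j => corner3.2 (perm inj_s j)].
  by apply/ffunP=> j; rewrite ffunE permE.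
case/eqP: nz_f; rewrite plus_part_shift // def_t -ev_slice (proj1 plusf 0).
by rewrite ev_slice -/corner3 f0 mulr0.
Qed.

(* The orientation class of the face through the origin in the last three     *)
(* directions, constant in the base point.                                    *)
Definition cube0 : M :=
  osimplex k [ffun j => j] *m blockmx last3 (fun v => (clear_coords D0 v == 0)%:R).

Lemma cell_part_cube0 : cell_part (cell corner3) cube0.
Proof.
have im_t (t' : {ffun 'I_3 -> 'I_3}) : injective t' -> tcomp last3 t' @: setT = D0.
  move=> inj_t'; have inj_t : injective (tcomp last3 t').
    by move=> i j; rewrite !ffunE => /last3_inj/inj_t'.
  apply/eqP; rewrite eqEcard -imset_last3 (card_imset _ last3_inj) (card_imset _ inj_t).
  by rewrite leqnn andbT; apply/subsetP=> _ /imsetP[j _ ->]; rewrite ffunE imset_f.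
have altz := alt_osimplex k ([ffun j => j] : {ffun 'I_3 -> 'I_3}).
have slice_alt v : alt (slice cube0 v).
  by rewrite slice_block; apply/altZ/alt_push.
have supp0 v t : ev cube0 (v, t) != 0 -> t @: setT = D0 /\ clear_coords D0 v = 0.
  rewrite -ev_slice slice_block evZ mulf_eq0 negb_or => /andP[].
  have [maskv _ nz_t | _] := eqVneq (clear_coords D0 v) 0; last by rewrite eqxx.
  split=> //; have inj_t : injectiveb t.
    by apply: contraNT nz_t => ninj; rewrite (altf_noninj char0 (alt_push last3 altz) ninj).
  case: (pickP (fun t' : {ffun 'I_3 -> 'I_3} => tcomp last3 t' == t)) => [t' /eqP def_t | out]; last first.
    case/eqP: nz_t; apply: ev_push_out => t' def_t.
    by have := out t'; rewrite def_t eqxx.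
  rewrite -def_t; apply: im_t; apply/injectiveP.
  by rewrite -(injective_tcomp last3_inj) def_t.
split; last first.
  by move=> [v t] /supp0[im_t0 maskv]; rewrite cell_corner3 /cell /= im_t0 maskv.
split=> // v a b c; rewrite mul1r -!ev_slice !slice_block !evZ.
have [-> | nz_t] := eqVneq (ev (osimplex k [ffun j => j] *m push k last3 2) (T3 a b c)) 0.
  by rewrite !mulr0.
congr (_%:R * _); congr (nat_of_bool (_ == _)).
have Da : a \in D0.
  have [t' def_t] : exists t' : {ffun 'I_3 -> 'I_3}, tcomp last3 t' = T3 a b c.
    case: (pickP (fun t' : {ffun 'I_3 -> 'I_3} => tcomp last3 t' == T3 a b c)) => [t' /eqP def_t | out]; first by exists t'.
    by case/eqP: nz_t; apply: ev_push_out => t' def_t; have := out t'; rewrite def_t eqxx.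
  by rewrite -(tcons0 a (T2 b c)) -/(T3 a b c) -def_t ffunE -imset_last3 imset_f.
apply/rowP=> i; rewrite !mxE; case: ifPn => // out_i.
by rewrite eE (inj_eq (@Some_inj _)); case: eqP out_i => [<-|]; rewrite ?Da ?addr0.
Qed.

Lemma ev_cube0 : ev cube0 corner3 = 1.
Proof.
rewrite -ev_slice slice_block evZ (ev_push_in last3_inj) ev_osimplex.
rewrite clear_coords0 eqxx mul1r (bigD1 1%g) //= big1 ?addr0 => [|s neq_s].
  by rewrite odd_perm1 mul1r (_ : _ == _) //; apply/eqP/ffunP=> j; rewrite !ffunE perm1.
case: eqP => [/ffunP eq_s | _]; last by rewrite mulr0.
by case/eqP: neq_s; apply/permP=> j; have := eq_s j; rewrite !ffunE perm1.
Qed.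

Lemma cell_part_line f : cell_part (cell corner3) f <-> (f <= cube0)%MS.
Proof.
have [[alt_c shift_c] supp_c] := cell_part_cube0.
have cellD u a : cell_part (cell corner3) u -> cell_part (cell corner3) (u + a *: cube0).
  case=> [[altu shiftu] suppu]; split; last first.
    move=> p; have [u0 | /suppu //] := eqVneq (ev u p) 0.
    by rewrite evD u0 add0r evZ mulf_eq0 negb_or => /andP[_ /supp_c].
  split=> [v|v a' b c]; last by rewrite !evD !evZ shiftu shift_c !mul1r.
  by rewrite sliceD /slice -scalemxAl; apply: altD; [exact: altu | exact/altZ/alt_c].
have cell0 : cell_part (cell corner3) 0.
  split; last by move=> p; rewrite ev0 eqxx.
  by split=> [v|v a b c]; rewrite ?ev0 ?mul1r // /slice mul0mx; apply: alt0.
split=> [cellf | /sub_rVP[a ->]]; last by rewrite -[a *: _]add0r; apply: cellD.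
have := cell_part_eq0 (cellD f (- ev f corner3) cellf).
rewrite evD evZ ev_cube0 mulr1 subrr => /(_ erefl)/eqP.
by rewrite scaleNr subr_eq0 => /eqP->; apply: scalemx_sub.
Qed.

(** An element fixing the face permutes its base points, on which [cube0] is constant, and reorders
    its three directions, which changes the orientation by the sign of that permutation. *)
Lemma cube0_act g : g \in sym_hyp_group n 3 ->
  cube0 *m sigma g = (-1) ^+ last_block_perm 3 g *: cube0.
Proof.
move=> Hg; have Yg : g \in young_group n 3 := subsetP (sym_hyp_sub n 3) g Hg.
have block_g j : hperm g (last3 j) = last3 (last_block_perm 3 g j).
  exact: (@hperm_last n (nseq 3 1%N) n_ge3 g j Yg).
have mask_g v : clear_coords D0 (vertex_act v g) == 0 = (clear_coords D0 v == 0).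
  have actD : hperm g @: D0 = D0 := @young_w0 n (nseq 3 1%N) g Yg.
  have := eq_cell_act (v, corner3.2) corner3 g; rewrite -cell_corner3_act in Hg.
  rewrite (eqP Hg) cell_act cell_last3 cell_corner3 /= -clear_coords_act actD.
  by rewrite !xpair_eqE eqxx.
rewrite /cube0 -(block_hom (c := 1) _ block_g) ?mulr1 // => [|v]; last first.
  by rewrite mask_g mul1r.
rewrite scale1r osimplex_act; have -> : tuple_act (perm_action 'I_3) [ffun j => j] (last_block_perm 3 g)
    = [ffun j => [ffun j => j] (last_block_perm 3 g j)].
  by apply/ffunP=> j; rewrite !ffunE.
by rewrite osimplex_perm -scalemxAl.
Qed.

(** The faces are the cosets of the stabilizer of the one at [corner3], which is the subgroup
    S_(n-3) x H_3. The functions on that face form the line of [cube0], on which the stabilizer acts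
    by the sign of the last block, the one-dimensional module being induced. *)
Lemma embeds_cubes :
  embeds (ind_sym_hyp_repr k n 3 (int_part (n - 3)) (nseq 3 1%N) [::]) sigma (@plus_part k n).
Proof.
apply: embeds_ext (embeds_induced (kappa := fun g => cell (cube_action n corner3 g))
  (O := @proper_cell n) (P := cell_part (cell corner3)) (Q := @cell_part k n)
  (pi := @cell_proj k n) _ proper_cellP _ _ _) => [f|g h|g f|w w' f _|].
- by split=> /(plus_part_cells char0).
- rewrite -cell_corner3_act actM -[in RHS](eq_cell_act _ _ h) actKV.
  by [].
- split=> [|cellf]; first exact: cell_part_act.
  have := cell_part_act g^-1%g cellf; rewrite actK -mulmxA -repr_mxM ?inE // mulgV.
  by rewrite repr_mx1 mulmx1.
- exact: cell_projP.
have lin := is_linear_subg (sym_hyp_sub n 3) (is_linear_prod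
  (is_linear_pullback (first_block_morphism n 3) (specht_trivial k (erefl (int_part (n - 3)))))
  (is_linear_pullback (last_block_morphism n 3) (is_linear_sign_bipartition k))).
apply: embeds_ext (linear_embeds (u := cube0) lin _ _) => [f||g Hg].
- by split=> /cell_part_line.
- by apply: contraTneq (oner_neq0 k) => c0; rewrite -ev_cube0 c0 ev0 eqxx.
by rewrite /= mul1r; apply: cube0_act.
Qed.

End Cubes.

(** * Degree zero: connectedness *)

Section Connected.
Variables (k : fieldType) (char0 : [pchar k] =i pred0) (n : nat).
Notation V := 'rV['Z_2]_n.
Notation vtup i := {ffun 'I_i.+1 -> V}.
Local Notation E i := (e (Some i)).
Local Notation K := (rips n 2).
Local Notation point x := (pt k (@T1 V x)).

Lemma osimplex_T1 (x : V) : osimplex k (T1 x) = point x.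
Proof.
apply: ev_inj => y; rewrite ev_osimplex (big_pred1 1%g) => [|s]; last first.
  by apply/esym/eqP/permP=> j; rewrite !ord1.
rewrite odd_perm1 mul1r ev_pt; congr (nat_of_bool (_ == _))%:R.
by apply/ffunP=> j; rewrite !ffunE perm1.
Qed.

Lemma osimplex_chain i (x : vtup i) : is_osimplex K x -> (osimplex k x <= chains k K i)%MS.
Proof. by move=> Kx; rewrite (sumsmx_sup x) ?genmxE. Qed.

Lemma vertex_chain (x : V) : (point x <= chains k K 0)%MS.
Proof.
rewrite -osimplex_T1; apply: osimplex_chain; rewrite /is_osimplex injective_T1.
apply/rips_tuple => j l; rewrite !ord1 tcons0; apply/hammingP.
by exists None, None; rewrite !e0 !addr0.
Qed.

Lemma edge_boundary (x : V) (i : 'I_n) : (point (phi x (Some i)) - point x <= boundaries k K 0)%MS.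
Proof.
have neq_x : x != phi x (Some i).
  by rewrite -{1}[x]addr0 -(e0 n) -/(phi x None) (inj_eq (@phi_inj n x)).
apply/boundariesP; exists (osimplex k (T2 x (phi x (Some i)))).
  apply: osimplex_chain; rewrite /is_osimplex injective_T2 neq_x.
  have vert j : exists a, T2 x (phi x (Some i)) j = x + e a.
    have := codom_f (T2 x (phi x (Some i))) j; rewrite codom_tcons codom_T1.
    by case/orP=> /eqP->; [exists None; rewrite e0 addr0 | exists (Some i)].
  apply/rips_tuple => j l; have [a ->] := vert j; have [b ->] := vert l.
  by apply/hammingP; exists a, b; rewrite addvK.
rewrite osimplex_boundary !big_ord_recl big_ord0 addr0 expr0 expr1 scale1r scaleN1r.
rewrite face_tcons !osimplex_T1; congr (_ - _); rewrite -osimplex_T1.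
rewrite (_ : face _ _ = T1 x) //; apply/ffunP=> j; rewrite !ord1 ffunE.
by rewrite (_ : lift _ _ = ord0) ?tcons0 //; apply: val_inj.
Qed.

Lemma connected (x : V) : (point x - point 0 <= boundaries k K 0)%MS.
Proof.
rewrite [x in T1 x]unit_expansion; elim/big_rec: _ => [|i y _ IHy]; first by rewrite subrr sub0mx.
by rewrite (addrC (E i)) -/(phi y (Some i)) -(subrKA (point y)) addmx_sub // edge_boundary.
Qed.

(** The augmentation has the boundaries as its kernel: a chain with coefficient sum zero is a
    combination of differences of a vertex and the origin, which bound by [connected]. It is
    invariant under the action, so the quotient is the trivial line. *)
Lemma homology0 d (rho : mx_representation k [set: hyperoct n] d) :
  is_linear rho (fun=> 1) -> mx_rsim (rips_homology k n 2 0) rho.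
Proof.
case=> d1; move: rho; rewrite d1 => rho lin.
pose aug : 'M[k]_(#|{: vtup 0}|, 1) := const_mx 1.
have augE (c : 'rV[k]_#|{: vtup 0}|) : c *m aug = (\sum_x ev c (T1 x))%:M.
  apply/matrixP=> i j; rewrite !ord1 !mxE eqxx -(sum_T1 (ev c)).
  rewrite [RHS](reindex_onto (@enum_val _ {: vtup 0}) enum_rank) /=; last by move=> *; apply: enum_rankK.
  apply: eq_big => [l|l _]; first by rewrite enum_valK eqxx.
  by rewrite mxE mulr1 /ev enum_valK.
have sBZ : (boundaries k K 0 <= cycles k K 0)%MS.
  by apply: boundaries_sub_cycles => B C; apply: rips_down.
have homA : {in [set: hyperoct n], forall g, tuple_repr k (vertex_action n) 0 g *m aug = aug *m rho g}.
  move=> g _; rewrite lin ?inE // mulmx1; apply: matrix_pt_eq => x.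
  by rewrite mulmxA pt_act -!rowE !row_const.
have kerA (c : 'rV[k]_#|{: vtup 0}|) : (c <= cycles k K 0)%MS ->
    c *m aug = 0 <-> (c <= boundaries k K 0)%MS.
  move=> _; rewrite augE; split=> [c0 | /boundariesP[b /(chainsP char0)[altb _] ->]]; last first.
    rewrite (eq_bigr _ (fun x _ => ev_boundary b (T1 x))).
    by rewrite (sum_alt2 char0 altb); apply/rowP=> j; rewrite !mxE mul0rn.
  have sum0 : \sum_x ev c (T1 x) = 0 by have /matrixP/(_ 0 0) := c0; rewrite !mxE eqxx.
  have -> : c = \sum_x ev c (T1 x) *: (point x - point 0).
    under eq_bigr => x _ do rewrite scalerBr.
    rewrite sumrB -scaler_suml sum0 scale0r subr0 {1}[c]fv_sum_pt.
    apply: ev_inj => y; rewrite !ev_sum (sum_T1 (fun t => ev (ev c t *: pt k t) y)).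
    by [].
  by apply: summx_sub => x _; rewrite scalemx_sub // connected.
have embH := embeds_section (boundaries_module k (@rips_acts n 2) 0)
  (cycles_module k (@rips_acts n 2) 0) sBZ homA kerA.
apply: (embeds_rsim (P := fun=> True) (sigma := rho)).
  apply: embeds_ext embH => u; split=> // _; exists (u 0 0 *: point 0).
    by rewrite scalemx_sub // vertex_chain.
  rewrite -scalemxAl -rowE row_const; apply/rowP=> j.
  by rewrite !ord1 !mxE mulr1.
exists 1%:M; split=> [|g _|u]; first by rewrite row_free_unit unitmx1.
  by rewrite mulmx1 mul1mx.
by split=> // _; rewrite submx1.
Qed.

End Connected.

(* Comparison of the realizations *)
Close Scope ring_scope.
Close Scope group_scope.

Theorem theorem5p4 (k : fieldType) (char0 : [pchar k]%R =i pred0)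
    (n : nat) (n_ge3 : 3 <= n) :
  let H i := rips_homology k n 2 i in
  let hooks :=
    \big[dadd_grepr/grepr0]_(1 <= j < n - 2)
      bipartition_repr k n (int_part (n - 3 - j)) (j :: nseq 3 1) in
  let first_form :=
    dadd_grepr hooks (ind_sym_hyp_repr k n 3 (int_part (n - 3)) (nseq 3 1) [::]) in
  let second_form :=
    dadd_grepr hooks
      (\big[dadd_grepr/grepr0]_(0 <= j < 2)
         \big[dadd_grepr/grepr0]_(0 <= i < n - 2 - j)
           bipartition_repr k n ((n - 2 - i - j) :: nseq (2 + j) 1) (int_part i)) in
  [/\ forall i : nat, i != 0 -> i != 3 -> rdegree (H i) = 0,
      mx_rsim (H 0) (bipartition_repr k n (int_part n) [::]),
      mx_rsim (H 3) first_form
    & mx_rsim first_form second_form].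
Proof.
move=> H hooks first_form second_form.
have emb_ind := embeds_cubes char0 n_ge3.
split.
- move=> [|[|[|[|i]]]] // _ _; apply: rdegree_homology0.
  + exact: homology1.
  + exact: homology2.
  by apply: homology_high.
- exact/homology0/is_linear_trivial_bipartition.
(* Both sides are realized in [cube_module] on the subspace [cube_image], the first form through its
   sign -1 and sign 1 parts. *)
- apply: embeds_rsim (embeds_homology3 char0 n) _.
  apply: embeds_ext (embeds_dadd (@minus_plus_direct _ char0 _) (embeds_hooks char0 n) emb_ind) => f.
  by split=> /(cube_image_split char0).
apply: dadd_rsim; first exact: mx_rsim_refl.
exact: embeds_rsim emb_ind (embeds_second char0 n).
Qed.
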